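(* Let $p$ be an odd prime and let $B$ be a compact flat $n$-manifold with $b_1(B)=0$ and holonomy group $H\cong(C_p)^k$ for some $k\ge2$. If $B$ appears as a cusp cross-section in a quasi-arithmetic hyperbolic manifold corresponding to a rational quadratic form $q$ of signature $(n+1,1)$, then, in $\mathbb{Q}^\times/(\mathbb{Q}^\times)^2$, \[d(q)=\begin{cases}-1 &\text{if } n\equiv 0\bmod 2(p-1),\\ -p &\text{if } n\equiv p-1\bmod 2(p-1).\end{cases}\]
   Context: $C_p$ is the cyclic group of order $p$ and $b_1$ is the first Betti number. The holonomy group of a compact flat $n$-manifold $B$ is the finite group $\pi_1(B)/T$, where $\pi_1(B)$ is embedded as a discrete subgroup of $O(n)\ltimes\mathbb{R}^n$ and $T\cong\mathbb{Z}^n$ is its subgroup of translations. Rational quadratic forms are non-degenerate quadratic forms over $\mathbb{Q}$. The discriminant $d(q)\in\mathbb{Q}^\times/(\mathbb{Q}^\times)^2$ of $q$ is the class of the determinant of a symmetric matrix representing $q$ (so $d(\langle a_1,\dots,a_m\rangle)=\prod a_i$). For $q$ a rational quadratic form of signature $(n+1,1)$, $\mathbb{H}_q^{n+1}$ denotes one of the two sheets of $\{x\in\mathbb{R}^{n+2}\mid q(x)=-1\}$ with the metric induced by $q$ (a model of hyperbolic $(n+1)$-space), $O^+(q;\mathbb{R})$ is the index-two subgroup of the real orthogonal group of $q$ preserving it, and $O^+(q;\mathbb{Q})=O^+(q;\mathbb{R})\cap GL_{n+2}(\mathbb{Q})$. A quasi-arithmetic hyperbolic manifold associated (corresponding) to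 $q$ is a finite-volume hyperbolic manifold of the form $\mathbb{H}_q^{n+1}/\Gamma$, where $\Gamma\le O^+(q;\mathbb{R})$ is discrete, torsion-free and commensurable to a subgroup of $O^+(q;\mathbb{Q})$ (two groups are commensurable if their intersection has finite index in both). $B$ appears as a cusp cross-section in a hyperbolic manifold $M$ if $M$ has a cusp diffeomorphic to $B\times\mathbb{R}_{\ge0}$. *)

(* Defs.v *)
From HB Require Import structures.
From mathcomp Require Import all_boot all_order all_algebra.
From mathcomp Require Import all_classical all_reals all_analysis.

Set Implicit Arguments.
Unset Strict Implicit.
Unset Printing Implicit Defensive.

Import Order.TTheory GRing.Theory Num.Theory.
Import numFieldNormedType.Exports.

Local Open Scope classical_set_scope.
Local Open Scope ring_scope.

Section MatrixGroups.
Variables (R : realType) (m : nat).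
Implicit Types G K : set 'M[R]_m.+1.

Definition subgroup G : Prop :=
  [/\ forall g, G g -> g \in unitmx, G 1,
      forall g h, G g -> G h -> G (g * h) & forall g, G g -> G g^-1].

Definition discrete_group G : Prop :=
  exists2 eps : R, 0 < eps & forall g, G g -> ball (1 : 'M[R]_m.+1) eps g -> g = 1.

Definition torsion_free G : Prop :=
  forall g d, G g -> (0 < d)%N -> g ^+ d = 1 -> g = 1.

Definition finite_index K G : Prop :=
  K `<=` G /\ exists s : seq 'M[R]_m.+1,
    (forall h, h \in s -> G h) /\
    (forall g, G g -> exists2 h, h \in s & K (h^-1 * g)).

Definition commensurable G K : Prop :=
  finite_index (G `&` K) G /\ finite_index (G `&` K) K.

Definition derived_subgroup G : set 'M[R]_m.+1 :=
  smallest subgroup [set c | exists g h, [/\ G g, G h & c = g^-1 * h^-1 * g * h]].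

(* Z-linear independence in G / [G, G] of the classes of s_0, ..., s_(r-1). *)
Definition abel_independent G r (s : 'I_r -> 'M[R]_m.+1) : Prop :=
  (forall i, G (s i)) /\
  forall c : 'I_r -> int,
    derived_subgroup G (\prod_(i < r) s i ^ c i) -> forall i, c i = 0.

Definition abel_rank G r : Prop :=
  (exists s : 'I_r -> 'M[R]_m.+1, abel_independent G s) /\
  ~ (exists s : 'I_r.+1 -> 'M[R]_m.+1, abel_independent G s).

(* G / N is isomorphic to the additive group V, via a surjective homomorphism
   G -> V with kernel N; the values of f outside G are irrelevant. *)
Definition quotient_isom G (N : set 'M[R]_m.+1) (V : zmodType) : Prop :=
  exists f : 'M[R]_m.+1 -> V,
    [/\ forall g h, G g -> G h -> f (g * h) = f g + f h,
        forall v, exists2 g, G g & f g = v &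
        forall g, G g -> (f g = 0 <-> N g)].

End MatrixGroups.

Section Smoothness.
Variables (R : realType) (a b : nat).
Implicit Types (O : set 'cV[R]_a.+1) (f : 'cV[R]_a.+1 -> 'cV[R]_b.+1).

Fixpoint Ck (r : nat) O f : Prop :=
  (forall x, O x -> {for x, continuous f}) /\
  if r is r'.+1 then
    forall v : 'cV[R]_a.+1,
      (forall x, O x -> derivable f x v) /\ Ck r' O (fun x => 'D_v f x)
  else True.

Definition Cinfty O f : Prop := forall r, Ck r O f.

End Smoothness.

(* Orbit spaces. If a group acts on R^(a+1) with orbits oX z, the orbit space of
   a subset X is the set of the oX x with x in X; similarly for Y and oY.  When
   X and Y are submanifolds (possibly with boundary) of Euclidean spaces and the
   projections to the orbit spaces are coverings, a map phi of orbit spaces is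
   smooth iff near every point it lifts to a map X -> Y which extends to a
   smooth map on a neighbourhood in Euclidean space. *)
Definition quotient_smooth (R : realType) (a b : nat)
    (X : set 'cV[R]_a.+1) (oX : 'cV[R]_a.+1 -> set 'cV[R]_a.+1)
    (Y : set 'cV[R]_b.+1) (oY : 'cV[R]_b.+1 -> set 'cV[R]_b.+1)
    (phi : set 'cV[R]_a.+1 -> set 'cV[R]_b.+1) : Prop :=
  forall x, X x -> exists (O : set 'cV[R]_a.+1) (f : 'cV[R]_a.+1 -> 'cV[R]_b.+1),
    [/\ open O, O x, Cinfty O f &
        forall z, X z -> O z -> Y (f z) /\ phi (oX z) = oY (f z)].

Definition quotient_diffeomorphic (R : realType) (a b : nat)
    (X : set 'cV[R]_a.+1) (oX : 'cV[R]_a.+1 -> set 'cV[R]_a.+1)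
    (Y : set 'cV[R]_b.+1) (oY : 'cV[R]_b.+1 -> set 'cV[R]_b.+1) : Prop :=
  exists (phi : set 'cV[R]_a.+1 -> set 'cV[R]_b.+1)
         (psi : set 'cV[R]_b.+1 -> set 'cV[R]_a.+1),
    [/\ quotient_smooth X oX Y oY phi, quotient_smooth Y oY X oX psi,
        forall x, X x -> psi (phi (oX x)) = oX x &
        forall y, Y y -> phi (psi (oY y)) = oY y].

Section FlatManifolds.
Variables (R : realType) (n : nat).

(* The isometry x |-> L x + v of R^n is represented by the matrix
     / 1 0 \
     \ v L /
   acting on the column vectors (1; x); composition is the matrix product. *)
Definition lin_part (g : 'M[R]_n.+1) : 'M[R]_n := drsubmx (g : 'M[R]_(1 + n)).
Definition trans_part (g : 'M[R]_n.+1) : 'cV[R]_n := dlsubmx (g : 'M[R]_(1 + n)).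

Definition isometry (g : 'M[R]_n.+1) : Prop :=
  exists (L : 'M[R]_n) (v : 'cV[R]_n),
    L^T *m L = 1%:M /\ g = block_mx (1%:M : 'M[R]_1) 0 v L.

Definition isom_act (g : 'M[R]_n.+1) (x : 'cV[R]_n) : 'cV[R]_n :=
  lin_part g *m x + trans_part g.

(* B = R^n / pi is a compact flat n-manifold with fundamental group pi. *)
Definition compact_flat_manifold (pi : set 'M[R]_n.+1) : Prop :=
  [/\ subgroup pi, forall g, pi g -> isometry g, discrete_group pi,
      forall g x, pi g -> isom_act g x = x -> g = 1 &
      exists2 K : set 'cV[R]_n, compact K &
        forall x, exists2 g, pi g & K (isom_act g x)].

Definition translations (pi : set 'M[R]_n.+1) : set 'M[R]_n.+1 :=
  [set g | pi g /\ lin_part g = 1%:M].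

Definition holonomy_isom (pi : set 'M[R]_n.+1) (V : zmodType) : Prop :=
  quotient_isom pi (translations pi) V.

(* H_1(B; Z) is the abelianization of pi. *)
Definition first_betti (pi : set 'M[R]_n.+1) (r : nat) : Prop := abel_rank pi r.

(* R^n x [0, +oo[, with points (t; x) where t >= 0 is the coordinate 0, and the
   orbits of pi acting on the factor R^n. *)
Definition half_cylinder : set 'cV[R]_n.+1 := [set z | 0 <= z ord0 ord0].

Definition half_cylinder_orbit (pi : set 'M[R]_n.+1) (z : 'cV[R]_n.+1) :
    set 'cV[R]_n.+1 :=
  [set (col_mx (usubmx (z : 'cV[R]_(1 + n)))
               (isom_act g (dsubmx (z : 'cV[R]_(1 + n)))) : 'cV[R]_(1 + n))
   | g in pi].

End FlatManifolds.

Section QuadraticForms.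

Definition sqclass (a : rat) : set rat := [set a * c ^+ 2 | c in [set c : rat | c != 0]].

Definition disc (m : nat) (A : 'M[rat]_m) : set rat := sqclass (\det A).

Definition rational_form (m : nat) (A : 'M[rat]_m) : Prop :=
  A^T = A /\ \det A != 0.

Definition realmx (R : realType) (m : nat) (A : 'M[rat]_m) : 'M[R]_m :=
  map_mx (@ratr R) A.

Definition signature_n1 (R : realType) (n : nat) (A : 'M[rat]_n.+2) : Prop :=
  exists2 P : 'M[R]_n.+2, P \in unitmx &
    P^T *m realmx R A *m P = diag_mx (\row_i (if i == ord_max then -1 else 1)).

End QuadraticForms.

Section LebesgueOuterMeasure.
Variables (R : realType) (m : nat).

Definition box (a b : 'cV[R]_m) : set 'cV[R]_m :=
  [set x | forall i, a i ord0 <= x i ord0 <= b i ord0].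

Definition box_volume (a b : 'cV[R]_m) : R := \prod_i (b i ord0 - a i ord0).

Definition lebesgue_outer (C : set 'cV[R]_m) : \bar R :=
  ereal_inf [set s | exists a b : nat -> 'cV[R]_m,
    [/\ forall k i, a k i ord0 <= b k i ord0,
        C `<=` \bigcup_k box (a k) (b k) &
        s = (\sum_(0 <= k <oo) (box_volume (a k) (b k))%:E)%E]].

End LebesgueOuterMeasure.

Section HyperbolicManifolds.
Variables (R : realType) (n : nat) (A : 'M[rat]_n.+2).

(* q has matrix A; e is a vector with q e = -1, selecting a sheet. *)
Definition bform (x y : 'cV[R]_n.+2) : R := (x^T *m realmx R A *m y) ord0 ord0.
Definition qform (x : 'cV[R]_n.+2) : R := bform x x.

Variable e : 'cV[R]_n.+2.

(* The sheet of {q = -1} containing e: for x, y in {q = -1} one has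
   |b(x, y)| >= 1, with b(x, y) < 0 exactly when x, y are in the same sheet. *)
Definition hyperboloid : set 'cV[R]_n.+2 := [set x | qform x = -1 /\ bform x e < 0].

Definition Oplus : set 'M[R]_n.+2 :=
  [set g | g^T *m realmx R A *m g = realmx R A /\
           forall x, hyperboloid x -> hyperboloid (g *m x)].

Definition OplusQ : set 'M[R]_n.+2 :=
  [set g | Oplus g /\ exists g0 : 'M[rat]_n.+2, g = realmx R g0].

Definition cone (D : set 'cV[R]_n.+2) : set 'cV[R]_n.+2 :=
  [set y | exists t x, [/\ 0 < t <= 1, D x & y = t *: x]].

(* In coordinates where q is the standard Minkowski form, Lebesgue measure is
   r^(n+1) dr dvol on the cone over the sheet, whence
   vol D = (n+2) Leb (cone D); the change of coordinates contributes
   the factor sqrt |det A|. *)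
Definition hyp_volume (D : set 'cV[R]_n.+2) : \bar R :=
  ((n.+2%:R * Num.sqrt `|\det (realmx R A)|)%:E * lebesgue_outer (cone D))%E.

(* Volume of the quotient: infimum of the volumes of the sets meeting every
   orbit (attained by fundamental domains when Gamma is discrete). *)
Definition covolume (Gamma : set 'M[R]_n.+2) : \bar R :=
  ereal_inf [set hyp_volume D | D in [set D : set 'cV[R]_n.+2 |
    D `<=` hyperboloid /\
    forall x, hyperboloid x -> exists2 g, Gamma g & D (g *m x)]].

Definition quasi_arithmetic_manifold (Gamma : set 'M[R]_n.+2) : Prop :=
  [/\ subgroup Gamma /\ Gamma `<=` Oplus, discrete_group Gamma, torsion_free Gamma,
      (covolume Gamma < +oo)%E &
      exists G : set 'M[R]_n.+2,
        [/\ subgroup G, G `<=` OplusQ & commensurable Gamma G]].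

(* Every closed horoball has this form for a unique future-pointing null vector
   xi: rescaling xi changes the level. *)
Definition ideal_vector (xi : 'cV[R]_n.+2) : Prop :=
  qform xi = 0 /\ forall x, hyperboloid x -> bform x xi < 0.

Definition horoball (xi : 'cV[R]_n.+2) : set 'cV[R]_n.+2 :=
  [set x | hyperboloid x /\ -1 <= bform x xi].

(* The image of the horoball in the quotient by Gamma is a cusp: its centre is a
   parabolic fixed point and the horoball is disjoint from its translates by
   the elements of Gamma which do not preserve it. *)
Definition cusp_horoball (Gamma : set 'M[R]_n.+2) (xi : 'cV[R]_n.+2) : Prop :=
  [/\ ideal_vector xi,
      exists g, [/\ Gamma g, g <> 1 & g *m xi = xi] &
      forall g x, Gamma g -> horoball xi x -> horoball xi (g *m x) -> g *m xi = xi].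

Definition linear_orbit (Gamma : set 'M[R]_n.+2) (x : 'cV[R]_n.+2) :
    set 'cV[R]_n.+2 := [set g *m x | g in Gamma].

(* The quotient by Gamma has a cusp diffeomorphic to (R^n / pi) x [0, +oo[. *)
Definition cusp_cross_section (pi : set 'M[R]_n.+1) (Gamma : set 'M[R]_n.+2) : Prop :=
  exists2 xi, cusp_horoball Gamma xi &
    quotient_diffeomorphic (@half_cylinder R n) (half_cylinder_orbit pi)
                           (horoball xi) (linear_orbit Gamma).

End HyperbolicManifolds.

(* Main.v *)
Require Import Defs.
From HB Require Import structures.
From mathcomp Require Import all_boot all_order all_fingroup all_algebra all_field.
From mathcomp Require Import all_classical all_reals all_analysis.
From mathcomp Require Import ring lra zify.

(** Why the theorem holds.  Let xi be the null vector of the cusp.  In a basis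
formed by xi, an opposite null vector eta and an orthonormal basis of their
complement, the stabilizer of xi in the orthogonal group of q is the group of
isometries of R^n (null_form_stabilizer), acting on the horoballs centred at xi
as on the half cylinder [0, +oo[ x R^n (horo_pt_act).  So the cusp
cross-section hypothesis gives a homeomorphism between the orbit spaces of the
half cylinder under pi and under a discrete group of isometries, the cusp group
of Gamma.  The half cylinder being contractible, this homeomorphism and its
inverse lift to it, and conjugation by the lift is an injective homomorphism phi
from pi to the cusp group (cross_section_injection).

The translations of pi form a group Z^n of finite index.  As in Bieberbach's
theorem, a discrete group of isometries of R^n isomorphic to Z^n contains
translations only, and these span R^n (transported_translations).  The linear
parts of the phi g therefore represent the holonomy group: they commute, their
p-th powers are 1, and a common fixed vector would give a nonzero homomorphism
from pi to the reals, against b_1 = 0 (hol_lin_fixed).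

Quasi-arithmeticity makes a power of every parabolic translation a rational
matrix, hence also its logarithm (rational_log).  Consequently the line of xi
is rational, and the translation vectors span a rational form of the quotient
of the orthogonal of xi by xi.  If G is the rational Gram matrix of a basis of
translations, q is the sum of a hyperbolic plane and of G, so that
d(q) = - det G (disc_cusp_form); moreover the holonomy acts by rational matrices
preserving G (rational_holonomy).

It remains to compute det G.  An element h <> 1 of the holonomy splits the space
into the orthogonal sum of its fixed vectors and of the image of h - 1; by
induction on the dimension it is enough to treat the second part
(det_form_exponent_p).  There the eigenvalues of h are primitive p-th roots of
unity, so the characteristic polynomial of h is a power of the cyclotomic
polynomial, the dimension is m (p - 1) and det (1 - h) = p^m.  If g is the
square root of h among its powers, then (g - g^-1) G is skew-symmetric, so its
determinant is a square; as det (g - g^-1) is p^m up to squares, so is det G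
(det_form_cyclotomic).  Summing up, n = m (p - 1) and d(q) = - p^m. *)

Set Implicit Arguments.
Unset Strict Implicit.
Unset Printing Implicit Defensive.

Import Order.TTheory GRing.Theory Num.Theory.
Import numFieldNormedType.Exports.

Local Open Scope classical_set_scope.
Local Open Scope ring_scope.

Local Notation isometry := Defs.isometry.
Local Notation realmx := Defs.realmx.

(** * Determinants of rational forms with automorphisms of prime order *)

Lemma det_skew2 (F : numFieldType) (K : 'M[F]_2) :
  K^T = - K -> \det K = K ord0 (lift ord0 ord0) ^+ 2.
Proof.
move=> skK; have skKE a b : K a b = - K b a.
  by move/matrixP/(_ b a): skK; rewrite !mxE.
have K0 a : K a a = 0.
  by apply/eqP; move/eqP: (skKE a a); rewrite -addr_eq0 -mulr2n mulrn_eq0.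
rewrite (expand_det_row _ ord0) !big_ord_recl big_ord0 K0 mul0r add0r addr0.
rewrite /cofactor det_mx11 !mxE /= expr1 mulN1r.
rewrite (_ : lift (lift _ _) _ = ord0); last by apply: val_inj.
by rewrite [K (lift _ _) _]skKE opprK; congr (_ * K _ _); apply: val_inj.
Qed.

(** A nonzero entry of W gives, after a permutation of the basis, an invertible
skew 2 x 2 corner; its determinant is a square and its Schur complement is
again skew. *)
Lemma det_skew_square (F : numFieldType) (n : nat) (W : 'M[F]_n) :
  W^T = - W -> exists c, \det W = c ^+ 2.
Proof.
elim/ltn_ind: n => -[|n] IHn in W *; first by exists 1; rewrite det_mx00 expr1n.
move=> skW.
have skE i j : W i j = - W j i.
  by move/matrixP/(_ j i): skW; rewrite !mxE.
have diag0 i : W i i = 0.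
  by apply/eqP; move/eqP: (skE i i); rewrite -addr_eq0 -mulr2n mulrn_eq0.
have [j nzWj | row0] := pickP [pred j | W ord0 j != 0]; last first.
  exists 0; rewrite expr0n (expand_det_row W ord0) big1 // => j _.
  by move/negbFE/eqP: (row0 j) => /= ->; rewrite mul0r.
case: n => [|n] in IHn W j skW skE diag0 nzWj *.
  by rewrite /= [j]ord1 diag0 eqxx in nzWj.
pose k : 'I_n.+2 := lift ord0 ord0; pose s := tperm j k.
have sK0 : s ord0 = ord0.
  rewrite tpermD //.
  by apply: contraNneq nzWj => /= ->; rewrite diag0.
pose W' : 'M[F]_(2 + n) := perm_mx s *m W *m (perm_mx s)^T.
have dW' : \det W' = \det W.
  by rewrite !det_mulmx det_tr mulrAC det_perm -expr2 sqrr_sign mul1r.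
have skW' : W'^T = - W'.
  by rewrite /W' !trmx_mul trmxK skW !mulmxA mulmxN mulNmx.
pose K := ulsubmx W'; pose B := ursubmx W'; pose M := drsubmx W'.
have skK : K^T = - K by rewrite /K trmx_ulsub skW'; apply/matrixP=> a b; rewrite !mxE.
have skM : M^T = - M by rewrite /M trmx_drsub skW'; apply/matrixP=> a b; rewrite !mxE.
have dlW : dlsubmx W' = - B^T.
  rewrite /B -[in RHS](opprK W') -skW'; apply/matrixP=> a b; rewrite !mxE.
  by rewrite opprK.
have nzK : K ord0 (lift ord0 ord0) != 0.
  have W'E a b : W' a b = W (s a) (s b).
    by rewrite /W' tr_perm_mx -row_permE -col_permE !mxE.
  have e0 : @lshift 2 n ord0 = ord0 :> 'I_n.+2 by exact: val_inj.
  have e1 : @lshift 2 n (lift ord0 ord0) = k :> 'I_n.+2 by exact: val_inj.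
  by rewrite [K _ _]mxE [usubmx _ _ _]mxE W'E e0 e1 sK0 tpermR.
have detK := det_skew2 skK.
have uK : K \in unitmx by rewrite unitmxE detK unitfE expf_neq0.
pose S := M + B^T *m invmx K *m B.
(* Block elimination of the lower left corner. *)
have detS : \det W' = \det K * \det S.
  have -> : W' = block_mx 1%:M 0 (- B^T *m invmx K) 1%:M *m block_mx K B 0 S.
    rewrite mulmx_block !mul1mx !mul0mx !addr0 mulmxKV // /S.
    by rewrite !mulNmx addrCA addNr addr0 -dlW submxK.
  by rewrite det_mulmx det_lblock det_ublock !det1 !mul1r.
have [//||c detSc] := IHn n _ S.
  have -> : S^T = M^T + B^T *m (invmx K)^T *m B.
    by rewrite /S linearD /= !trmx_mul trmxK mulmxA.
  rewrite trmx_inv skK -[- K]scaleN1r invmxZ; last by rewrite unitmxZ ?unitrN1.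
  by rewrite invrN1 scaleN1r skM mulmxN mulNmx /S opprD.
by exists (K ord0 (lift ord0 ord0) * c); rewrite -dW' detS detK detSc exprMn.
Qed.

Lemma Cyclotomic_prime_root (p : nat) (z : algC) : prime p ->
  \sum_(i < p) z ^+ i = 0 -> p.-primitive_root z.
Proof.
move=> p_pr sz.
have z1 : z ^+ p = 1.
  by apply/eqP; rewrite -subr_eq0 subrX1 sz mulr0.
apply/andP; split; first exact: prime_gt0.
have [m pr_m m_p] := prim_order_exists (prime_gt0 p_pr) z1.
case: (primeP p_pr) => _ /(_ m m_p) /orP[/eqP m1 | /eqP <-]; last by case/andP: pr_m.
move: sz; move: (prim_expr_order pr_m); rewrite m1 expr1 => ->.
under eq_bigr do rewrite expr1n.
rewrite sumr_const card_ord => /eqP; rewrite pnatr_eq0 => /eqP p0.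
by rewrite p0 in p_pr.
Qed.

(** Every complex root of f has the p-th cyclotomic polynomial as its minimal
polynomial over the rationals, so f is a power of that polynomial, whose value
at 1 is p. *)
Lemma cyclotomic_factorization (p : nat) (f : {poly rat}) : prime p -> f \is monic ->
    (forall z : algC, root (map_poly ratr f) z -> p.-primitive_root z) ->
  exists m, size f = (m * p.-1).+1 /\ f.[1] = p%:R ^+ m.
Proof.
move=> p_pr; have [l] := ubnP (size f); elim: l => // l IHl in f *.
rewrite ltnS => szf mf rf.
have [sz1 | sz1] := leqP (size f) 1.
  have sf1 : size f = 1%N.
    by apply/eqP; rewrite eqn_leq sz1 size_poly_gt0 monic_neq0.
  exists 0%N; rewrite sf1; split=> //.
  have /eqP/size_poly1P[c c0 fc] := sf1.
  by move/monicP: mf; rewrite fc lead_coefC hornerC.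
have [z rz] : exists z : algC, root (map_poly ratr f) z.
  by apply: closed_rootP; rewrite size_map_poly gtn_eqF.
have pz := rf z rz.
pose g : {poly rat} := map_poly intr 'Phi_p.
have mg : g \is monic by rewrite monic_map // Cyclotomic_monic.
have szg : size g = p.
  rewrite size_map_inj_poly // ?size_Cyclotomic ?totient_prime ?prednK ?prime_gt0 //.
  exact: intr_inj.
have g1 : g.[1] = p%:R.
  have : 'Phi_1 * 'Phi_p = 'X^p - 1.
    rewrite -(prod_Cyclotomic (prime_gt0 p_pr)).
    have -> : divisors p = [:: 1; p]%N.
      apply: (irr_sorted_eq ltn_trans ltnn); rewrite ?sorted_divisors_ltn //=.
        by rewrite prime_gt1.
      move=> d; rewrite -dvdn_divisors ?prime_gt0 // !inE.
      by apply/idP/orP=> [/(primeP p_pr).2/orP // | [] /eqP->]; rewrite ?dvd1n.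
    by rewrite big_cons big_seq1.
  have -> : 'Phi_1 = 'X - 1.
    by have := prod_Cyclotomic (ltn0Sn 0); rewrite big_seq1 expr1.
  have nzX1 : 'X - 1 != 0 :> {poly int} by rewrite polyXsubC_eq0.
  rewrite subrX1 => /(mulfI nzX1) gE; rewrite /g gE.
  rewrite rmorph_sum horner_sum; under eq_bigr do rewrite rmorphXn /= map_polyX hornerXn expr1n.
  by rewrite sumr_const card_ord.
have gf : g %| f.
  have [q [Dq mq] dvq] := minCpolyP z.
  have -> : g = q; last by rewrite -dvq.
  apply: (map_inj_poly (f := ratr : rat -> algC)); rewrite ?rmorph0 //.
    exact: fmorph_inj.
  rewrite -Dq (minCpoly_cyclotomic pz) -(Cintr_Cyclotomic pz) /g -map_poly_comp.
  by apply: eq_map_poly => a /=; rewrite ratr_int.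
have [h fE] := dvdpP _ _ gf.
have mh : h \is monic by rewrite -(monicMr _ mg) -fE.
have szh : size f = (size h + p.-1)%N.
  by rewrite fE size_Mmonic ?monic_neq0 // szg -{1}(prednK (prime_gt0 p_pr)) addnS.
have [|||m [szm hm]] := IHl h.
- apply: leq_trans szf; rewrite szh -addn1 leq_add2l -ltnS.
  by rewrite (prednK (prime_gt0 p_pr)) prime_gt1.
- by [].
- by move=> w rw; apply: rf; rewrite fE rmorphM rootM rw.
exists m.+1; rewrite szh szm mulSn; split; first by lia.
by rewrite fE hornerM hm g1 exprSr.
Qed.

(** The characteristic polynomial of D satisfies the previous lemma. *)
Lemma det1B_cyclotomic (p s : nat) (D : 'M[rat]_s) : prime p ->
    \sum_(i < p) D ^+ i = 0 ->
  exists m, s = (m * p.-1)%N /\ \det (1%:M - D) = p%:R ^+ m.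
Proof.
move=> p_pr sD.
have [|m] := cyclotomic_factorization (f := char_poly D) p_pr (char_poly_monic D).
  move=> z; rewrite map_char_poly -eigenvalue_root_char => /eigenvalueP[v vD nzv].
  apply: Cyclotomic_prime_root => //.
  have vDi i : v *m map_mx ratr (D ^+ i) = z ^+ i *: v.
    elim: i => [|i IHi]; first by rewrite !expr0 map_mx1 mulmx1 scale1r.
    by rewrite exprS -mulmxE map_mxM mulmxA vD -scalemxAl IHi scalerA -exprS.
  have : v *m map_mx ratr (\sum_(i < p) D ^+ i) = 0 by rewrite sD map_mx0 mulmx0.
  rewrite map_mx_sum mulmx_sumr => /eqP.
  under eq_bigr do rewrite vDi.
  by rewrite -scaler_suml scaler_eq0 (negPf nzv) orbF => /eqP.
rewrite size_char_poly => -[[sE] det1]; exists m; split=> //.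
rewrite -det1 /char_poly -horner_evalE -det_map_mx /=; congr (\det _).
apply/matrixP=> i j; rewrite !mxE /= !horner_evalE.
by rewrite hornerD hornerN hornerC hornerMn hornerX.
Qed.
(** E = D^((p+1)/2) is a square root of D, and E - E^-1 is skew-adjoint for G:
its product with G is a skew matrix, of square determinant, while
E - E^-1 = E^-1 (D - 1). *)
Lemma det_form_cyclotomic (p s : nat) (G D : 'M[rat]_s) :
    prime p -> odd p -> G^T = G -> D *m G *m D^T = G ->
    D ^+ p = 1%:M -> \sum_(i < p) D ^+ i = 0 ->
  exists m c, s = (m * p.-1)%N /\ \det G = p%:R ^+ m * c ^+ 2.
Proof.
move=> p_pr p_odd symG orthD Dp sD.
have [m [sE detB1]] := det1B_cyclotomic p_pr sD.
have p_half : p = p./2.*2.+1 by rewrite -[LHS]odd_double_half p_odd.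
(* F is the inverse of E; written as a square, it has a square determinant. *)
pose E := D ^+ p./2.+1; pose F1 := E ^+ p./2; pose F := F1 * F1.
have E2 : E * E = D.
  by rewrite /E -exprD addnS addSn addnn exprS -p_half Dp -[1%:M]/1 mulr1.
have EF : E * F = 1.
  by rewrite /F /F1 -!exprD addnn -exprS -p_half -exprM mulnC exprM Dp expr1n.
have FE : F * E = 1 by rewrite /F /F1 -!exprD -exprSr addnn -p_half -exprM mulnC exprM Dp expr1n.
have orthE : E *m G *m E^T = G.
  rewrite /E; elim: p./2.+1 => [|i IHi]; first by rewrite expr0 trmx1 mulmx1 mul1mx.
  rewrite exprSr -mulmxE trmx_mul !mulmxA -(mulmxA _ D) -(mulmxA _ (D *m G)).
  by rewrite orthD.
have GE : G *m E^T = F *m G.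
  by rewrite -[in RHS]orthE !mulmxA (FE : F *m E = 1%:M) mul1mx.
have GF : G *m F^T = E *m G.
  by rewrite -[G in LHS]orthE -mulmxA -trmx_mul (FE : F *m E = 1%:M) trmx1 mulmx1.
have skW : ((E - F) *m G)^T = - ((E - F) *m G).
  by rewrite trmx_mul symG linearB /= mulmxBr GE GF mulmxBl opprB.
have [c detW] := det_skew_square skW.
have EBF : E - F = F *m (D - 1%:M).
  by rewrite mulmxBr mulmx1 -E2 mulmxE mulrA FE mul1r.
have detD1 : \det (D - 1%:M) = p%:R ^+ m.
  have even_s : odd s = false.
    by rewrite sE oddM [X in odd X.-1]p_half /= odd_double andbF.
  by rewrite -opprB -scaleN1r detZ detB1 -signr_odd even_s mul1r.
have nzF1 : \det F1 != 0.
  apply: contra_eq_neq (congr1 (fun M : 'M[rat]_s => \det M) EF) => F0.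
  by rewrite -!mulmxE !det_mulmx F0 mul0r mulr0 det1 eq_sym oner_eq0.
have nzp : (p%:R : rat) ^+ m != 0 by rewrite expf_neq0 // pnatr_eq0 -lt0n prime_gt0.
exists m, (c / (\det F1 * p%:R ^+ m)); split=> //.
move: detW; rewrite det_mulmx EBF /F -mulmxE !det_mulmx detD1 expr_div_n => <-.
by field; rewrite nzF1 -natrX pnatr_eq0 expn_eq0 negb_and -lt0n prime_gt0.
Qed.

Lemma det_orthogonal_sum (F : fieldType) (n r s : nat) (G : 'M[F]_n)
    (K : 'M[F]_(r, n)) (I : 'M[F]_(s, n)) :
    (r + s = n)%N -> row_free (col_mx K I) ->
    K *m G *m I^T = 0 -> I *m G *m K^T = 0 ->
  exists2 b, b != 0 &
    \det G * b ^+ 2 = \det (K *m G *m K^T) * \det (I *m G *m I^T).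
Proof.
move=> e; subst n => freeKI KI IK; exists (\det (col_mx K I)).
  by rewrite -unitfE -unitmxE -row_free_unit.
rewrite expr2 mulrCA -{2}det_tr -!det_mulmx tr_col_mx mulmxA mul_col_mx.
by rewrite mul_col_row KI IK det_ublock.
Qed.

(** Induction on n.  An element C <> 1 of S splits the space into the orthogonal
sum of the fixed vectors of C, where S satisfies the same hypotheses since it
commutes with C, and of the image of C - 1, where det_form_cyclotomic
applies. *)
Lemma det_form_exponent_p (p n : nat) (G : 'M[rat]_n) (S : 'M[rat]_n -> Prop) :
    prime p -> odd p -> G^T = G -> \det G != 0 ->
    (forall C, S C -> C *m G *m C^T = G) -> (forall C, S C -> C ^+ p = 1%:M) ->
    (forall C D, S C -> S D -> C *m D = D *m C) ->
    (forall x : 'rV_n, (forall C, S C -> x *m C = x) -> x = 0) ->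
  exists m c, n = (m * p.-1)%N /\ \det G = p%:R ^+ m * c ^+ 2.
Proof.
move=> p_pr p_odd; elim/ltn_ind: n => n IHn in G S *.
move=> symG nzG orthS Sp commS fixS.
have [n0 | n_gt0] := posnP n.
  by subst n; exists 0%N, 1; split=> //; rewrite det_mx00 expr1n mulr1.
have [C SC nzC] : exists2 C, S C & C != 1%:M.
  apply: contrapT => noC; pose x : 'rV[rat]_n := const_mx 1.
  have : x = 0.
    apply: fixS => C SC; have [->|nzC] := eqVneq C 1%:M; first by rewrite mulmx1.
    by case: noC; exists C.
  by move/matrixP/(_ ord0 (Ordinal n_gt0))/eqP; rewrite !mxE oner_eq0.
pose B := C - 1%:M.
have [K freeK eqK] : exists2 K : 'M[rat]_(\rank (kermx B), n),
    row_free K & (K :=: kermx B)%MS.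
  by exists (row_base (kermx B)); [apply: row_base_free | apply: eq_row_base].
have [I freeI eqI] : exists2 I : 'M[rat]_(\rank B, n), row_free I & (I :=: B)%MS.
  by exists (row_base B); [apply: row_base_free | apply: eq_row_base].
have Cp := Sp _ SC; have orthC := orthS _ SC.
have sumB : B *m (\sum_(i < p) C ^+ i) = 0.
  by rewrite /B -[1%:M]/(1 : 'M[rat]_n) mulmxE -subrX1 Cp subrr.
(* If v is in the image of C - 1 then (1 + C + ... + C^(p-1)) v = 0; if v is
   also fixed by C, the left-hand side is p v. *)
have disj : (kermx B :&: B)%MS = 0.
  apply/eqP/rowV0P=> v; rewrite sub_capmx => /andP[/sub_kermxP vB /submxP[w vE]].
  have vC : v *m C = v.
    by apply/eqP; rewrite -subr_eq0 -[X in _ - X]mulmx1 -mulmxBr vB.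
  have vCi i : v *m C ^+ i = v.
    elim: i => [|i IHi]; first by rewrite expr0 mulmx1.
    by rewrite exprS -mulmxE mulmxA vC.
  have : v *m (\sum_(i < p) C ^+ i) = 0 by rewrite vE -mulmxA sumB mulmx0.
  rewrite mulmx_sumr; under eq_bigr do rewrite vCi.
  rewrite sumr_const card_ord -scaler_nat => /eqP.
  by rewrite scaler_eq0 pnatr_eq0 eqn0Ngt prime_gt0 //= => /eqP.
have rs : (\rank (kermx B) + \rank B = n)%N.
  by rewrite mxrank_ker subnK // rank_leq_row.
have freeKI : row_free (col_mx K I).
  rewrite /row_free -addsmxE (adds_eqmx eqK eqI).
  by rewrite mxrank_disjoint_sum.
have KB : K *m B = 0 by apply/sub_kermxP; rewrite eqK.
have [X IE] : exists X, I = X *m B by apply/submxP; rewrite eqI.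
have KC : K *m C = K by apply/eqP; rewrite -subr_eq0 -[X in _ - X]mulmx1 -mulmxBr KB.
have GC : K *m G *m C^T = K *m G by rewrite -[in LHS]KC -!mulmxA (mulmxA C) orthC.
have KI : K *m G *m I^T = 0.
  by rewrite IE trmx_mul mulmxA [B^T]linearB /= mulmxBr GC trmx1 mulmx1 subrr mul0mx.
have IK : I *m G *m K^T = 0.
  by apply: trmx_inj; rewrite trmx0 !trmx_mul trmxK symG mulmxA KI.
have [b nzb detE] := det_orthogonal_sum rs freeKI KI IK.
have restrict r (Y : 'M[rat]_(r, n)) (D : 'M[rat]_r) C' : row_free Y ->
    S C' -> Y *m C' = D *m Y ->
    D *m (Y *m G *m Y^T) *m D^T = Y *m G *m Y^T /\ D ^+ p = 1%:M.
  move=> freeY SC' YC'; split.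
    rewrite !mulmxA -YC' -!mulmxA -trmx_mul -YC' trmx_mul.
    by rewrite [G *m _]mulmxA [C' *m _]mulmxA [C' *m _]mulmxA orthS.
  apply: (row_free_inj freeY); rewrite mul1mx.
  have -> i : D ^+ i *m Y = Y *m C' ^+ i; last by rewrite Sp // mulmx1.
  elim: i => [|i IHi]; first by rewrite !expr0 mul1mx mulmx1.
  by rewrite exprS -mulmxE -mulmxA IHi mulmxA -YC' -mulmxA mulmxE -exprS.
have symY r (Y : 'M[rat]_(r, n)) : (Y *m G *m Y^T)^T = Y *m G *m Y^T.
  by rewrite !trmx_mul trmxK symG mulmxA.
have [D ID] : exists D, I *m C = D *m I.
  apply/submxP; rewrite eqI IE; apply/submxP; exists (X *m C).
  by rewrite -!mulmxA; congr (_ *m _); rewrite /B mulmxBl mulmxBr mulmx1 mul1mx.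
have [orthD Dp] := restrict _ _ _ _ freeI SC ID.
have sD : \sum_(i < p) D ^+ i = 0.
  apply: (row_free_inj freeI); rewrite mul0mx mulmx_suml.
  transitivity (I *m \sum_(i < p) C ^+ i); last by rewrite IE -mulmxA sumB mulmx0.
  rewrite mulmx_sumr; apply: eq_bigr => i _; elim: (val i) => [|j IHj].
    by rewrite !expr0 mul1mx mulmx1.
  by rewrite exprS -mulmxE -mulmxA IHj mulmxA -ID -mulmxA mulmxE -exprS.
have [m1 [c1 [s1 det1]]] := det_form_cyclotomic p_pr p_odd (symY _ I) orthD Dp sD.
have nzKI : \det (K *m G *m K^T) * \det (I *m G *m I^T) != 0.
  by rewrite -detE mulf_neq0 // expf_neq0.
have ltr : (\rank (kermx B) < n)%N.
  rewrite -[X in (_ < X)%N]rs -[X in (X < _)%N]addn0 ltn_add2l lt0n mxrank_eq0.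
  by rewrite subr_eq0.
have [||||||m2 [c2 [s2 det2]]] := IHn _ ltr (K *m G *m K^T)
    (fun D => exists2 C', S C' & K *m C' = D *m K).
- exact: symY.
- by move: nzKI; rewrite mulf_eq0 negb_or => /andP[].
- by move=> D' [C' SC' /(restrict _ _ _ _ freeK SC')[]].
- by move=> D' [C' SC' /(restrict _ _ _ _ freeK SC')[]].
- move=> D1 D2 [C1 SC1 KC1] [C2 SC2 KC2]; apply: (row_free_inj freeK).
  by rewrite -!mulmxA -KC1 -KC2 !mulmxA -KC1 -KC2 -!mulmxA commS.
- move=> x fx; apply: (row_free_inj freeK); rewrite mul0mx; apply: fixS => C' SC'.
  have [D' KD'] : exists D', K *m C' = D' *m K.
    apply/submxP; rewrite eqK; apply/sub_kermxP.
    by rewrite /B mulmxBr mulmx1 -mulmxA commS // mulmxA KC subrr.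
  by rewrite -mulmxA KD' mulmxA fx //; exists C'.
exists (m2 + m1)%N, (c1 * c2 / b); split; first by rewrite mulnDl -s1 -s2 rs.
apply: (mulIf (expf_neq0 2 nzb)); rewrite detE det1 det2 exprD expr_div_n.
by field.
Qed.

(** * Discrete groups of Euclidean isometries *)

Section MatrixNorm.
Variable R : realType.

Lemma mx_norm_le a b (M : 'M[R]_(a, b)) c :
  0 <= c -> (`|M| <= c) <-> (forall i j, `|M i j| <= c).
Proof.
move=> c0; rewrite [`|M|]mx_normrE; split=> [Mc i j|Mc].
  apply: le_trans Mc; exact: (le_bigmax _ (fun ij => `|M ij.1 ij.2|) (i, j)).
by apply/bigmax_leP; split=> // -[i j] _; apply: Mc.
Qed.

Lemma mx_norm_lt a b (M : 'M[R]_(a, b)) c :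
  0 < c -> (`|M| < c) <-> (forall i j, `|M i j| < c).
Proof.
move=> c0; rewrite [`|M|]mx_normrE; split=> [Mc i j|Mc].
  apply: le_lt_trans Mc; exact: (le_bigmax _ (fun ij => `|M ij.1 ij.2|) (i, j)).
by apply/bigmax_ltP; split=> // -[i j] _; apply: Mc.
Qed.

Lemma mx_norm_entry a b (M : 'M[R]_(a, b)) i j : `|M i j| <= `|M|.
Proof. by move: i j; apply/mx_norm_le. Qed.

Lemma mx_normM a b c (M : 'M[R]_(a, b)) (N : 'M[R]_(b, c)) :
  `|M *m N| <= b%:R * `|M| * `|N|.
Proof.
apply/mx_norm_le => [|i j]; first by rewrite !mulr_ge0.
rewrite mxE; apply: le_trans (ler_norm_sum _ _ _) _.
have <- : #|'I_b|%:R = b%:R :> R by rewrite card_ord.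
rewrite -mulrA mulr_natl -sumr_const.
by apply: ler_sum => k _; rewrite normrM ler_pM // mx_norm_entry.
Qed.

Lemma orthogonal_norm n (L : 'M[R]_n) : L^T *m L = 1%:M -> `|L| <= 1.
Proof.
move=> LL; apply/mx_norm_le => // i j.
rewrite -(@expr_le1 _ 2) // -normrX ger0_norm ?sqr_ge0 //.
have <- : (L^T *m L) j j = 1 by rewrite LL mxE eqxx.
rewrite mxE (bigD1 i) //= !mxE -expr2 lerDl.
by apply: sumr_ge0 => k _; rewrite mxE -expr2 sqr_ge0.
Qed.

(** Pigeonhole: the cube of side 2 C is cut into cubes of side eps. *)
Lemma bounded_close_terms a b (u : nat -> 'M[R]_(a, b)) C eps :
  (forall k, `|u k| <= C) -> 0 < eps -> exists k l, (k < l)%N /\ `|u k - u l| < eps.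
Proof.
move=> uC eps0; pose v k ij : R := (u k ij.1 ij.2 + C) / eps.
have C0 : 0 <= C := le_trans (normr_ge0 _) (uC 0%N).
have v_itv k ij : 0 <= v k ij <= C *+ 2 / eps.
  have := le_trans (mx_norm_entry (u k) ij.1 ij.2) (uC k); rewrite ler_norml => /andP[? ?].
  by rewrite /v ler_pM2r ?invr_gt0 // divr_ge0 ?(ltW eps0) //; lra.
pose N := (Num.truncn (C *+ 2 / eps)).+1.
pose f (k : nat) : {ffun 'I_a * 'I_b -> 'I_N} :=
  [ffun ij => inord (Num.truncn (v k ij))].
have fE k ij : f k ij = Num.truncn (v k ij) :> nat.
  by rewrite ffunE inordK // ltnS le_truncn //; case/andP: (v_itv k ij).
pose K := #|{ffun 'I_a * 'I_b -> 'I_N}|.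
have /injectivePn[k [l kl fkl]] : ~~ injectiveb (fun k : 'I_K.+1 => f k).
  apply/negP => /injectiveP /leq_card; rewrite card_ord -/K ltnn //.
suff close (i j : nat) : f i = f j -> `|u i - u j| < eps.
  have [ij|ij|ij] := ltngtP k l.
  - by exists k, l; split; last exact: close.
  - by exists l, k; split; last exact: close.
  - by case/eqP: kl; apply: val_inj.
move=> ffij; apply/mx_norm_lt => // x y.
have /(congr1 val) /= := congr1 (fun g : {ffun _ -> _} => g (x, y)) ffij.
rewrite !fE; set t := Num.truncn (v i _) => tj.
have /andP[vi _] := v_itv i (x, y); have /andP[vj _] := v_itv j (x, y).
have /andP[] := truncn_itv vi; have /andP[] := truncn_itv vj.
rewrite -tj -/t -natr1 => tv1 vt1 tv2 vt2.
have : `|v i (x, y) - v j (x, y)| < 1 by rewrite ltr_norml; lra.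
rewrite /v /= -mulrBl normrM (ger0_norm (x := eps^-1)) ?invr_ge0 ?ltW //.
rewrite ltr_pdivrMr // mul1r !mxE; congr (_ < _); congr (`|_|); lra.
Qed.

End MatrixNorm.

Section Isometries.
Variables (R : realType) (n : nat).
Implicit Types (g h : 'M[R]_n.+1) (L M : 'M[R]_n) (v w x : 'cV[R]_n).
Implicit Types D : set 'M[R]_n.+1.

Definition euclidean L v : 'M[R]_n.+1 := block_mx (1%:M : 'M[R]_1) 0 v L.

Lemma lin_euclidean L v : lin_part (euclidean L v) = L.
Proof. exact: block_mxKdr. Qed.

Lemma trans_euclidean L v : trans_part (euclidean L v) = v.
Proof. exact: block_mxKdl. Qed.

Lemma euclideanM L v M w : euclidean L v * euclidean M w = euclidean (L *m M) (L *m w + v).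
Proof.
rewrite /euclidean -mulmxE (@mulmx_block _ 1 n 1 n 1 n).
by rewrite !mul0mx !mulmx0 !mul1mx mulmx1 addr0 !add0r addrC.
Qed.

Lemma euclidean1 : euclidean 1%:M 0 = 1.
Proof. exact/esym/(@scalar_mx_block R 1 n 1). Qed.

Lemma isometryP g : isometry g <->
  (lin_part g)^T *m lin_part g = 1%:M /\ g = euclidean (lin_part g) (trans_part g).
Proof.
split=> [[L [v [LL ->]]]|[LL gE]]; last by exists (lin_part g), (trans_part g).
by rewrite -/(euclidean L v) lin_euclidean trans_euclidean.
Qed.

Lemma isometryE g : isometry g -> g = euclidean (lin_part g) (trans_part g).
Proof. by case/isometryP. Qed.

Lemma lin_orthogonal g : isometry g -> (lin_part g)^T *m lin_part g = 1%:M.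
Proof. by case/isometryP. Qed.

Lemma lin_orthogonalV g : isometry g -> lin_part g *m (lin_part g)^T = 1%:M.
Proof. by move/lin_orthogonal/mulmx1C. Qed.

Lemma lin_partM g h : isometry g -> isometry h ->
  lin_part (g * h) = lin_part g *m lin_part h.
Proof.
by move=> /isometryE-> /isometryE->; rewrite euclideanM !lin_euclidean.
Qed.

Lemma trans_partM g h : isometry g -> isometry h ->
  trans_part (g * h) = lin_part g *m trans_part h + trans_part g.
Proof.
by move=> /isometryE-> /isometryE->; rewrite euclideanM !(lin_euclidean, trans_euclidean).
Qed.

Lemma lin_part1 : lin_part (1 : 'M[R]_n.+1) = 1%:M.
Proof. by rewrite -euclidean1 lin_euclidean. Qed.

Lemma trans_part1 : trans_part (1 : 'M[R]_n.+1) = 0.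
Proof. by rewrite -euclidean1 trans_euclidean. Qed.

Lemma isometry_unit g : isometry g -> g \is a GRing.unit.
Proof.
move=> /isometryP[LL ->]; rewrite -[_ \is a _]/(_ \in unitmx) unitmxE /euclidean.
rewrite (@det_lblock _ 1 n) det1 mul1r.
by rewrite -unitmxE; case/mulmx1_unit: LL.
Qed.

Lemma isometryV g : isometry g ->
  g^-1 = euclidean (lin_part g)^T (- ((lin_part g)^T *m trans_part g)).
Proof.
move=> ig; apply: (mulIr (isometry_unit ig)); rewrite mulVr ?isometry_unit //.
rewrite [X in _ * X]isometryE // euclideanM lin_orthogonal // subrr.
by rewrite euclidean1.
Qed.

Lemma isom_actM g h x : isometry g -> isometry h ->
  isom_act (g * h) x = isom_act g (isom_act h x).
Proof.
move=> ig ih; rewrite /isom_act lin_partM // trans_partM //.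
by rewrite mulmxDr mulmxA addrA.
Qed.

Lemma isom_act1 x : isom_act 1 x = x.
Proof. by rewrite /isom_act lin_part1 trans_part1 mul1mx addr0. Qed.

Lemma isom_actX g x k : isometry g -> (forall i, isometry (g ^+ i)) ->
  isom_act g x = x -> isom_act (g ^+ k) x = x.
Proof.
move=> ig igk gx; elim: k => [|k IHk]; first by rewrite expr0 isom_act1.
by rewrite exprS isom_actM // IHk.
Qed.

Lemma subgroupX D g k : subgroup D -> D g -> D (g ^+ k).
Proof.
case=> _ D1 DM _ Dg; elim: k => [|k IHk]; first by rewrite expr0.
by rewrite exprS; apply: DM.
Qed.

Lemma euclidean_norm L v : `|euclidean L v| <= Num.max 1 (Num.max `|v| `|L|).
Proof.
have h0 : 0 <= Num.max 1 (Num.max `|v| `|L|) by rewrite le_max ler01.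
apply/(mx_norm_le _ h0) => i j; rewrite !le_max /euclidean.
case: (@split_ordP 1 n i) => i' ->; case: (@split_ordP 1 n j) => j' ->.
- rewrite (@block_mxEul _ 1 n 1 n) mxE; case: eqP => _; by rewrite ?normr1 ?normr0 ?lexx ?ler01.
- by rewrite (@block_mxEur _ 1 n 1 n) mxE normr0 ler01.
- by rewrite (@block_mxEdl _ 1 n 1 n) mx_norm_entry orbT.
- by rewrite (@block_mxEdr _ 1 n 1 n) mx_norm_entry !orbT.
Qed.

(** Two terms of the sequence that are close to each other differ by an element
of D close to 1, because the inverses of isometries moving the origin a bounded
distance are bounded too. *)
Lemma discrete_repetition D (g : nat -> 'M[R]_n.+1) C :
    subgroup D -> (forall h, D h -> isometry h) -> discrete_group D ->
    (forall k, D (g k)) -> (forall k, `|trans_part (g k)| <= C) ->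
  exists k l, (k < l)%N /\ g k = g l.
Proof.
move=> sD isoD [eps eps0 dD] Dg gC.
have C0 : 0 <= C := le_trans (normr_ge0 _) (gC 0%N).
pose B := Num.max 1 (Num.max C (n%:R * C)).
have B1 : 1 <= B by rewrite le_max lexx.
have BC : C <= B by rewrite !le_max lexx orbT.
have BnC : n%:R * C <= B by rewrite !le_max lexx !orbT.
have gB k : `|g k| <= B.
  rewrite [g k]isometryE; last exact: isoD.
  apply: le_trans (euclidean_norm _ _) _; rewrite !ge_max B1 (le_trans _ BC) //=.
  by apply: le_trans B1; apply/orthogonal_norm/lin_orthogonal/isoD.
have gVB k : `|(g k)^-1| <= B.
  rewrite isometryV; last exact: isoD.
  have LT : `|(lin_part (g k))^T| <= 1.
    by apply: orthogonal_norm; rewrite trmxK lin_orthogonalV //; apply: isoD.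
  apply: le_trans (euclidean_norm _ _) _; rewrite !ge_max B1 (le_trans LT B1) andbT /=.
  rewrite normrN; apply: le_trans BnC.
  apply: le_trans (mx_normM _ _) _; apply: ler_pM; rewrite ?mulr_ge0 //.
  by rewrite -[leRHS]mulr1 ler_wpM2l.
have B0 : 0 < B by apply: lt_le_trans B1.
have e0 : 0 < eps / (n.+1%:R * B) by rewrite divr_gt0 // mulr_gt0.
have [k [l [kl close]]] := bounded_close_terms gB e0.
exists k, l; split=> //; have [uD D1 DM DV] := sD.
suff : (g k)^-1 * g l = 1.
  by move=> e; rewrite -[LHS]mulr1 -e mulVKr //; apply/isometry_unit/isoD.
apply: dD; first by apply: DM => //; apply: DV.
rewrite -ball_normE /= -(mulVr (isometry_unit (isoD _ (Dg k)))) -mulrBr -mulmxE.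
apply: le_lt_trans (mx_normM _ _) _.
apply: (@le_lt_trans _ _ (n.+1%:R * B * `|g k - g l|)).
  by rewrite ler_wpM2r // ler_wpM2l.
by rewrite mulrC -ltr_pdivlMr // mulr_gt0.
Qed.

(** All the powers of an isometry fixing x move the origin a bounded distance, so
two of them coincide. *)
Lemma torsion_free_fixpoint_free D :
    subgroup D -> (forall h, D h -> isometry h) -> discrete_group D -> torsion_free D ->
  forall g x, D g -> isom_act g x = x -> g = 1.
Proof.
move=> sD isoD dD tf g x Dg gx; have DX k := subgroupX k sD Dg.
have iX k := isoD _ (DX k).
have [|k [l [kl gkl]]] := discrete_repetition (g := fun k => g ^+ k)
    (C := `|x| + n%:R * 1 * `|x|) sD isoD dD DX.
  move=> k; have : isom_act (g ^+ k) x = x by apply: isom_actX => //; apply: isoD.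
  rewrite /isom_act addrC => /(canRL (addrK _)) ->.
  apply: le_trans (ler_normB _ _) _; rewrite lerD2l.
  apply: le_trans (mx_normM _ _) _; rewrite ler_wpM2r // ler_wpM2l //.
  by apply: orthogonal_norm; apply: lin_orthogonal.
apply: (tf g (l - k)%N) => //; first by rewrite subn_gt0.
apply: (mulrI (isometry_unit (iX k))).
by rewrite -exprD mulr1 subnKC // ltnW.
Qed.

(** Otherwise there would be nontrivial elements of arbitrarily small
displacement at x, hence infinitely many moving x a bounded distance. *)
Lemma proper_discontinuity D x :
    subgroup D -> (forall h, D h -> isometry h) -> discrete_group D ->
    (forall g y, D g -> isom_act g y = y -> g = 1) ->
  exists2 eps : R, 0 < eps & forall g y, D g ->
    `|y - x| < eps -> `|isom_act g y - x| < eps -> g = 1.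
Proof.
move=> sD isoD dD free; pose disp g := `|isom_act g x - x|.
have disp_gt0 g : D g -> g <> 1 -> 0 < disp g.
  move=> Dg g1; rewrite normr_gt0 subr_eq0; apply/eqP => gx.
  by apply: g1; apply: free gx.
suff [d d0 dP] : exists2 d, 0 < d & forall g, D g -> disp g < d -> g = 1.
  exists (d / (1 + n%:R)); first by rewrite divr_gt0 // ltr_wpDr.
  move=> g y Dg xy xgy; apply: dP => //.
  have -> : d = d / (1 + n%:R) + n%:R * (d / (1 + n%:R)).
    have : (1 + n%:R : R) != 0 by rewrite lt0r_neq0 // ltr_wpDr.
    by move=> ?; field.
  rewrite /disp (_ : _ - x = (isom_act g y - x) - lin_part g *m (y - x)); last first.
    rewrite /isom_act mulmxBr; apply/matrixP=> i j; rewrite !mxE; ring.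
  apply: le_lt_trans (ler_normB _ _) _; apply: ltr_leD => //.
  apply: le_trans (mx_normM _ _) _; rewrite -mulrA ler_wpM2l //.
  apply: (@le_trans _ _ (1 * `|y - x|)); last by rewrite mul1r ltW.
  by rewrite ler_wpM2r // orthogonal_norm // lin_orthogonal //; apply: isoD.
apply: contrapT => nod.
have small (d : R) : exists g, 0 < d -> [/\ D g, g <> 1 & disp g < d].
  have [d0|d0] := boolP (0 < d); last by exists 1 => d1; case/negP: d0.
  apply: contrapT => nog; apply: nod; exists d => // g Dg gd.
  by apply: contrapT => g1; apply: nog; exists g.
have [G GP] := choice small.
pose s := fix s k := if k is k'.+1 then G (disp (s k')) else G 1.
have sP k : D (s k) /\ s k <> 1.
  elim: k => [|k [Dk k1]] /=; first by have [//|] := GP 1.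
  by have [|] := GP (disp (s k)); first exact: disp_gt0.
have s_lt k : disp (s k.+1) < disp (s k).
  have [Dk k1] := sP k; by have [|] := GP (disp (s k)); first exact: disp_gt0.
have s_mono k l : (k < l)%N -> disp (s l) < disp (s k).
  elim: l => // l IHl; rewrite ltnS leq_eqVlt => /orP[/eqP-> // | /IHl].
  exact: lt_trans.
have s1 k : disp (s k) < 1.
  have s01 : disp (s 0%N) < 1 by case: (GP 1 ltr01).
  by case: k => // k; apply: lt_trans s01; apply: s_mono.
have [|k [l [kl skl]]] := discrete_repetition (g := s)
    (C := 1 + `|x - 0| + n%:R * 1 * `|x|) sD isoD dD (fun k => (sP k).1).
  move=> k; have -> : trans_part (s k) = isom_act (s k) x - x + (x - 0)
      - lin_part (s k) *m x.
    by rewrite /isom_act; apply/matrixP=> i j; rewrite !mxE; ring.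
  apply: le_trans (ler_normB _ _) _; apply: lerD.
    by apply: le_trans (ler_normD _ _) _; rewrite lerD2r; apply/ltW/s1.
  apply: le_trans (mx_normM _ _) _; rewrite ler_wpM2r // ler_wpM2l //.
  by apply: orthogonal_norm; apply: lin_orthogonal; apply: isoD; case: (sP k).
by have := s_mono _ _ kl; rewrite skl ltxx.
Qed.

End Isometries.

(** * Free abelian groups of isometries *)

Section CommutingIsometries.
Variables (R : realType) (n : nat).
Implicit Types (g h : 'M[R]_n.+1) (L M : 'M[R]_n) (t c v w x : 'cV[R]_n).

Lemma dot_eq0 m (x : 'cV[R]_m) : x^T *m x = 0 -> x = 0.
Proof.
move=> /matrixP/(_ 0 0); rewrite !mxE => /eqP; rewrite psumr_eq0.
  move=> /allP x0; apply/matrixP=> i j; rewrite (ord1 j) mxE.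
  by have := x0 i (mem_index_enum _); rewrite /= mxE -expr2 sqrf_eq0 => /eqP.
by move=> i _; rewrite mxE -expr2 sqr_ge0.
Qed.

Lemma orthogonal_fixT L x : L^T *m L = 1%:M -> L *m x = x -> L^T *m x = x.
Proof. by move=> LL Lx; rewrite -[in LHS]Lx mulmxA LL mul1mx. Qed.

(** The kernel and the image of 1 - L are orthogonal to each other. *)
Lemma orthogonal_fix_image L x w : L^T *m L = 1%:M -> L *m x = x ->
  x = w - L *m w -> x = 0.
Proof.
move=> LL Lx xE; have xL : x^T *m L = x^T.
  by rewrite -[in RHS](orthogonal_fixT LL Lx) trmx_mul trmxK.
by apply: dot_eq0; rewrite [X in _ *m X]xE mulmxBr mulmxA xL subrr.
Qed.

(** A screw motion: the rotation lin_part g about the point c followed by the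
translation by t along the axis. *)
Definition screw g t c := [/\ isometry g, lin_part g *m t = t &
  trans_part g = t + (c - lin_part g *m c)].

(** The space is the sum of the kernel and of the image of 1 - L. *)
Lemma screw_exists g : isometry g -> exists tc : 'cV[R]_n * 'cV[R]_n, screw g tc.1 tc.2.
Proof.
move=> ig; set L := lin_part g; have LL := lin_orthogonal ig.
pose B : 'M[R]_n := 1%:M - L^T.
have disj : (kermx B :&: B)%MS = 0.
  apply/eqP/rowV0P=> v; rewrite sub_capmx => /andP[/sub_kermxP vB /submxP[w vE]].
  apply: trmx_inj; rewrite trmx0; apply: (orthogonal_fix_image (w := w^T) LL).
    rewrite -{1}[lin_part g]trmxK -trmx_mul; congr (_^T).
    by move: vB; rewrite /B mulmxBr mulmx1 => /subr0_eq.
  by rewrite vE trmx_mul /B linearB /= trmxK trmx1 mulmxBl mul1mx.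
have /sub_addsmxP[[u1 u2]] /= : ((trans_part g)^T <= kermx B + B)%MS.
  rewrite submx_full // /row_full mxrank_disjoint_sum // mxrank_ker subnK //.
  exact: rank_leq_row.
move=> /(congr1 trmx); rewrite trmxK linearD /= => gE.
exists ((u1 *m kermx B)^T, u2^T); split=> //=.
  rewrite -/L -{1}[L]trmxK -trmx_mul; congr (_^T).
  have : u1 *m kermx B *m B = 0 by rewrite -mulmxA mulmx_ker mulmx0.
  by rewrite {2}/B mulmxBr mulmx1 => /subr0_eq.
rewrite gE; congr (_ + _).
by rewrite trmx_mul /B linearB /= trmxK trmx1 mulmxBl mul1mx.
Qed.

(** An isometry commuting with g permutes the axes of g, along which g translates
by t. *)
Lemma screw_commute g h t c : screw g t c -> isometry h -> g * h = h * g ->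
  lin_part h *m t = t.
Proof.
move=> [ig Lt gE] ih gh; set L := lin_part g; set M := lin_part h.
have LM : L *m M = M *m L by rewrite -!lin_partM // gh.
have tr : M *m trans_part g + trans_part h = L *m trans_part h + trans_part g.
  by rewrite -!trans_partM // gh.
apply/esym/subr0_eq; apply: (@orthogonal_fix_image L _ (trans_part h - c + M *m c)).
- exact: lin_orthogonal.
- by rewrite mulmxBr mulmxA LM -mulmxA Lt.
move: tr; rewrite gE -/L !mulmxDr !mulmxN !mulmxA -/M LM => tr.
have {tr} : trans_part h = L *m trans_part h + (t + (c - L *m c)) -
    (M *m t + (M *m c - M *m L *m c)) by rewrite -tr addrC addKr.
move=> hE; rewrite {1}hE; apply/matrixP=> i j; rewrite !mxE; ring.
Qed.

Lemma screwM g h t s c : screw g t c -> screw h s c ->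
  lin_part g *m s = s -> lin_part h *m t = t -> screw (g * h) (t + s) c.
Proof.
move=> [ig gt gE] [ih hs hE] gs ht; split.
- exists (lin_part g *m lin_part h), (lin_part g *m trans_part h + trans_part g).
  split; last by rewrite [X in X * _]isometryE // [X in _ * X]isometryE // euclideanM.
  by rewrite trmx_mul -mulmxA (mulmxA (lin_part g)^T) lin_orthogonal // mul1mx lin_orthogonal.
- by rewrite lin_partM // -mulmxA mulmxDr ht hs mulmxDr gt gs.
rewrite trans_partM // lin_partM // hE gE mulmxDr mulmxBr mulmxA gs.
by apply/matrixP=> i j; rewrite !mxE; ring.
Qed.

Lemma screwV g t c : screw g t c -> screw g^-1 (- t) c.
Proof.
move=> [ig gt gE]; have LL := lin_orthogonal ig; have LV := lin_orthogonalV ig.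
rewrite isometryV //; split.
- exists (lin_part g)^T, (- ((lin_part g)^T *m trans_part g)); split=> //.
  by rewrite trmxK.
- by rewrite lin_euclidean mulmxN orthogonal_fixT.
rewrite lin_euclidean trans_euclidean gE mulmxDr orthogonal_fixT // mulmxBr mulmxA LL.
by rewrite mul1mx opprD opprB.
Qed.

End CommutingIsometries.

Section FreeAbelian.
Variables (R : realType) (n : nat) (D : set 'M[R]_n.+1).
Hypotheses (sD : subgroup D) (isoD : forall h, D h -> isometry h).
Hypothesis dD : discrete_group D.
Variable theta : 'rV[int]_n -> 'M[R]_n.+1.
Hypotheses (thetaD : forall a, D (theta a)) (theta_inj : injective theta).
Hypothesis thetaM : forall a b, theta (a + b) = theta a * theta b.

Let theta_comm a b : theta a * theta b = theta b * theta a.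
Proof. by rewrite -!thetaM addrC. Qed.

Let theta0 : theta 0 = 1.
Proof.
apply: (mulrI (isometry_unit (isoD (thetaD 0)))).
by rewrite -thetaM addr0 mulr1.
Qed.

Let thetaN a : theta (- a) = (theta a)^-1.
Proof.
apply: (mulrI (isometry_unit (isoD (thetaD a)))).
by rewrite -thetaM subrr theta0 mulrV // isometry_unit //; apply: isoD.
Qed.

Lemma screw_theta a t c (z : int) : screw (theta a) t c ->
  screw (theta (a *~ z)) (t *~ z) c.
Proof.
move=> sc; have nat_case (k : nat) : screw (theta (a *+ k)) (t *+ k) c.
  elim: k => [|k IHk].
    rewrite !mulr0n theta0; split; rewrite ?lin_part1 ?trans_part1 ?mul1mx ?subrr ?addr0 //.
    by rewrite -euclidean1; exists 1%:M, 0; rewrite trmx1 mulmx1.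
  rewrite !mulrS thetaM; apply: screwM => //.
  - by rewrite -scaler_nat -scalemxAr; case: sc => _ -> _.
  - by apply: (screw_commute sc); [exact: isoD | exact: theta_comm].
case: z => k; first exact: nat_case.
by rewrite NegzE !mulrNz thetaN; apply: screwV; apply: nat_case.
Qed.

(** Only the vectors c i - lin_part g *m c i distinguish theta a from a
translation, one for each generator, whatever its exponent. *)
Lemma theta_translation_bound (t c : 'I_n -> 'cV[R]_n) :
    (forall i, screw (theta (delta_mx 0 i)) (t i) (c i)) ->
  exists C, forall a : 'rV[int]_n,
    `|trans_part (theta a) - \sum_i t i *~ a 0 i| <= C.
Proof.
move=> sc; suff [C CP] : exists C, forall a : 'rV[int]_n,
    `|trans_part (theta (\sum_(i <- index_enum 'I_n) delta_mx 0 i *~ a 0 i))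
      - \sum_(i <- index_enum 'I_n) t i *~ a 0 i| <= C.
  exists C => a; have := CP a; congr (`|trans_part (theta _) - _| <= C).
  rewrite [RHS]row_sum_delta; apply: eq_bigr => i _.
  by rewrite -scaler_int intz.
elim: (index_enum _) => [|i s [C CP]].
  by exists 0 => a; rewrite !big_nil theta0 trans_part1 subrr normr0.
exists (n%:R * 1 * C + (`|c i| + n%:R * 1 * `|c i|)) => a; rewrite !big_cons thetaM.
have [ig gt gE] := screw_theta (a 0 i) (sc i).
set g := theta (delta_mx 0 i *~ a 0 i) in ig gt gE *; set S := \sum_(j <- s) _.
have gS : lin_part g *m (\sum_(j <- s) t j *~ a 0 j) = \sum_(j <- s) t j *~ a 0 j.
  rewrite mulmx_sumr; apply: eq_bigr => j _; rewrite -scaler_int -scalemxAr.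
  by rewrite (screw_commute (sc j) ig (theta_comm _ _)).
rewrite trans_partM //; last exact: isoD.
have -> : lin_part g *m trans_part (theta S) + trans_part g -
    (t i *~ a 0 i + \sum_(j <- s) t j *~ a 0 j) =
    lin_part g *m (trans_part (theta S) - \sum_(j <- s) t j *~ a 0 j) +
    (c i - lin_part g *m c i).
  by rewrite mulmxBr gS gE; apply/matrixP=> k l; rewrite !mxE; ring.
have Lg : `|lin_part g| <= 1 by apply/orthogonal_norm/lin_orthogonal.
apply: le_trans (ler_normD _ _) _; apply: lerD.
  apply: le_trans (mx_normM _ _) _; apply: ler_pM; rewrite ?mulr_ge0 //.
    by rewrite ler_wpM2l.
  exact: CP.
apply: le_trans (ler_normB _ _) _; rewrite lerD2l.
by apply: le_trans (mx_normM _ _) _; rewrite ler_wpM2r // ler_wpM2l.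
Qed.

(** Suppose that sum_i c_i t_i = 0 with c_i0 = 1.  For each q the integers
a_i = floor (q c_i) make sum_i a_i t_i bounded, so by discreteness two of the
isometries theta a coincide; but a_i0 = q. *)
Lemma screw_vectors_free (t c : 'I_n -> 'cV[R]_n) :
    (forall i, screw (theta (delta_mx 0 i)) (t i) (c i)) ->
  row_free (\matrix_(i, j) t i j 0).
Proof.
move=> sc; apply: contrapT => /negP; rewrite -kermx_eq0 => /rowV0Pn[x /sub_kermxP xT x0].
have [i0 xi0] : exists i, x 0 i != 0.
  by apply/existsP; apply: contraNT x0 => /existsPn x0; apply/eqP/matrixP=> i j;
    rewrite ord1 !mxE; apply/eqP/negPn/x0.
have [C CP] := theta_translation_bound sc.
pose a (q : nat) : 'rV[int]_n := \row_i Num.floor (q%:R * (x 0 i / x 0 i0)).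
have rel : \sum_i x 0 i *: t i = 0.
  apply/matrixP=> j k; rewrite ord1 summxE.
  have := congr1 (fun M : 'rV[R]_n => M 0 j) xT; rewrite mxE [RHS]mxE.
  by under eq_bigr do rewrite mxE; under [in X in _ -> X]eq_bigr do rewrite mxE; rewrite mxE.
have bnd q : `|trans_part (theta (a q))| <= C + \sum_i `|t i|.
  rewrite -[trans_part _](subrK (\sum_i t i *~ a q 0 i)).
  apply: le_trans (ler_normD _ _) _; apply: lerD; first exact: CP.
  have -> : \sum_i t i *~ a q 0 i = \sum_i ((a q 0 i)%:~R - q%:R * (x 0 i / x 0 i0)) *: t i.
    under [RHS]eq_bigr do rewrite scalerBl scaler_int mulrCA mulrC -scalerA.
    by rewrite sumrB -scaler_sumr rel scaler0 subr0.
  apply: le_trans (ler_norm_sum _ _ _) _; apply: ler_sum => i _.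
  rewrite normrZ -[leRHS]mul1r ler_wpM2r // mxE.
  have /andP[fl1 fl2] := floor_itv (q%:R * (x 0 i / x 0 i0)).
  by rewrite ler_norml; move: fl1 fl2; rewrite intrD; lra.
have [k [l [kl /theta_inj/matrixP/(_ 0 i0)]]] :=
  discrete_repetition sD isoD dD (fun q => thetaD (a q)) bnd.
have fl (q : nat) : Num.floor (q%:R : R) = q%:Z := intrKfloor q%:Z.
rewrite !mxE divff // !mulr1 !fl => /eqP; rewrite eqz_nat => /eqP kl'.
by rewrite kl' ltnn in kl.
Qed.

(** The linear part of h fixes the vectors t_i, which span the space. *)
Lemma commuting_isometry_translation h : isometry h ->
  (forall a, theta a * h = h * theta a) -> lin_part h = 1%:M.
Proof.
move=> ih comm.
have [tc sc] := choice (fun i => screw_exists (isoD (thetaD (delta_mx 0 i)))).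
have := screw_vectors_free sc; rewrite row_free_unit => uT.
set T := (X in X \in unitmx) in uT.
have TL : T *m (lin_part h)^T = T.
  apply/matrixP=> i j; have := screw_commute (sc i) ih (comm _).
  move=> /matrixP/(_ j 0); rewrite [T i j]mxE [LHS]mxE => <-; rewrite mxE.
  by apply: eq_bigr => k _; rewrite !mxE mulrC.
by apply: trmx_inj; rewrite trmx1 -[LHS](mulKmx uT) TL mulVmx.
Qed.

Lemma theta_translations_free :
  row_free (\matrix_(i < n, j < n) trans_part (theta (delta_mx 0 i)) j 0).
Proof.
have [tc sc] := choice (fun i => screw_exists (isoD (thetaD (delta_mx 0 i)))).
rewrite (_ : (\matrix_(i, j) _) = \matrix_(i, j) (tc i).1 j 0).
  exact: screw_vectors_free sc.
apply/matrixP=> i j; rewrite [LHS]mxE [RHS]mxE; have [ig _ ->] := sc i.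
by rewrite (commuting_isometry_translation ig) ?mul1mx ?subrr ?addr0 //.
Qed.

End FreeAbelian.

(** * Lifting through coverings *)

(** Connectedness of the unit interval, on which P is locally constant. *)
Lemma unit_interval_propagation (R : realType) (P : R -> Prop) : P 0 ->
    (forall s : R, 0 <= s <= 1 -> exists2 eps : R, 0 < eps & forall t t' : R,
       0 <= t <= 1 -> 0 <= t' <= 1 -> `|t - s| < eps -> `|t' - s| < eps -> P t -> P t') ->
  P 1.
Proof.
move=> P0 locP; pose B : set R := [set t | 0 <= t <= 1 /\ P t].
pose U (Q : R -> Prop) : set R := [set x | exists s eps : R, [/\ 0 < eps, `|x - s| < eps &
   forall t : R, 0 <= t <= 1 -> `|t - s| < eps -> Q t]].
have openU Q : open (U Q).
  rewrite openE => x [s [eps [eps0 xs sQ]]].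
  apply/nbhs_ballP; exists (eps - `|x - s|) => /=; first by rewrite subr_gt0.
  move=> y; rewrite -ball_normE /= ltrBrDr => xy; exists s, eps; split=> //.
  by rewrite distrC in xy; apply: le_lt_trans xy; apply: ler_distD.
have mem (t : R) : `[0, 1]%classic t <-> 0 <= t <= 1 by rewrite /= in_itv.
suff : B = `[0, 1]%classic.
  by move/seteqP=> [_ /(_ 1)]; rewrite /= in_itv /= lexx ler01 => /(_ isT) [].
apply: segment_connected.
- by exists 0; split=> //; rewrite lexx ler01.
- exists (U P); [exact: openU | apply/seteqP; split=> x].
    move=> [x01 Px]; split; first exact/mem.
    have [eps eps0 epsP] := locP x x01; exists x, eps; split; rewrite ?subrr ?normr0 //.
    by move=> t t01 tx; apply: (epsP x t); rewrite ?subrr ?normr0.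
  by move=> [/mem x01 [s [eps [_ xs sP]]]]; split=> //; apply: sP.
exists (~` U (fun t => ~ P t)); first by rewrite closedC; apply: openU.
apply/seteqP; split=> x.
  move=> [x01 Px]; split; first exact/mem.
  by move=> [s [eps [_ xs sP]]]; apply: (sP x).
move=> [/mem x01 nU]; split=> //; apply: contrapT => nPx; apply: nU.
have [eps eps0 epsP] := locP x x01; exists x, eps; split; rewrite ?subrr ?normr0 //.
by move=> t t01 tx Pt; apply: nPx; apply: (epsP t x); rewrite ?subrr ?normr0.
Qed.

Section Lifting.
Variables (R : realType) (V W : normedModType R).

Definition continuous_in (Z : set V) (f : V -> W) (z : V) :=
  forall e : R, 0 < e -> exists2 d : R, 0 < d &
    forall z', Z z' -> `|z' - z| < d -> `|f z' - f z| < e.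

Lemma continuous_inP Z f z : continuous_in Z f z <-> f @ within Z (nbhs z) --> f z.
Proof.
split=> [cf|cf e e0].
  apply/cvgrPdist_lt => e e0; rewrite near_withinE.
  have [d d0 df] := cf e e0; apply/nbhs_ballP; exists d => //= x.
  by rewrite -ball_normE /= distrC => xz Zx; rewrite distrC; apply: df.
move/cvgrPdist_lt: cf => /(_ e e0); rewrite near_withinE => /nbhs_ballP[d /= d0 df].
exists d => // z' Zz' z'z; rewrite distrC; apply: df => //.
by rewrite -ball_normE /= distrC.
Qed.

Lemma eq_near_continuous_in Z f g z d : Z z -> 0 < d ->
    (forall z', Z z' -> `|z' - z| < d -> f z' = g z') ->
  continuous_in Z g z -> continuous_in Z f z.
Proof.
move=> Zz d0 fg cg e e0; have [d' d'0 gd'] := cg e e0.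
exists (Num.min d d'); first by rewrite lt_min d0.
move=> z' Zz'; rewrite lt_min => /andP[zd zd'].
by rewrite !fg ?subrr ?normr0 //; apply: gd'.
Qed.

(** E z w reads: the point w of the total space lies over z.  The hypotheses say
that this is a covering of the convex set Z: its sheets are separated, and it is
evenly covered by sections. *)
Variables (Z : set V) (E : V -> W -> Prop).
Hypothesis convZ : forall x y t, Z x -> Z y -> 0 <= t <= 1 -> Z (x + t *: (y - x)).
Hypothesis sepE : forall z w, E z w -> exists2 d : R, 0 < d &
  forall z' w' w'', E z' w' -> E z' w'' -> `|w' - w| < d -> `|w'' - w| < d -> w' = w''.
Hypothesis evenE : forall z, Z z -> exists2 d : R, 0 < d &
  forall z1 w1, Z z1 -> `|z1 - z| < d -> E z1 w1 -> exists2 s, s z1 = w1 &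
  forall z', Z z' -> `|z' - z| < d -> E z' (s z') /\ continuous_in Z s z'.

Let path (a b : V) (t : R) := a + t *: (b - a).

Let pathB a b t s : path a b t - path a b s = (t - s) *: (b - a).
Proof. by rewrite /path opprD addrACA subrr add0r scalerBl. Qed.

Let path_affine a b t r v :
  path a b (t + v * (r - t)) = path a b t + v *: (path a b r - path a b t).
Proof. by rewrite pathB scalerA -[LHS](subrK (path a b t)) pathB addrAC subrr add0r addrC. Qed.

(** The two sections agree on an open and closed part of the segment. *)
Lemma sections_agree f g a b : Z a -> Z b -> f a = g a ->
    (forall t, 0 <= t <= 1 -> let z := a + t *: (b - a) in
      [/\ E z (f z), E z (g z), continuous_in Z f z & continuous_in Z g z]) ->
  f b = g b.
Proof.
move=> Za Zb fga fgP; pose c := path a b.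
have -> : b = c 1 by rewrite /c /path scale1r addrC subrK.
apply: (@unit_interval_propagation _ (fun t => f (c t) = g (c t))).
  by rewrite /c /path scale0r addr0.
move=> s s01; have [Ef Eg cf cg] := fgP s s01.
have near_c (h : V -> W) e : continuous_in Z h (c s) -> 0 < e -> exists2 eps : R, 0 < eps &
    forall t : R, 0 <= t <= 1 -> `|t - s| < eps -> `|h (c t) - h (c s)| < e.
  move=> ch e0; have [d d0 dh] := ch e e0.
  have b0 : 0 < `|b - a| + 1 by rewrite ltr_wpDl.
  exists (d / (`|b - a| + 1)); first by rewrite divr_gt0.
  move=> t t01 ts; apply: dh; first exact: convZ.
  rewrite pathB normrZ; rewrite ltr_pdivlMr // in ts.
  by apply: le_lt_trans ts; rewrite ler_wpM2l // lerDl.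
have near2 e : 0 < e -> exists2 eps : R, 0 < eps & forall t : R, 0 <= t <= 1 -> `|t - s| < eps ->
    `|f (c t) - f (c s)| < e /\ `|g (c t) - g (c s)| < e.
  move=> e0; have [e1 e10 fe] := near_c f e cf e0; have [e2 e20 ge] := near_c g e cg e0.
  exists (Num.min e1 e2); first by rewrite lt_min e10.
  by move=> t t01; rewrite lt_min => /andP[t1 t2]; split; [apply: fe | apply: ge].
have [fgs|fgs] := pselect (f (c s) = g (c s)).
  have [d d0 dP] := sepE Ef; have [eps eps0 epsP] := near2 d d0.
  exists eps => // t t' _ t'01 _ t's _; have [ft gt] := epsP t' t'01 t's.
  have [Ef' Eg' _ _] := fgP t' t'01.
  by apply: (dP (c t')) => //; rewrite fgs.
have d0 : 0 < `|f (c s) - g (c s)| / 2.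
  by rewrite divr_gt0 // normr_gt0 subr_eq0; apply/eqP.
have [eps eps0 epsP] := near2 _ d0.
exists eps => // t t' t01 _ ts _ fgt; have [ft gt] := epsP t t01 ts; exfalso.
have /le_lt_trans/(_ (ltrD gt ft)) := ler_normB (g (c t) - g (c s)) (f (c t) - f (c s)).
by rewrite fgt opprB [_ + (f _ - _)]addrC addrA subrK -splitr ltxx.
Qed.

(** A section near a point of the segment from a to b extends a little further
along it, so by connectedness of the unit interval it reaches b. *)
Lemma tube_section a w b : Z a -> E a w -> Z b -> exists (d : R) s, [/\ 0 < d, s a = w &
  forall z (r : R), Z z -> 0 <= r <= 1 -> `|z - (a + r *: (b - a))| < d ->
    E z (s z) /\ continuous_in Z s z].
Proof.
move=> Za Eaw Zb; pose c := path a b.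
pose P t := exists (d : R) s, [/\ 0 < d, s a = w & forall z (r : R), Z z -> 0 <= r <= t ->
  `|z - c r| < d -> E z (s z) /\ continuous_in Z s z].
suff : P 1 by [].
have c0 : c 0 = a by rewrite /c /path scale0r addr0.
apply: unit_interval_propagation.
  have [d d0 dP] := evenE Za.
  have aa : `|a - a| < d by rewrite subrr normr0.
  have [s sa sP] := dP a w Za aa Eaw.
  exists d, s; split=> // z r Zz r0; have -> : r = 0 by apply/le_anti; rewrite andbC.
  by rewrite c0; apply: sP.
move=> u u01; have [rho rho0 rhoP] := evenE (convZ Za Zb u01).
have b0 : 0 < `|b - a| + 1 by rewrite ltr_wpDl.
exists (rho / 2 / (`|b - a| + 1)); first by rewrite !divr_gt0.
have close t : `|t - u| < rho / 2 / (`|b - a| + 1) -> `|c t - c u| < rho / 2.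
  rewrite ltr_pdivlMr // pathB normrZ; apply: le_lt_trans.
  by rewrite ler_wpM2l // lerDl.
move=> t t' t01 t'01 tu t'u [d [s [d0 sa sP]]].
have Zc r : 0 <= r <= 1 -> Z (c r) by apply: convZ.
have half : rho / 2 < rho by lra.
have ct := lt_trans (close t tu) half.
have Ect : E (c t) (s (c t)).
  by apply: (sP _ t _ _ _).1; rewrite ?subrr ?normr0 ?lexx ?andbT //; [exact: Zc|case/andP: t01].
have [s1 s1E s1P] := rhoP (c t) (s (c t)) (Zc t t01) ct Ect.
have agree z r : Z z -> 0 <= r <= t -> `|z - c r| < d -> `|z - c u| < rho -> s z = s1 z.
  move=> Zz rt zr zu; apply: (@sections_agree _ _ (c t)) => //; first exact: Zc.
  move=> v v01 x; have Zx : Z x by apply: convZ => //; apply: Zc.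
  have [Es cs] : E x (s x) /\ continuous_in Z s x.
    apply: (sP x (t + v * (r - t))) => //.
      by case/andP: v01 => v0 v1; case/andP: rt => r0 rt; case/andP: t01 => ? ?;
        apply/andP; split; nra.
    have -> : x - c (t + v * (r - t)) = v *: (z - c r).
      rewrite /c path_affine opprD addrACA subrr add0r -scalerBr.
      by rewrite opprB addrA subrK.
    rewrite normrZ ger0_norm; last by case/andP: v01.
    by apply: le_lt_trans zr; rewrite ler_piMl //; case/andP: v01.
  have xu : `|x - c u| < rho.
    have -> : x - c u = (1 - v) *: (c t - c u) + v *: (z - c u).
      rewrite scalerBl scale1r -[in RHS]addrA [- (v *: _) + _]addrC -scalerBr opprB.
      by rewrite [z - _ + _]addrA subrK /x addrAC.
    apply: le_lt_trans (ler_normD _ _) _; rewrite !normrZ.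
    case/andP: v01 => v0 v1; rewrite !ger0_norm ?subr_ge0 //.
    have [->|vn0] := eqVneq v 0; first by rewrite mul0r addr0 subr0 mul1r.
    have v_gt0 : 0 < v by rewrite lt_def vn0.
    have := normr_ge0 (c t - c u); have := normr_ge0 (z - c u); nra.
  by have [] := s1P x Zx xu.
(* s1 is defined on the ball of radius rho about c u, s on the tube of radius d. *)
pose s2 z := if `|z - c u| < rho then s1 z else s z.
exists (Num.min d (rho / 2)), s2; split; first by rewrite lt_min d0 divr_gt0.
  rewrite /s2; case: ifP => // au; rewrite -sa; apply/esym/(agree a 0) => //.
    by rewrite lexx; case/andP: t01.
  by rewrite c0 subrr normr0.
move=> z r Zz rt'; rewrite lt_min => /andP[zd zrho].
have [zu|zu] := ltP `|z - c u| rho.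
  have [Es1 cs1] := s1P z Zz zu; split; first by rewrite /s2 zu.
  apply: (@eq_near_continuous_in _ _ s1 _ (rho - `|z - c u|)) => //; first by rewrite subr_gt0.
  move=> z' _; rewrite ltrBrDr => zz'; rewrite /s2 (le_lt_trans (ler_distD z _ _)) //.
have rt : 0 <= r <= t.
  case/andP: rt' => r0 rt'; rewrite r0 leNgt /=; apply/negP => tr.
  have /close cr : `|r - u| < rho / 2 / (`|b - a| + 1).
    by move: tu t'u; rewrite !ltr_norml => /andP[? ?] /andP[? ?]; apply/andP; split; lra.
  have := le_lt_trans (ler_distD (c r) z (c u)) (ltrD zrho cr).
  by rewrite -splitr ltNge zu.
have [Es cs] := sP z r Zz rt zd; split; first by rewrite /s2 ltNge zu.
apply: (@eq_near_continuous_in _ _ s _ (d - `|z - c r|)) => //; first by rewrite subr_gt0.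
move=> z' Zz'; rewrite ltrBrDr => zz'; rewrite /s2; case: ifP => // z'u.
by apply/esym/(agree z' r) => //; apply: le_lt_trans (ler_distD z _ _) zz'.
Qed.

(** Two sections along segments from a to nearby end points agree where both are
defined, so their values at the end points form a continuous section. *)
Lemma global_section a w : Z a -> E a w ->
  exists f, f a = w /\ forall z, Z z -> E z (f z) /\ continuous_in Z f z.
Proof.
move=> Za Eaw.
have tube b : exists ds : R * (V -> W), Z b -> [/\ 0 < ds.1, ds.2 a = w &
    forall z (r : R), Z z -> 0 <= r <= 1 -> `|z - (a + r *: (b - a))| < ds.1 ->
      E z (ds.2 z) /\ continuous_in Z ds.2 z].
  have [Zb|nZb] := pselect (Z b); last by exists (0, fun=> w).
  by have [d [s ds]] := tube_section Za Eaw Zb; exists (d, s).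
have [F FP] := choice tube; exists (fun b => (F b).2 b); split; first by case: (FP a Za).
have end1 (b : V) : b = a + 1 *: (b - a) by rewrite scale1r addrC subrK.
move=> b Zb; have [d0 sa sP] := FP b Zb.
have [||Eb cb] := sP b 1 Zb; first by rewrite ler01 lexx.
  by rewrite -end1 subrr normr0.
split=> //; apply: (@eq_near_continuous_in _ _ (F b).2 _ (F b).1) => // z Zz zb.
have [dz0 sza szP] := FP z Zz.
apply: (@sections_agree _ _ a) => //; first by rewrite sa.
move=> t t01 x; have Zx : Z x by apply: convZ.
have [] := szP x t Zx t01; first by rewrite subrr normr0.
have [] // := sP x t Zx t01.
rewrite -[_ - _]/(path a z t - path a b t) /path opprD addrACA subrr add0r -scalerBr.
rewrite opprB addrA subrK normrZ ger0_norm; last by case/andP: t01.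
by apply: le_lt_trans zb; rewrite ler_piMl //; case/andP: t01.
Qed.

End Lifting.

(** * Homeomorphic orbit spaces of the half cylinder *)

Section HalfCylinder.
Variables (R : realType) (n : nat).
Implicit Types (g h : 'M[R]_n.+1) (D : set 'M[R]_n.+1) (z w : 'cV[R]_n.+1).

Definition cyl_act g z : 'cV[R]_n.+1 :=
  col_mx (usubmx (z : 'cV[R]_(1 + n))) (isom_act g (dsubmx (z : 'cV[R]_(1 + n)))).

Definition cyl_base z : 'cV[R]_n := dsubmx (z : 'cV[R]_(1 + n)).

Lemma cyl_base_act g z : cyl_base (cyl_act g z) = isom_act g (cyl_base z).
Proof. exact: col_mxKd. Qed.

Lemma cyl_actM g h z : isometry g -> isometry h ->
  cyl_act (g * h) z = cyl_act g (cyl_act h z).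
Proof.
by move=> ig ih; rewrite /cyl_act (@col_mxKu _ 1 n 1) (@col_mxKd _ 1 n 1) isom_actM.
Qed.

Lemma cyl_act1 z : cyl_act 1 z = z.
Proof. by rewrite /cyl_act isom_act1 (@vsubmxK _ 1 n 1). Qed.

Lemma head_col_mx (a : 'cV[R]_1) (b : 'cV[R]_n) :
  (col_mx a b : 'cV[R]_n.+1) ord0 ord0 = a 0 0.
Proof.
have -> : ord0 = @lshift 1 n 0 :> 'I_n.+1 by exact: val_inj.
by rewrite (@col_mxEu _ 1 n 1).
Qed.

Lemma head_usubmx z : usubmx (z : 'cV[R]_(1 + n)) 0 0 = z ord0 ord0.
Proof. by rewrite mxE; congr (z _ _); apply: val_inj. Qed.

Lemma cyl_act_height g z : cyl_act g z ord0 ord0 = z ord0 ord0.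
Proof. by rewrite head_col_mx head_usubmx. Qed.

Lemma cyl_act_half g z : @half_cylinder R n z -> @half_cylinder R n (cyl_act g z).
Proof. by rewrite /half_cylinder /= cyl_act_height. Qed.

Lemma half_cylinder_convex z w (t : R) : @half_cylinder R n z -> @half_cylinder R n w ->
  0 <= t <= 1 -> @half_cylinder R n (z + t *: (w - z)).
Proof.
rewrite /half_cylinder /= !mxE => z0 w0 /andP[t0 t1]; nra.
Qed.

Lemma cyl_base_norm z w : `|cyl_base z - cyl_base w| <= `|z - w|.
Proof.
apply/mx_norm_le => // i j; rewrite !mxE.
by apply: le_trans (mx_norm_entry (z - w) (rshift 1 i) j); rewrite !mxE.
Qed.

Lemma cyl_act_norm g z w : isometry g ->
  `|cyl_act g z - cyl_act g w| <= (1 + n%:R) * `|z - w|.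
Proof.
move=> ig.
have -> : cyl_act g z - cyl_act g w = col_mx (usubmx (z - w : 'cV[R]_(1 + n)))
    (lin_part g *m (cyl_base z - cyl_base w)).
  rewrite /cyl_act (@opp_col_mx _ 1 n 1) (@add_col_mx _ 1 n 1) /isom_act.
  congr (@col_mx R 1 n 1 _ _).
    by rewrite linearB.
  by rewrite mulmxBr opprD addrACA subrr addr0.
apply/mx_norm_le => [|i j]; first by rewrite mulr_ge0 // addr_ge0.
case: (@split_ordP 1 n i) => k ->.
  rewrite (@col_mxEu _ 1 n 1) mxE; apply: le_trans (mx_norm_entry _ _ _) _.
  by rewrite ler_peMl // lerDl.
rewrite (@col_mxEd _ 1 n 1); apply: le_trans (mx_norm_entry _ _ _) _.
apply: le_trans (mx_normM _ _) _; rewrite -mulrA ler_pM // ?mulr_ge0 // ?lerDr //.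
rewrite -[leRHS]mul1r ler_pM // ?cyl_base_norm //.
exact/orthogonal_norm/lin_orthogonal.
Qed.

Lemma continuous_cyl_act (Z : set 'cV[R]_n.+1) (f : 'cV[R]_n.+1 -> 'cV[R]_n.+1) g z :
  isometry g -> continuous_in Z f z -> continuous_in Z (cyl_act g \o f) z.
Proof.
move=> ig cf e e0; have c0 : 0 < 1 + n%:R :> R by rewrite ltr_wpDr.
have [d d0 df] := cf (e / (1 + n%:R)) (divr_gt0 e0 c0).
exists d => // z' Zz' zd; apply: le_lt_trans (cyl_act_norm _ _ ig) _.
by rewrite mulrC -ltr_pdivlMr //; apply: df.
Qed.

Lemma continuous_in_cyl_act (f : 'cV[R]_n.+1 -> 'cV[R]_n.+1) g z : isometry g ->
  continuous_in (@half_cylinder R n) f (cyl_act g z) ->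
  continuous_in (@half_cylinder R n) (f \o cyl_act g) z.
Proof.
move=> ig cf e e0; have c0 : 0 < 1 + n%:R :> R by rewrite ltr_wpDr.
have [d d0 df] := cf e e0; exists (d / (1 + n%:R)); first exact: divr_gt0.
move=> z' Zz'; rewrite ltr_pdivlMr // mulrC => zd.
by apply: df; [exact: cyl_act_half | apply: le_lt_trans (cyl_act_norm _ _ ig) zd].
Qed.

Lemma cyl_separated D w : subgroup D -> (forall g, D g -> isometry g) -> discrete_group D ->
    (forall g x, D g -> isom_act g x = x -> g = 1) ->
  exists2 d : R, 0 < d & forall g w', D g -> `|w' - w| < d -> `|cyl_act g w' - w| < d ->
    g = 1.
Proof.
move=> sD isoD dD free; have [d d0 dP] := proper_discontinuity (cyl_base w) sD isoD dD free.
exists d => // g w' Dg w'w gw'w; apply: (dP g (cyl_base w')) => //.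
  exact: le_lt_trans (cyl_base_norm _ _) w'w.
by rewrite -cyl_base_act; apply: le_lt_trans (cyl_base_norm _ _) gw'w.
Qed.

End HalfCylinder.

Section OrbitSpaceMaps.
Variables (R : realType) (n : nat).
Local Notation Z := (@half_cylinder R n).
Variables (D : set 'M[R]_n.+1) (M : 'cV[R]_n.+1 -> 'cV[R]_n.+1 -> Prop).
Hypotheses (sD : subgroup D) (isoD : forall g, D g -> isometry g).
Hypotheses (dD : discrete_group D) (freeD : forall g x, D g -> isom_act g x = x -> g = 1).
(** M z w reads: the orbit of z corresponds to the orbit of w. *)
Hypothesis M_act : forall z w g, M z w -> D g -> M z (cyl_act g w).
Hypothesis M_orbit : forall z w w', M z w -> M z w' -> exists2 g, D g & w' = cyl_act g w.

Lemma orbit_map_separated z w : M z w -> exists2 d : R, 0 < d &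
  forall z' w' w'', M z' w' -> M z' w'' -> `|w' - w| < d -> `|w'' - w| < d -> w' = w''.
Proof.
move=> Mzw; have [d d0 dP] := cyl_separated w sD isoD dD freeD; exists d => //.
move=> z' w' w'' M' M'' w'd w''d; have [g Dg w''E] := M_orbit M' M''.
by rewrite w''E (dP g w') ?cyl_act1 // -w''E.
Qed.

Hypothesis M_local : forall z, Z z -> exists (d : R) s, 0 < d /\
  forall z', Z z' -> `|z' - z| < d -> M z' (s z') /\ continuous_in Z s z'.

(** Moved by D, a local lift goes through any given point over its domain. *)
Lemma orbit_map_lift : exists f, forall z, Z z -> M z (f z) /\ continuous_in Z f z.
Proof.
have Z0 : Z 0 by rewrite /half_cylinder /= mxE.
have [d [s [d0 sP]]] := M_local Z0.
have [|Ms0 _] := sP 0 Z0; first by rewrite subrr normr0.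
have [|f [_ fP]] := global_section (@half_cylinder_convex R n) orbit_map_separated _ Z0 Ms0;
  last by exists f.
move=> z Zz; have [d' [s' [d'0 s'P]]] := M_local Zz; exists d' => // z1 w1 Zz1 z1d Mzw1.
have [M1 _] := s'P z1 Zz1 z1d; have [g Dg w1E] := M_orbit M1 Mzw1.
exists (cyl_act g \o s'); first by rewrite /= -w1E.
move=> z' Zz' z'd; have [M' c'] := s'P z' Zz' z'd; split; first exact: M_act.
by apply: continuous_cyl_act => //; apply: isoD.
Qed.

End OrbitSpaceMaps.

Section OrbitSpaceHomeo.
Variables (R : realType) (n : nat).
Local Notation Z := (@half_cylinder R n).
Variables (D1 D2 : set 'M[R]_n.+1) (M : 'cV[R]_n.+1 -> 'cV[R]_n.+1 -> Prop).
Hypotheses (sD1 : subgroup D1) (isoD1 : forall g, D1 g -> isometry g).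
Hypotheses (dD1 : discrete_group D1).
Hypothesis freeD1 : forall g x, D1 g -> isom_act g x = x -> g = 1.
Hypotheses (sD2 : subgroup D2) (isoD2 : forall g, D2 g -> isometry g).
Hypotheses (dD2 : discrete_group D2).
Hypothesis freeD2 : forall g x, D2 g -> isom_act g x = x -> g = 1.
Hypothesis M_half : forall z w, M z w -> Z z /\ Z w.
Hypothesis M_act1 : forall z w g, M z w -> D1 g -> M (cyl_act g z) w.
Hypothesis M_orbit1 : forall z z' w, M z w -> M z' w -> exists2 g, D1 g & z' = cyl_act g z.
Hypothesis M_act2 : forall z w g, M z w -> D2 g -> M z (cyl_act g w).
Hypothesis M_orbit2 : forall z w w', M z w -> M z w' -> exists2 g, D2 g & w' = cyl_act g w.
Hypothesis M_local1 : forall z, Z z -> exists (d : R) s, 0 < d /\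
  forall z', Z z' -> `|z' - z| < d -> M z' (s z') /\ continuous_in Z s z'.
Hypothesis M_local2 : forall w, Z w -> exists (d : R) s, 0 < d /\
  forall w', Z w' -> `|w' - w| < d -> M (s w') w' /\ continuous_in Z s w'.

Let free_inj (D : set 'M[R]_n.+1) g h (z : 'cV[R]_n.+1) :
  subgroup D -> (forall g, D g -> isometry g) ->
  (forall g x, D g -> isom_act g x = x -> g = 1) ->
  D g -> D h -> cyl_act g z = cyl_act h z -> g = h.
Proof.
move=> [uD D1' DM DV] isoD free Dg Dh /(congr1 (@cyl_base R n)); rewrite !cyl_base_act.
set x := cyl_base z => gx; apply: (mulrI (isometry_unit (isoD _ (DV _ Dh)))).
rewrite mulVr ?isometry_unit //; last exact: isoD.
have [iV ig ih] : [/\ isometry h^-1, isometry g & isometry h].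
  by split; apply: isoD => //; apply: DV.
apply: (free _ x); first by apply: DM => //; apply: DV.
by rewrite isom_actM // gx -isom_actM // mulVr ?isom_act1 // isometry_unit.
Qed.

(** The two actions are the deck transformations of two coverings of the same
quotient.  A lift f of the homeomorphism intertwines them; the lift F of the
inverse makes the resulting homomorphism injective, as F \o f is the action of an
element of D1. *)
Lemma orbit_space_homeo_injection : exists phi : 'M[R]_n.+1 -> 'M[R]_n.+1,
  [/\ forall g, D1 g -> D2 (phi g),
      forall g h, D1 g -> D1 h -> phi (g * h) = phi g * phi h &
      forall g h, D1 g -> D1 h -> phi g = phi h -> g = h].
Proof.
have Z0 : Z 0 by rewrite /half_cylinder /= mxE.
have [_ _ DM1 DV1] := sD1; have [_ _ DM2 DV2] := sD2.
have [f fP] := orbit_map_lift sD2 isoD2 dD2 freeD2 M_act2 M_orbit2 M_local1.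
have [F FP] := @orbit_map_lift R n D1 (fun w z => M z w) sD1 isoD1 dD1 freeD1
  (fun z w g => @M_act1 w z g) (fun w z z' => @M_orbit1 z z' w) M_local2.
have Zf z : Z z -> Z (f z) by move=> /fP[/M_half[]].
have deck g : exists u, D1 g -> D2 u /\ forall z, Z z -> f (cyl_act g z) = cyl_act u (f z).
  have [Dg|nDg] := pselect (D1 g); last by exists 1.
  have [iV ig] : isometry g^-1 /\ isometry g by split; apply: isoD1 => //; apply: DV1.
  have Mfg z : Z z -> M z (f (cyl_act g z)).
    move=> Zz; have [Mg _] := fP _ (cyl_act_half g Zz).
    have := M_act1 Mg (DV1 _ Dg).
    by rewrite -cyl_actM // mulVr ?isometry_unit // cyl_act1.
  have [u Du uE] := M_orbit2 (fP _ Z0).1 (Mfg _ Z0).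
  exists u => _; split=> // z Zz.
  apply: (sections_agree (@half_cylinder_convex R n)
    (orbit_map_separated sD2 isoD2 dD2 freeD2 M_orbit2) (f := f \o cyl_act g)
    (g := cyl_act u \o f) Z0) => // t t01 x.
  have Zx : Z x by apply: half_cylinder_convex.
  split; first exact: Mfg.
  - by apply: M_act2 => //; case: (fP _ Zx).
  - by apply: continuous_in_cyl_act => //; case: (fP _ (cyl_act_half g Zx)).
  - by apply: continuous_cyl_act; [exact: isoD2 | case: (fP _ Zx)].
have [phi phiP] := choice deck; exists phi; split.
- by move=> g /phiP[].
- move=> g h Dg Dh; have [Du uE] := phiP g Dg; have [Dv vE] := phiP h Dh.
  have [Dw wE] := phiP _ (DM1 _ _ Dg Dh).
  apply: (free_inj (z := f 0) sD2 isoD2 freeD2) => //; first exact: DM2.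
  rewrite -wE // cyl_actM ?uE ?vE //; try exact: isoD1; try exact: isoD2.
    by rewrite cyl_actM //; exact: isoD2.
  exact: cyl_act_half.
move=> g h Dg Dh gh; have [Du uE] := phiP g Dg; have [Dv vE] := phiP h Dh.
pose orb z z' := Z z /\ exists2 k, D1 k & z' = cyl_act k z.
have orb_orbit z w w' : orb z w -> orb z w' -> exists2 k, D1 k & w' = cyl_act k w.
  move=> [_ [k Dk ->]] [_ [k' Dk' ->]]; exists (k' * k^-1).
    by apply: DM1 => //; apply: DV1.
  have [ik ik' iV] : [/\ isometry k, isometry k' & isometry k^-1].
    by split; apply: isoD1 => //; apply: DV1.
  by rewrite -cyl_actM ?mulrVK ?isometry_unit //; apply/isoD1/DM1 => //; apply: DV1.
have Zg := cyl_act_half g Z0; have Zh := cyl_act_half h Z0.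
have MF z : Z z -> orb z (F (f z)).
  by move=> Zz; split=> //; apply: M_orbit1 (fP _ Zz).1 (FP _ (Zf _ Zz)).1.
have [_ [k Dk kE]] := MF _ Zg; have ik := isoD1 Dk.
have kF : F (f (cyl_act h 0)) = cyl_act k (cyl_act h 0).
  apply: (sections_agree (@half_cylinder_convex R n)
    (orbit_map_separated sD1 isoD1 dD1 freeD1 orb_orbit) (f := F \o f)
    (g := cyl_act k) Zg) => // t t01 x.
  have Zx : Z x by apply: half_cylinder_convex.
  split; [exact: MF | by split=> //; exists k | |].
  - have [_ cf] := fP _ Zx; have [_ cF] := FP _ (Zf _ Zx); move=> e e0.
    have [d d0 dF] := cF e e0; have [d' d'0 df] := cf d d0.
    by exists d' => // z' Zz' z'd; apply: dF; [exact: Zf | exact: df].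
  - by apply: (@continuous_cyl_act _ _ _ id) => // e e0; exists e.
have fgh : f (cyl_act g 0) = f (cyl_act h 0) by rewrite uE // vE // gh.
apply: (free_inj (z := 0) sD1 isoD1 freeD1) => //.
have : cyl_act k^-1 (F (f (cyl_act g 0))) = cyl_act k^-1 (F (f (cyl_act h 0))) by rewrite fgh.
have iV : isometry k^-1 by apply/isoD1/DV1.
by rewrite kE kF -!(cyl_actM _ iV ik) mulVr ?cyl_act1 // isometry_unit.
Qed.

End OrbitSpaceHomeo.

(** * Null frames of Lorentzian forms *)

Section NullCoordinates.
Variable R : realType.

Lemma tr_mx11 (M : 'M[R]_1) : M^T = M.
Proof. by apply/matrixP=> i j; rewrite mxE !ord1. Qed.

(** The Householder reflection exchanging u and the first basis vector. *)
Lemma orthogonal_first_column n (u : 'cV[R]_(1 + n)) : u^T *m u = 1%:M ->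
  exists2 O : 'M[R]_(1 + n), O^T *m O = 1%:M & O *m col_mx 1%:M 0 = u.
Proof.
move=> uu; set e : 'cV[R]_(1 + n) := col_mx 1%:M 0.
have ee : e^T *m e = 1%:M.
  by rewrite tr_col_mx mul_row_col trmx1 trmx0 mul1mx mul0mx addr0.
have [->|ue] := eqVneq u e; first by exists 1%:M; rewrite ?trmx1 ?mul1mx.
pose w := u - e; pose c := (w^T *m w) 0 0.
have wwE : w^T *m w = c%:M by rewrite [LHS]mx11_scalar.
have c0 : c != 0.
  apply: contra_neq ue => c0; apply/subr0_eq/dot_eq0.
  by rewrite wwE c0; apply/matrixP=> i j; rewrite !mxE mul0rn.
have wT : w^T = u^T - e^T by rewrite /w linearB.
have weE : w^T *m e = (- (c / 2))%:M.
  have eu : e^T *m u = u^T *m e by rewrite -[LHS]tr_mx11 trmx_mul trmxK.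
  have : w^T *m w = 2%:R *: 1%:M - 2%:R *: (u^T *m e).
    rewrite wT mulmxBl !mulmxBr uu ee eu.
    by apply/matrixP=> i j; rewrite !mxE; ring.
  rewrite wwE => cE.
  have -> : w^T *m e = u^T *m e - 1%:M by rewrite wT mulmxBl ee.
  apply/matrixP=> i j; move/matrixP/(_ i j): cE; rewrite !ord1 !mxE eqxx !mulr1n.
  by move=> ->; field.
exists (1%:M - (2 / c) *: (w *m w^T)).
  rewrite [X in X *m _]linearB /= linearZ /= trmx_mul trmxK trmx1.
  rewrite mulmxBl mul1mx mulmxBr mulmx1 -!scalemxAl -!scalemxAr mulmxA -(mulmxA w).
  rewrite wwE mul_mx_scalar -scalemxAl !scalerA.
  apply/matrixP=> i j; rewrite !mxE; field.
  exact: c0.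
rewrite mulmxBl mul1mx -scalemxAl -mulmxA weE mul_mx_scalar scalerA.
rewrite (_ : 2 / c * - (c / 2) = -1); last by field.
by rewrite scaleN1r opprK /w addrC subrK.
Qed.

Variable n : nat.

(** The Gram matrix of xi, eta and an orthonormal basis of their complement,
where xi and eta are null vectors with product -1. *)
Definition null_form : 'M[R]_(1 + (1 + n)) :=
  block_mx 0 (row_mx (- 1%:M) 0) (col_mx (- 1%:M) 0) (block_mx 0 0 0 1%:M).

Lemma null_formK : null_form *m null_form = 1%:M.
Proof.
rewrite mulmx_block mulmx0 add0r mul0mx add0r mul_row_block mul_block_col.
rewrite !mulmx0 !mul0mx !addr0 mul_row_col mul_col_row mulmx_block.
rewrite !mulmx0 !mul0mx !mulNmx !mulmxN !opprK !mul1mx !addr0 !add0r.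
rewrite row_mx0 col_mx0 add_block_mx !addr0 !add0r.
by rewrite -scalar_mx_block -scalar_mx_block.
Qed.

Definition is_null_frame (B : 'M[R]_n.+2) (xi : 'cV[R]_n.+2) (P : 'M[R]_(1 + (1 + n))) :=
  [/\ P \in unitmx, P^T *m B *m P = null_form & P *m col_mx 1%:M 0 = xi].

(** After a rotation of the positive part of a diagonalizing basis, the null
vector xi is c (f + f') where f and f' are orthogonal of norms -1 and 1; take
eta = (f - f') / 2 c. *)
Lemma null_frame_exists (B : 'M[R]_n.+2) (xi : 'cV[R]_n.+2) :
    (exists2 P : 'M[R]_n.+2, P \in unitmx &
      P^T *m B *m P = diag_mx (\row_i (if i == ord_max then -1 else 1))) ->
    xi != 0 -> xi^T *m B *m xi = 0 ->
  exists P, is_null_frame B xi P.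
Proof.
move=> [P0 uP0 P0E] xi0 xixi.
(* The negative vector is moved to the front. *)
pose s : 'S_n.+2 := tperm ord0 ord_max.
have [P1 uP1 P1E] : exists2 P1 : 'M[R]_(1 + (1 + n)), P1 \in unitmx &
    P1^T *m B *m P1 = block_mx (- 1%:M) 0 0 1%:M.
  exists (P0 *m perm_mx s); first by rewrite unitmx_mul uP0 unitmx_perm.
  have sV : (s^-1)%g = s by apply: tpermV.
  rewrite trmx_mul !mulmxA -2!(mulmxA (perm_mx s)^T) P0E.
  rewrite tr_perm_mx sV -row_permE -[X in _ *m perm_mx X]sV -col_permE.
  have sE (i : 'I_n.+2) : (s i == ord_max) = (i == ord0).
    by rewrite -{1}[ord_max](tpermL ord0) (inj_eq perm_inj).
  have e0 : @lshift 1 (1 + n) 0 = ord0 :> 'I_n.+2 by exact: val_inj.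
  have e1 (i : 'I_(1 + n)) : (@rshift 1 (1 + n) i == ord0 :> 'I_n.+2) = false by [].
  have lr i j : (@lshift 1 (1 + n) i == @rshift 1 (1 + n) j :> 'I_n.+2) = false.
    exact: (@eq_lrshift 1 (1 + n) i j).
  have rl i j : (@rshift 1 (1 + n) i == @lshift 1 (1 + n) j :> 'I_n.+2) = false.
    exact: (@eq_rlshift 1 (1 + n) i j).
  have rr i j : (@rshift 1 (1 + n) i == @rshift 1 (1 + n) j :> 'I_n.+2) = (i == j).
    exact: (@eq_rshift 1 (1 + n) i j).
  apply/matrixP=> i j; rewrite [LHS]mxE [LHS]mxE [LHS]mxE (inj_eq perm_inj).
  rewrite mxE sE.
  case: (@split_ordP 1 (1 + n) i) => i' ->; case: (@split_ordP 1 (1 + n) j) => j' ->.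
  - by rewrite block_mxEul !ord1 !mxE e0 !eqxx !mulr1n.
  - by rewrite block_mxEur !mxE lr.
  - by rewrite block_mxEdl !mxE rl.
  - by rewrite block_mxEdr !mxE e1 rr.
have [y yE] : exists y : 'cV[R]_(1 + (1 + n)), P1 *m y = xi.
  by exists (invmx P1 *m xi); rewrite mulKVmx.
pose c : R := usubmx y 0 0; pose a := dsubmx y.
have y_col : y = col_mx c%:M a by rewrite -[c%:M]mx11_scalar vsubmxK.
have aa : a^T *m a = (c ^+ 2)%:M.
  have : y^T *m (P1^T *m B *m P1) *m y = 0.
    by rewrite -xixi -yE trmx_mul !mulmxA.
  rewrite P1E.
  rewrite y_col tr_col_mx mul_row_block !mulmx0 addr0 add0r mulmx1 mul_row_col.
  rewrite mulmxN mulmx1 mulNmx tr_scalar_mx -scalar_mxM addrC => /subr0_eq ->.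
  by rewrite expr2.
have c0 : c != 0.
  apply: contra_neq xi0 => c0; rewrite -yE y_col.
  have -> : a = 0 by apply: dot_eq0; rewrite aa c0 expr0n /= raddf0.
  by rewrite c0 raddf0 col_mx0 mulmx0.
(* y = (c; a) with |a|^2 = c^2. *)
have [|O OO Oe] := @orthogonal_first_column n (c^-1 *: a).
  rewrite [(c^-1 *: a)^T]linearZ /= -scalemxAl -scalemxAr aa scalerA scale_scalar_mx.
  congr (_%:M).
  by field.
pose P2 := P1 *m block_mx 1%:M 0 0 O.
have P2E : P2^T *m B *m P2 = block_mx (- 1%:M) 0 0 1%:M.
  rewrite /P2 trmx_mul !mulmxA -2!(mulmxA _^T) P1E tr_block_mx !trmx0 trmx1.
  rewrite !mulmx_block !(mulmx0, mul0mx, addr0, add0r, mulmx1, mul1mx) OO //.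
pose N : 'M[R]_(1 + (1 + n)) := block_mx c%:M (row_mx (c *+ 2)^-1%:M 0)
  (col_mx c%:M 0) (block_mx (- (c *+ 2)^-1)%:M 0 0 1%:M).
have NE : N^T *m block_mx (- 1%:M) 0 0 1%:M *m N = null_form.
  rewrite /N /null_form !(tr_block_mx, tr_row_mx, tr_col_mx, trmx0, tr_scalar_mx).
  rewrite !mulmx_block !(mulmx0, mul0mx, addr0, add0r, mulmx1, mul1mx, mulmxN, mulNmx).
  rewrite !(mul_row_col, mul_row_block, mul_mx_row, mul_col_mx, mul_block_col,
    mul_col_row, mulmx_block) !(mulmx0, mul0mx, addr0, add0r, mulmx1) -!scalar_mxM.
  rewrite !(opp_row_mx, opp_col_mx, opp_block_mx, add_row_mx, add_col_mx, add_block_mx).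
  rewrite !(oppr0, addr0, add0r) addNr -!raddfN -!raddfD /=.
  have -> : - (c * (c *+ 2)^-1) + c * - (c *+ 2)^-1 = -1 by field.
  have -> : - ((c *+ 2)^-1 * c) + - (c *+ 2)^-1 * c = -1 by field.
  rewrite -block_mxEh -block_mxEv add_block_mx !addr0 add0r -raddfD /=.
  have -> : - ((c *+ 2)^-1 * (c *+ 2)^-1) + - (c *+ 2)^-1 * - (c *+ 2)^-1 = 0 by field.
  by rewrite raddf0.
exists (P2 *m N).
have PE : (P2 *m N)^T *m B *m (P2 *m N) = null_form.
  have -> : (P2 *m N)^T *m B *m (P2 *m N) = N^T *m (P2^T *m B *m P2) *m N.
    by rewrite trmx_mul !mulmxA.
  by rewrite P2E.
split=> //.
  have : null_form *m (P2 *m N)^T *m B *m (P2 *m N) = 1%:M.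
    by rewrite -[RHS]null_formK -[X in _ = _ *m X]PE !mulmxA.
  by case/mulmx1_unit.
rewrite -mulmxA [N *m _]mul_block_col !mulmx0 !addr0 !mulmx1.
rewrite -mulmxA mul_block_col mul1mx !mul0mx addr0 add0r.
have -> : col_mx c%:M 0 = c *: col_mx 1%:M 0 :> 'cV[R]_(1 + n).
  by rewrite scale_col_mx scaler0 scale_scalar_mx mulr1.
by rewrite -scalemxAr Oe scalerA divff // scale1r -y_col yE.
Qed.

End NullCoordinates.

(** * Stabilizers of null vectors and coordinates on horoballs *)

Section Stabilizer.
Variables (R : realType) (n : nat).
Implicit Types (g h : 'M[R]_n.+1) (v : 'cV[R]_n) (L : 'M[R]_n).

(** The matrix, in a null frame, of the Lorentz transformation which fixes xi and
acts on the horospheres centred at xi as the isometry g. *)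
Definition horo_mx g : 'M[R]_(1 + (1 + n)) :=
  block_mx 1%:M (row_mx (2^-1 *: ((trans_part g)^T *m trans_part g))
                        ((trans_part g)^T *m lin_part g)) 0 (g : 'M[R]_(1 + n)).

(** Invariance of the product with xi makes the lower right block of M affine; the
other blocks of the equation make it an isometry and determine its first row. *)
Lemma null_form_stabilizer (M : 'M[R]_(1 + (1 + n))) :
    M^T *m null_form R n *m M = null_form R n -> M *m col_mx 1%:M 0 = col_mx 1%:M 0 ->
  isometry (drsubmx M : 'M[R]_n.+1) /\ M = horo_mx (drsubmx M).
Proof.
move=> MJ Me; pose r : 'rV[R]_(1 + n) := row_mx (- 1%:M) 0.
pose J' : 'M[R]_(1 + n) := block_mx 0 0 0 1%:M.
have JE : null_form R n = block_mx 0 r r^T J'.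
  by rewrite /null_form /r tr_row_mx linearN /= trmx1 trmx0.
have [b [m ME]] : exists b m, M = block_mx 1%:M b 0 m.
  exists (ursubmx M), (drsubmx M); rewrite -[LHS]submxK.
  move: Me; rewrite -[M in M *m _]submxK mul_block_col !mulmx1 !mulmx0 !addr0.
  by move=> /eq_col_mx[-> ->].
move: MJ; rewrite JE ME tr_block_mx trmx1 trmx0 !mulmx_block.
rewrite !(mulmx1, mul1mx, mulmx0, mul0mx, addr0, add0r).
move=> /eq_block_mx[_ rm _ ].
have mr : m^T *m r^T = r^T by rewrite -trmx_mul rm.
rewrite mulmxDl -!mulmxA rm (mulmxA m^T r^T) mr.
have [m00 [m01 [v [L mE]]]] : exists m00 m01 v L, m = block_mx m00 m01 v L.
  by exists (ulsubmx m), (ursubmx m), (dlsubmx m), (drsubmx m); rewrite submxK.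
have {rm} [m00E m01E] : m00 = 1%:M /\ m01 = 0.
  have := rm; rewrite {1}/r mE mul_row_block !mul0mx !addr0 !mulNmx !mul1mx.
  by move=> /eq_row_mx[/oppr_inj -> /eqP]; rewrite oppr_eq0 => /eqP.
rewrite {}m00E {}m01E in mE.
have [a [c bE]] : exists a c, b = row_mx a c.
  by exists (lsubmx b), (rsubmx b); rewrite hsubmxK.
rewrite /r /J' mE bE !tr_row_mx tr_block_mx linearN /= !(trmx0, trmx1) !mulmx_block.
rewrite !(mul_col_row, mul_mx_row, mulmx1, mul1mx, mulmx0, mul0mx, addr0, add0r).
rewrite !(mulmxN, mulNmx, mulmx1, mul1mx, mulmx0, mul0mx, oppr0, add_block_mx, addr0, add0r).
move=> /eq_block_mx[e00 e01 _ LL].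
have iso : isometry (m : 'M[R]_n.+1) by exists L, v; rewrite mE.
have drE : drsubmx (block_mx (1%:M : 'M[R]_1) b 0 m) = m by rewrite block_mxKdr.
rewrite -mE -bE drE; split=> //.
rewrite /horo_mx; congr (block_mx _ _ _ _); rewrite bE mE.
rewrite -/(euclidean L v) trans_euclidean lin_euclidean; congr row_mx.
  move: e00; rewrite (tr_mx11 a) => e00.
  have -> : v^T *m v = 2 *: a.
    by apply/matrixP=> i j; move/matrixP/(_ i j): e00; rewrite !mxE; lra.
  by rewrite scalerA mulVf ?scale1r.
by apply/matrixP=> i j; move/matrixP/(_ i j): e01; rewrite !mxE; lra.
Qed.

End Stabilizer.

Section HoroballCoordinates.
Variables (R : realType) (n : nat) (A : 'M[rat]_n.+2) (e xi : 'cV[R]_n.+2).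
Variable P : 'M[R]_(1 + (1 + n)).
Let B := realmx R A.
Hypothesis frameP : is_null_frame B xi P.
Hypothesis qe : qform A e = -1.
Hypothesis ideal_xi : ideal_vector A e xi.

Let uP : P \in unitmx. Proof. by case: frameP. Qed.

Definition stab (g : 'M[R]_n.+2) := g^T *m B *m g = B /\ g *m xi = xi.

(** The isometry of the horospheres induced by g. *)
Definition rho (g : 'M[R]_n.+2) : 'M[R]_n.+1 := drsubmx (invmx P *m g *m P).

Lemma rhoP g : stab g -> isometry (rho g) /\ g = P *m horo_mx (rho g) *m invmx P.
Proof.
move=> [gB gxi]; have [_ PB Pe] := frameP; rewrite /rho.
have gP : g *m P = P *m (invmx P *m g *m P) by rewrite !mulmxA mulmxV // mul1mx.
move: (invmx P *m g *m P) gP => M gP.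
have [||iso ME] := @null_form_stabilizer R n M.
- have -> : M^T *m null_form R n *m M = (P *m M)^T *m B *m (P *m M).
    by rewrite -PB trmx_mul !mulmxA.
  by rewrite -gP -PB -[in RHS]gB trmx_mul !mulmxA.
- by apply: (can_inj (mulKmx uP)); rewrite mulmxA -gP -mulmxA Pe gxi.
by split=> //; rewrite -ME -gP -mulmxA mulmxV // mulmx1.
Qed.

Lemma stab_coord g : stab g -> invmx P *m g *m P = horo_mx (rho g).
Proof.
by move=> /rhoP[_ {1}->]; rewrite -!mulmxA mulVmx // mulmx1 mulKmx.
Qed.

Lemma stab1 : stab 1. Proof. by split; rewrite ?trmx1 -?mulmxE ?mul1mx ?mulmx1. Qed.

Lemma stabV g : g \is a GRing.unit -> stab g -> stab g^-1.
Proof.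
move=> ug [gB gxi]; split; last by rewrite -[in LHS]gxi mulmxA mulmxE mulVr // mul1mx.
have ggV : g *m g^-1 = 1%:M by rewrite mulmxE mulrV.
by rewrite -[in LHS]gB !mulmxA -trmx_mul ggV trmx1 mul1mx -mulmxA ggV mulmx1.
Qed.

Lemma rhoM g h : stab g -> stab h -> rho (g * h) = rho g * rho h.
Proof.
move=> sg sh; rewrite {1}/rho.
have -> : invmx P *m (g * h) *m P = horo_mx (rho g) *m horo_mx (rho h).
  by rewrite -!stab_coord // -mulmxE !mulmxA -(mulmxA _ P) mulmxV // mulmx1.
by rewrite /horo_mx mulmx_block block_mxKdr mul0mx add0r.
Qed.

Lemma rho1 : rho 1 = 1.
Proof.
rewrite /rho mulmx1 mulVmx // [X in drsubmx X](@scalar_mx_block _ 1 (1 + n)).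
exact: block_mxKdr.
Qed.

Lemma rho_inj g h : stab g -> stab h -> rho g = rho h -> g = h.
Proof. by move=> /rhoP[_ {2}->] /rhoP[_ {2}->] ->. Qed.

Lemma bform_coord x y : bform A (P *m x) (P *m y) = (x^T *m null_form R n *m y) 0 0.
Proof.
by rewrite /bform; have [_ <- _] := frameP; rewrite trmx_mul !mulmxA.
Qed.

Lemma null_product (a s a' s' : R) (w w' : 'cV[R]_n) :
  ((col_mx a%:M (col_mx s%:M w))^T *m null_form R n *m col_mx a'%:M (col_mx s'%:M w')) 0 0
  = (w^T *m w') 0 0 - a * s' - s * a'.
Proof.
rewrite /null_form !tr_col_mx !tr_scalar_mx mul_row_block mulmx0 add0r.
rewrite mul_mx_row mulmx0 mul_row_col !mulmxN mulmx1 mul_row_block !mulmx0 !addr0 add0r mulmx1.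
rewrite add_row_mx addr0 add0r !mul_row_col mulmx0 addr0 !(mulmxN, mulNmx) mulmx1.
by rewrite -!scalar_mxM !mxE eqxx !mulr1n; ring.
Qed.

(** In the coordinates (a; (s; w)) of a null frame the quadratic form is
|w|^2 - 2 a s; here s is minus the product with xi. *)
Definition coord_eta (x : 'cV[R]_n.+2) : R := usubmx (dsubmx (invmx P *m x)) 0 0.

Definition coord_w (x : 'cV[R]_n.+2) : 'cV[R]_n := dsubmx (dsubmx (invmx P *m x)).

Lemma coord_expand x : exists a, x = P *m col_mx a%:M (col_mx (coord_eta x)%:M (coord_w x)).
Proof.
pose y := invmx P *m x; exists (usubmx y 0 0).
by rewrite /coord_eta /coord_w -!mx11_scalar !vsubmxK mulKVmx.
Qed.

Lemma coord_etaE a s (w : 'cV[R]_n) :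
  coord_eta (P *m col_mx a%:M (col_mx s%:M w)) = s.
Proof. by rewrite /coord_eta mulKmx // col_mxKd col_mxKu mxE eqxx. Qed.

Lemma bform_xi x : bform A x xi = - coord_eta x.
Proof.
have [a xE] := coord_expand x; rewrite [in LHS]xE.
have -> : xi = P *m col_mx 1%:M (col_mx 0%:M 0).
  by have [_ _ <-] := frameP; rewrite raddf0 col_mx0.
by rewrite bform_coord null_product mulmx0 mxE; ring.
Qed.

Definition sqnorm (u : 'cV[R]_n) : R := (u^T *m u) 0 0.

Lemma sqnorm_ge0 u : 0 <= sqnorm u.
Proof. by rewrite /sqnorm mxE sumr_ge0 // => i _; rewrite mxE -expr2 sqr_ge0. Qed.

(** Two vectors with q = -1 and positive coordinates s and t have a negative
product: this is the positivity of the form at t w - s u. *)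
Lemma hyperboloid_coord x : qform A x = -1 -> 0 < coord_eta x -> hyperboloid A e x.
Proof.
move=> qx sx; split=> //.
have se : 0 < coord_eta e.
  rewrite -oppr_lt0 -bform_xi; case: ideal_xi => _; apply; split=> //.
  by rewrite -[bform _ _ _]/(qform A e) qe ltrN10.
move: qx qe sx se; have [a xE] := coord_expand x; have [b eE] := coord_expand e.
rewrite {1}/qform {1}/qform.
move: (coord_eta x) (coord_eta e) (coord_w x) (coord_w e) xE eE => s t w u -> ->.
rewrite !bform_coord !null_product -!/(sqnorm _) => qx qy s0 t0.
have cs : 0 <= sqnorm (t *: w - s *: u) by apply: sqnorm_ge0.
have {cs} : 0 <= t ^+ 2 * sqnorm w - 2 * s * t * (w^T *m u) 0 0 + s ^+ 2 * sqnorm u.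
  apply: le_trans cs _; rewrite le_eqVlt; apply/orP; left; apply/eqP.
  have uw : u^T *m w = w^T *m u by rewrite -[LHS]tr_mx11 trmx_mul trmxK.
  have wuT : (t *: w - s *: u)^T = t *: w^T - s *: u^T by rewrite linearB /= !linearZ.
  rewrite /sqnorm wuT mulmxBl !mulmxBr.
  rewrite -!scalemxAl -!scalemxAr uw !mxE; ring.
move: (sqnorm w) (sqnorm u) ((w^T *m u) 0 0) qx qy => W U V qx qy cs.
have WE : W = 2 * a * s - 1 by lra.
have UE : U = 2 * b * t - 1 by lra.
rewrite {}WE {}UE in cs; rewrite ltNge; apply/negP => V0.
have : 0 <= s * t * (V - a * t - s * b) by rewrite !mulr_ge0 // ltW.
have : 0 < s ^+ 2 by rewrite exprn_gt0.
have : 0 < t ^+ 2 by rewrite exprn_gt0.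
nra.
Qed.

Lemma coord_wE a s (w : 'cV[R]_n) : coord_w (P *m col_mx a%:M (col_mx s%:M w)) = w.
Proof. by rewrite /coord_w mulKmx // !col_mxKd. Qed.

(** The upper half-space picture of the closed horoball: the height above the
bounding horosphere and the foot point on it. *)
Definition horo_pt (z : 'cV[R]_n.+1) : 'cV[R]_n.+2 :=
  let t := 1 + z ord0 ord0 in let u := cyl_base z in
  P *m col_mx ((t + sqnorm u / t) / 2)%:M (col_mx (t^-1)%:M (t^-1 *: u)).

Definition horo_inv (x : 'cV[R]_n.+2) : 'cV[R]_n.+1 :=
  col_mx ((coord_eta x)^-1 - 1)%:M ((coord_eta x)^-1 *: coord_w x).

Lemma sqnormZ c u : sqnorm (c *: u) = c ^+ 2 * sqnorm u.
Proof.
by rewrite /sqnorm [(c *: u)^T]linearZ /= -scalemxAl -scalemxAr !mxE mulrA.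
Qed.

Lemma qform_coord a s w : qform A (P *m col_mx a%:M (col_mx s%:M w)) =
  sqnorm w - 2 * a * s.
Proof. by rewrite /qform bform_coord null_product /sqnorm; ring. Qed.

Lemma horo_pt_horoball z : half_cylinder z -> horoball A e xi (horo_pt z).
Proof.
rewrite /half_cylinder /= => z0; set t := 1 + z ord0 ord0.
have t0 : 0 < t by rewrite ltr_wpDr.
split; last by rewrite bform_xi coord_etaE -/t lerN2 invf_le1 // /t lerDl.
apply: hyperboloid_coord; last by rewrite coord_etaE invr_gt0.
by rewrite qform_coord sqnormZ -/t; field; rewrite lt0r_neq0.
Qed.

Lemma horoball_eta x : horoball A e xi x -> 0 < coord_eta x <= 1.
Proof.
move=> [hx]; rewrite bform_xi lerN2 => ->; rewrite andbT.
by case: ideal_xi => _ /(_ x hx); rewrite bform_xi oppr_lt0.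
Qed.

Lemma horo_inv_half x : horoball A e xi x -> half_cylinder (horo_inv x).
Proof.
move=> /horoball_eta/andP[s0 s1]; rewrite /half_cylinder /= /horo_inv.
by rewrite head_col_mx mxE eqxx mulr1n subr_ge0 invf_ge1.
Qed.

Lemma horo_inv_height x : horo_inv x ord0 ord0 = (coord_eta x)^-1 - 1.
Proof. by rewrite head_col_mx mxE eqxx mulr1n. Qed.

Lemma cyl_base_horo_inv x : cyl_base (horo_inv x) = (coord_eta x)^-1 *: coord_w x.
Proof. exact: col_mxKd. Qed.

Lemma horo_invK x : horoball A e xi x -> horo_pt (horo_inv x) = x.
Proof.
move=> hx; have /andP[s0 _] := horoball_eta hx; case: hx => -[qx _] _.
rewrite /horo_pt horo_inv_height cyl_base_horo_inv [1 + _]addrC subrK invrK scalerA.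
rewrite divff ?lt0r_neq0 // scale1r; have [a xE] := coord_expand x.
rewrite [RHS]xE; congr (P *m col_mx _%:M _); move: qx; rewrite {1}xE qform_coord sqnormZ.
move: (coord_eta x) s0 (sqnorm _) => s s0 W qx.
have -> : W = 2 * a * s - 1 by lra.
by field; rewrite lt0r_neq0.
Qed.

Lemma cyl_eqP (z w : 'cV[R]_n.+1) : z ord0 ord0 = w ord0 ord0 ->
  cyl_base z = cyl_base w -> z = w.
Proof.
move=> h b; rewrite -[z](@vsubmxK _ 1 n 1) -[w](@vsubmxK _ 1 n 1).
congr (@col_mx _ 1 n 1 _ _); last exact: b.
by rewrite [LHS]mx11_scalar [RHS]mx11_scalar !head_usubmx h.
Qed.

Lemma horo_ptK z : half_cylinder z -> horo_inv (horo_pt z) = z.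
Proof.
rewrite /half_cylinder /= => z0.
have t0 : 0 < 1 + z ord0 ord0 by rewrite ltr_wpDr.
apply: cyl_eqP.
  by rewrite horo_inv_height coord_etaE invrK addrC addKr.
rewrite cyl_base_horo_inv coord_etaE coord_wE invrK scalerA divff ?scale1r //.
by rewrite lt0r_neq0.
Qed.

Lemma stab_bform g x y : stab g -> bform A (g *m x) (g *m y) = bform A x y.
Proof. by move=> [gB _]; rewrite /bform -/B -[in RHS]gB trmx_mul !mulmxA. Qed.

Lemma coord_eta_stab g x : stab g -> coord_eta (g *m x) = coord_eta x.
Proof.
move=> sg; apply: oppr_inj; rewrite -!bform_xi -[in LHS]sg.2.
exact: stab_bform.
Qed.

Lemma stab_horoball g x : stab g -> horoball A e xi x -> horoball A e xi (g *m x).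
Proof.
move=> sg hx; have /andP[s0 s1] := horoball_eta hx.
split; last by rewrite bform_xi coord_eta_stab // lerN2.
apply: hyperboloid_coord; last by rewrite coord_eta_stab.
by rewrite /qform stab_bform //; case: hx => -[].
Qed.

Lemma coord_w_stab g x : stab g ->
  coord_w (g *m x) = coord_eta x *: trans_part (rho g) + lin_part (rho g) *m coord_w x.
Proof.
move=> sg; have [a xE] := coord_expand x; rewrite {1}xE.
move: (coord_eta x) (coord_w x) => s w.
rewrite /coord_w (_ : invmx P *m _ = horo_mx (rho g) *m col_mx a%:M (col_mx s%:M w)).
  rewrite /horo_mx mul_block_col mul0mx add0r col_mxKd.
  rewrite [X in (X : 'M[R]_(1 + n)) *m _](isometryE (rhoP sg).1) /euclidean mul_block_col.
  by rewrite col_mxKd mul_mx_scalar.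
by rewrite -stab_coord // !mulmxA.
Qed.

(** A point of the horoball is determined by its last two coordinates, on which g
acts as the affine matrix rho g. *)
Lemma horo_pt_act g z : stab g -> half_cylinder z ->
  g *m horo_pt z = horo_pt (cyl_act (rho g) z).
Proof.
move=> sg hz; have hx := horo_pt_horoball hz.
rewrite -[LHS]horo_invK; last exact: stab_horoball.
congr horo_pt; have [z0 zb] : z ord0 ord0 = (coord_eta (horo_pt z))^-1 - 1 /\
    cyl_base z = (coord_eta (horo_pt z))^-1 *: coord_w (horo_pt z).
  by rewrite -horo_inv_height -cyl_base_horo_inv horo_ptK.
apply: cyl_eqP; first by rewrite horo_inv_height coord_eta_stab // -z0 cyl_act_height.
rewrite cyl_base_horo_inv cyl_base_act coord_eta_stab // coord_w_stab // /isom_act zb.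
have /andP[s0 _] := horoball_eta hx.
by rewrite scalerDr scalerA mulVf ?lt0r_neq0 // scale1r -scalemxAr addrC.
Qed.

End HoroballCoordinates.

Section MatrixLimits.
Variables (R : realType) (T : Type) (F : set_system T).
Context {FF : Filter F}.

Lemma cvg_mx_entries a b (f : T -> 'M[R]_(a, b)) (l : 'M[R]_(a, b)) :
  (forall i j, (fun x => f x i j) @ F --> l i j) -> f @ F --> l.
Proof.
move=> fl; apply/cvgrPdist_lt => e e0.
have : \forall x \near F, forall ij : 'I_a * 'I_b, `|l ij.1 ij.2 - f x ij.1 ij.2| < e.
  by apply: filter_forall => -[i j] /=; have /cvgrPdist_lt := fl i j; apply.
by apply: filterS => x fx; apply/mx_norm_lt => // i j; rewrite !mxE; apply: (fx (i, j)).
Qed.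

Lemma cvg_mx_entry a b (f : T -> 'M[R]_(a, b)) (l : 'M[R]_(a, b)) i j :
  f @ F --> l -> (fun x => f x i j) @ F --> l i j.
Proof.
move=> fl; apply: (@cvg_comp _ _ _ f (fun M : 'M[R]_(a, b) => M i j) _ _ _ fl).
exact: coord_continuous.
Qed.

Lemma cvg_mulmx a b c (f : T -> 'M[R]_(a, b)) (g : T -> 'M[R]_(b, c))
    (k : 'M[R]_(a, b)) (l : 'M[R]_(b, c)) :
  f @ F --> k -> g @ F --> l -> (fun x => f x *m g x) @ F --> k *m l.
Proof.
move=> fk gl; apply: cvg_mx_entries => i j.
rewrite mxE (_ : (fun x => _) = (fun x => \sum_q f x i q * g x q j)); last first.
  by apply/funext => x; rewrite mxE.
apply: cvg_big => [|q _]; first exact: add_continuous.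
by apply: cvgM; apply: cvg_mx_entry.
Qed.

End MatrixLimits.

Section HoroballContinuity.
Variables (R : realType) (n : nat) (P : 'M[R]_(1 + (1 + n))).

Lemma cvg_horo_pt (T : Type) (F : set_system T) (f : T -> 'cV[R]_n.+1) (l : 'cV[R]_n.+1) :
  Filter F -> f @ F --> l -> 1 + l ord0 ord0 != 0 -> (horo_pt P \o f) @ F --> horo_pt P l.
Proof.
move=> FF fl l0; rewrite /horo_pt /comp /=.
have h_cvg : (fun x => 1 + f x ord0 ord0) @ F --> 1 + l ord0 ord0.
  by apply: cvgD; [exact: cvg_cst | exact: cvg_mx_entry].
have hV_cvg : (fun x => (1 + f x ord0 ord0)^-1) @ F --> (1 + l ord0 ord0)^-1.
  exact: cvgV.
have b_cvg i j : (fun x => cyl_base (f x) i j) @ F --> cyl_base l i j.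
  rewrite mxE; under eq_fun do rewrite mxE; exact: cvg_mx_entry.
have s_cvg : (fun x => sqnorm (cyl_base (f x))) @ F --> sqnorm (cyl_base l).
  rewrite /sqnorm mxE; under eq_fun do rewrite mxE.
  apply: cvg_big => [|q _]; first exact: add_continuous.
  under eq_fun do rewrite mxE; rewrite mxE.
  by apply: cvgM; apply: b_cvg.
apply: cvg_mulmx; first exact: cvg_cst.
apply: cvg_mx_entries => i j; rewrite (ord1 j).
case: (split_ordP i) => i' ->; first rewrite (ord1 i').
  rewrite col_mxEu (_ : (fun x => _) = (fun x => (1 + f x ord0 ord0 +
      sqnorm (cyl_base (f x)) / (1 + f x ord0 ord0)) / 2)); last first.
    by apply/funext => x; rewrite col_mxEu mxE eqxx mulr1n.
  rewrite mxE eqxx mulr1n; apply: cvgM; last exact: cvg_cst.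
  by apply: cvgD => //; apply: cvgM.
rewrite col_mxEd; under eq_fun do rewrite col_mxEd.
case: (split_ordP i') => k ->; first rewrite (ord1 k).
  rewrite col_mxEu mxE eqxx mulr1n; under eq_fun do rewrite col_mxEu mxE eqxx mulr1n.
  exact: hV_cvg.
rewrite col_mxEd mxE; under eq_fun do rewrite col_mxEd mxE.
by apply: cvgM.
Qed.

Lemma cvg_horo_inv (T : Type) (F : set_system T) (f : T -> 'cV[R]_n.+2) (l : 'cV[R]_n.+2) :
  Filter F -> f @ F --> l -> coord_eta P l != 0 ->
  (horo_inv P \o f) @ F --> horo_inv P l.
Proof.
move=> FF fl l0; rewrite /horo_inv /comp /=.
have y_cvg : (fun x => invmx P *m f x) @ F --> invmx P *m l.
  by apply: cvg_mulmx => //; apply: cvg_cst.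
have s_cvg : (fun x => coord_eta P (f x)) @ F --> coord_eta P l.
  rewrite /coord_eta mxE [dsubmx _ _ _]mxE.
  under eq_fun do rewrite mxE [dsubmx _ _ _]mxE.
  exact: cvg_mx_entry y_cvg.
have sV_cvg : (fun x => (coord_eta P (f x))^-1) @ F --> (coord_eta P l)^-1.
  exact: cvgV.
have w_cvg i j : (fun x => coord_w P (f x) i j) @ F --> coord_w P l i j.
  rewrite /coord_w mxE [dsubmx _ _ _]mxE.
  under eq_fun do rewrite mxE [dsubmx _ _ _]mxE.
  exact: cvg_mx_entry y_cvg.
apply: cvg_mx_entries => i j; rewrite (ord1 j).
case: (@split_ordP 1 n i) => k ->; first rewrite (ord1 k).
  rewrite (@col_mxEu _ 1 n 1) mxE eqxx mulr1n.
  under eq_fun do rewrite (@col_mxEu _ 1 n 1) mxE eqxx mulr1n.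
  by apply: cvgB => //; apply: cvg_cst.
rewrite (@col_mxEd _ 1 n 1) mxE; under eq_fun do rewrite (@col_mxEd _ 1 n 1) mxE.
exact: cvgM.
Qed.

End HoroballContinuity.

(** * The cusp group *)

Section CuspGroup.
Variables (R : realType) (n : nat) (A : 'M[rat]_n.+2) (e xi : 'cV[R]_n.+2).
Variable P : 'M[R]_(1 + (1 + n)).
Hypothesis frameP : is_null_frame (realmx R A) xi P.
Hypothesis qe : qform A e = -1.
Variable Gamma : set 'M[R]_n.+2.
Hypotheses (sG : subgroup Gamma) (OG : Gamma `<=` Oplus A e).
Hypotheses (dG : discrete_group Gamma) (tfG : torsion_free Gamma).

Definition cusp_group : set 'M[R]_n.+1 :=
  [set rho P g | g in [set g | Gamma g /\ g *m xi = xi]].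

Lemma cusp_stab g : Gamma g -> g *m xi = xi -> stab A xi g.
Proof. by move=> /OG[gA _]. Qed.

Lemma Gamma_unit g : Gamma g -> g \is a GRing.unit.
Proof. by case: sG => uG _ _ _ /uG. Qed.

Lemma cusp_group_isometry g : cusp_group g -> isometry g.
Proof. by move=> [h [Gh hxi] <-]; case: (rhoP frameP (cusp_stab Gh hxi)). Qed.

Lemma cusp_group_subgroup : subgroup cusp_group.
Proof.
have [uG G1 GM GV] := sG; split.
- by move=> g /cusp_group_isometry/isometry_unit.
- by exists 1; [split; rewrite // -[1]/(1%:M) mul1mx | rewrite (rho1 frameP)].
- move=> _ _ [g [Gg gxi] <-] [h [Gh hxi] <-].
  have [sg sh] := (cusp_stab Gg gxi, cusp_stab Gh hxi).
  exists (g * h); last exact: (rhoM frameP).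
  by split; [exact: GM | rewrite -mulmxE -mulmxA hxi].
move=> _ [g [Gg gxi] <-]; have sg := cusp_stab Gg gxi.
have sV := stabV (Gamma_unit Gg) sg.
exists g^-1; first by split; [exact: GV | case: sV].
have ug : rho P g \is a GRing.unit by apply/isometry_unit/cusp_group_isometry; exists g.
apply: (mulrI ug); rewrite mulrV // -(rhoM frameP) // mulrV ?(rho1 frameP) //.
exact: Gamma_unit.
Qed.

Lemma horo_mx_near1 (g : 'M[R]_n.+1) : isometry g -> `|g - 1| <= 1 ->
  `|horo_mx g - 1%:M| <= (1 + n%:R) * `|g - 1|.
Proof.
move=> ig g1; set d := `|g - 1| in g1 *.
have d0 : 0 <= d by apply: normr_ge0.
have vd : `|trans_part g| <= d.
  apply/mx_norm_le => // i j.
  apply: le_trans (mx_norm_entry (g - 1) (@rshift 1 n i) (@lshift 1 n j)).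
  by rewrite !mxE (@eq_rlshift 1 n) subr0.
have Lg : `|lin_part g| <= 1 by apply/orthogonal_norm/lin_orthogonal.
have vTd : `|(trans_part g)^T| <= d.
  by apply/mx_norm_le => // i j; rewrite mxE; move: (j) (i); apply/mx_norm_le.
have nd : n%:R * d <= (1 + n%:R) * d by rewrite ler_wpM2r // lerDr.
rewrite [1%:M](@scalar_mx_block _ 1 (1 + n)) opp_block_mx add_block_mx.
apply/mx_norm_le => [|i j]; first by rewrite mulr_ge0 // addr_ge0.
case: (split_ordP i) => i' ->; case: (split_ordP j) => j' ->.
- by rewrite block_mxEul subrr mxE normr0 mulr_ge0 // addr_ge0.
- rewrite block_mxEur oppr0 addr0; apply: le_trans nd.
  case: (split_ordP j') => k ->; rewrite (row_mxEl, row_mxEr);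
    apply: le_trans (mx_norm_entry _ _ _) _.
    rewrite normrZ; apply: (@le_trans _ _ (1 * (n%:R * d * 1))); last by rewrite mul1r mulr1.
    apply: ler_pM => //; first by rewrite ger0_norm ?invr_ge0 // invf_le1 // ler1n.
    apply: le_trans (mx_normM _ _) _; apply: ler_pM; rewrite ?mulr_ge0 //.
      by rewrite ler_wpM2l.
    exact: le_trans g1.
  apply: le_trans (mx_normM _ _) _; rewrite -[leRHS]mulr1.
  apply: ler_pM; rewrite ?mulr_ge0 //.
  by rewrite ler_wpM2l.
- by rewrite block_mxEdl oppr0 addr0 mxE normr0 mulr_ge0 // addr_ge0.
rewrite block_mxEdr; apply: le_trans (mx_norm_entry _ _ _) _.
by rewrite -[leLHS]mul1r ler_wpM2r // lerDl.
Qed.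

(** The inverse of rho is horo_mx up to conjugation, which is continuous at 1. *)
Lemma cusp_group_discrete : discrete_group cusp_group.
Proof.
have [eps eps0 epsP] := dG; have uP : P \in unitmx by case: frameP.
pose K' : R := n.+2%:R * (n.+2%:R * `|P| * (1 + n%:R)) * `|invmx P|.
have K'0 : 0 <= K' by rewrite !mulr_ge0 // addr_ge0.
pose K := K' + 1; have K0 : 0 < K by rewrite ltr_wpDl.
exists (Num.min 1 (eps / K)); first by rewrite lt_min ltr01 divr_gt0.
move=> g Dg; rewrite -ball_normE /= distrC lt_min => /andP[g1 gK].
have ig := cusp_group_isometry Dg; case: Dg => h [Gh hxi] hg.
have [_ hE] := rhoP frameP (cusp_stab Gh hxi); rewrite hg in hE.
suff h1 : h = 1 by rewrite -hg h1 (rho1 frameP).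
apply: epsP => //; rewrite -ball_normE /= distrC.
have -> : h - 1 = P *m (horo_mx g - 1%:M) *m invmx P.
  by rewrite hE mulmxBr mulmxBl mulmx1 mulmxV.
apply: le_lt_trans (mx_normM _ _) _.
apply: (@le_lt_trans _ _ (K * `|g - 1|)); last by rewrite mulrC -ltr_pdivlMr.
apply: (@le_trans _ _ (K' * `|g - 1|)); last by rewrite ler_wpM2r // lerDl.
rewrite /K' [leRHS]mulrAC; apply: ler_wpM2r => //.
rewrite -!mulrA; apply: ler_wpM2l => //.
apply: le_trans (mx_normM _ _) _; rewrite -mulrA; apply: ler_wpM2l => //.
apply: ler_wpM2l => //; apply: horo_mx_near1 => //; exact: ltW.
Qed.

Lemma rhoX g k : Gamma g -> g *m xi = xi ->
  rho P (g ^+ k) = rho P g ^+ k /\ g ^+ k *m xi = xi.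
Proof.
move=> Gg gxi; elim: k => [|k [IH1 IH2]].
  by rewrite !expr0 (rho1 frameP) -[1]/(1%:M) mul1mx.
rewrite !exprS -IH1 (rhoM frameP); first last.
- by apply: cusp_stab => //; apply: subgroupX.
- exact: cusp_stab.
by split=> //; rewrite -mulmxE -mulmxA IH2.
Qed.

Lemma cusp_group_torsion_free : torsion_free cusp_group.
Proof.
move=> _ d [g [Gg gxi] <-] d0 gd; have [gE gdxi] := rhoX d Gg gxi.
have := tfG Gg d0; rewrite gd in gE => ->; first exact: (rho1 frameP).
apply: (rho_inj frameP (xi := xi) (A := A)).
- by apply: cusp_stab => //; apply: subgroupX.
- exact: stab1.
- by rewrite gE (rho1 frameP).
Qed.

Lemma cusp_group_free g x : cusp_group g -> isom_act g x = x -> g = 1.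
Proof.
apply: torsion_free_fixpoint_free.
- exact: cusp_group_subgroup.
- exact: cusp_group_isometry.
- exact: cusp_group_discrete.
- exact: cusp_group_torsion_free.
Qed.

Hypothesis cusp_xi : cusp_horoball A e Gamma xi.
Variable pi : set 'M[R]_n.+1.
Hypothesis flat_pi : compact_flat_manifold pi.
Hypothesis diffeo : quotient_diffeomorphic (@half_cylinder R n) (half_cylinder_orbit pi)
                           (horoball A e xi) (linear_orbit Gamma).

Let ideal_xi : ideal_vector A e xi. Proof. by case: cusp_xi. Qed.

Lemma orbit_image_eq (G : set 'M[R]_n.+2) g x : subgroup G -> G g ->
  linear_orbit G (g *m x) = linear_orbit G x.
Proof.
move=> [uG G1 GM GV] Gg; apply/seteqP; split=> _ [h Gh <-].
  by exists (h * g); [exact: GM | rewrite -mulmxE -mulmxA].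
exists (h * g^-1); first by apply: GM => //; apply: GV.
by rewrite -mulmxE -mulmxA (mulmxA g^-1) mulmxE mulVr ?mul1mx //; apply: uG.
Qed.

Lemma half_orbit_image_eq g z : pi g ->
  half_cylinder_orbit pi (cyl_act g z) = half_cylinder_orbit pi z.
Proof.
move=> pg; have [[up p1 pM pV] isop _ _ _] := flat_pi.
rewrite -[LHS]/[set cyl_act h (cyl_act g z) | h in pi].
apply/seteqP; split=> _ [h ph <-].
  by exists (h * g); [exact: pM | rewrite -/(cyl_act _ _) cyl_actM //; apply: isop].
exists (h * g^-1); first by apply: pM => //; apply: pV.
rewrite -cyl_actM; [|by apply/isop/pM => //; apply: pV|exact: isop].
by rewrite mulrVK //; apply: up.
Qed.

(** The half cylinder covers both sides of the diffeomorphism: its orbit space by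
pi, and, through horo_pt, the image of the horoball in the quotient by Gamma.
Two points of the horoball in the same orbit of Gamma are in the same orbit of
the stabilizer of xi. *)
Lemma cross_section_injection : exists phi : 'M[R]_n.+1 -> 'M[R]_n.+1,
  [/\ forall g, pi g -> cusp_group (phi g),
      forall g h, pi g -> pi h -> phi (g * h) = phi g * phi h &
      forall g h, pi g -> pi h -> phi g = phi h -> g = h].
Proof.
have [phi [psi [phi_s psi_s psiK phiK]]] := diffeo.
have [sp isop dp freep _] := flat_pi; have [up p1 pM pV] := sp.
have [uG G1 GM GV] := sG; have [_ _ cusp3] := cusp_xi.
pose oX := half_cylinder_orbit pi; pose oY := linear_orbit Gamma.
pose M z w := [/\ half_cylinder z, half_cylinder w & phi (oX z) = oY (horo_pt P w)].
have within_cvg (Z : set 'cV[R]_n.+1) z (T : topologicalType) (f : 'cV[R]_n.+1 -> T) :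
    f @ z --> f z -> f @ within Z (nbhs z) --> f z.
  by move=> fz; apply: cvg_trans fz; apply: cvg_app; apply: cvg_within.
have open_near (O : set 'cV[R]_n.+1) z : open O -> O z -> exists2 d : R, 0 < d &
    forall z', `|z' - z| < d -> O z'.
  move=> oO Oz; have /nbhs_ballP[d /= d0 dO] : nbhs z O.
    by apply: open_nbhs_nbhs.
  by exists d => // z' z'd; apply: dO; rewrite -ball_normE /= distrC.
apply: (@orbit_space_homeo_injection R n pi cusp_group M) => //.
- exact: cusp_group_subgroup.
- exact: cusp_group_isometry.
- exact: cusp_group_discrete.
- exact: cusp_group_free.
- by move=> z w [].
- move=> z w g [hz hw zw] pg; split=> //; first exact: cyl_act_half.
  by rewrite -zw /oX half_orbit_image_eq.
- move=> z z' w [hz hw zw] [hz' _ z'w].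
  have : oX z' = oX z by have := congr1 psi (etrans z'w (esym zw)); rewrite /oX !psiK.
  move=> /seteqP[/(_ z')[]].
    by exists 1; rewrite // -/(cyl_act _ _) cyl_act1.
  by move=> g pg gz _; exists g.
- move=> z w _ [hz hw zw] [g [Gg gxi] <-]; split=> //; first exact: cyl_act_half.
  by rewrite -(horo_pt_act frameP qe ideal_xi (cusp_stab Gg gxi) hw) /oY orbit_image_eq.
- move=> z w w' [hz hw zw] [_ hw' zw'].
  have : oY (horo_pt P w') = oY (horo_pt P w) by rewrite -zw -zw'.
  move=> /seteqP[/(_ (horo_pt P w'))[]]; first by exists 1; rewrite // -[1]/(1%:M) mul1mx.
  move=> g Gg gw _; have hb := horo_pt_horoball frameP qe ideal_xi hw.
  have gxi : g *m xi = xi.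
    by apply: (cusp3 g _ Gg hb); rewrite gw; apply: (horo_pt_horoball frameP qe ideal_xi).
  exists (rho P g); first by exists g.
  rewrite -[LHS](horo_ptK frameP) // -gw.
  rewrite (horo_pt_act frameP qe ideal_xi (cusp_stab Gg gxi) hw) (horo_ptK frameP) //.
  exact: cyl_act_half.
- move=> z hz; have [U [f [oO Oz fC fP]]] := phi_s z hz.
  have [d d0 dO] := open_near _ _ oO Oz.
  exists d, (horo_inv P \o f); split=> // z' hz' z'd; have Oz' := dO _ z'd.
  have [hf fE] := fP z' hz' Oz'; split.
    split=> //; first exact: (horo_inv_half frameP ideal_xi).
    by rewrite /= (horo_invK frameP ideal_xi).
  apply/continuous_inP; apply: cvg_horo_inv.
    by apply: within_cvg; apply: (fC 0%N).1.
  by have /andP[/lt0r_neq0] := horoball_eta frameP ideal_xi hf.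
move=> w hw; have hb := horo_pt_horoball frameP qe ideal_xi hw.
have [U [f [oO Ow fC fP]]] := psi_s _ hb.
have h_cvg w' : half_cylinder w' -> horo_pt P @ w' --> horo_pt P w'.
  move=> hw'; apply: (@cvg_horo_pt R n P _ (nbhs w') id); first exact: cvg_id.
  by apply/lt0r_neq0; rewrite ltr_wpDr.
have /nbhs_ballP[d /= d0 dO] : nbhs w [set w' | U (horo_pt P w')].
  by apply: (h_cvg w hw); apply: open_nbhs_nbhs.
exists d, (f \o horo_pt P); split=> // w' hw' w'd.
have Ow' : U (horo_pt P w') by apply: dO; rewrite -ball_normE /= distrC.
have hb' := horo_pt_horoball frameP qe ideal_xi hw'.
have [hf fE] := fP _ hb' Ow'; split.
  by split=> //; rewrite /oX /oY /= -fE phiK.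
apply/continuous_inP; apply: within_cvg.
by apply: (cvg_comp _ _ (h_cvg w' hw')); apply: (fC 0%N).1.
Qed.

End CuspGroup.

(** * Holonomy of a flat manifold on its translations *)

Section Spanning.
Variables (R : realType) (n : nat).

(** An independent family in S which does not span is enlarged by any element of S
not orthogonal to a chosen normal vector of its span. *)
Lemma independent_or_orthogonal (S : set 'cV[R]_n) :
  (exists V : 'M[R]_n, row_free V /\ forall i, S (row i V)^T) \/
  (exists2 u : 'cV[R]_n, u != 0 & forall s, S s -> s^T *m u = 0).
Proof.
suff: forall r, (r <= n)%N -> (exists V : 'M[R]_(r, n), row_free V /\ forall i, S (row i V)^T) \/
    (exists2 u : 'cV[R]_n, u != 0 & forall s, S s -> s^T *m u = 0) by apply.
elim=> [_|r IHr rn].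
  by left; exists 0; split=> [|[]//]; rewrite /row_free mxrank0.
have [[V [freeV SV]]|] := IHr (ltnW rn); last by right.
have /rowV0Pn[w /sub_kermxP wV w0] : kermx V^T != 0.
  by rewrite -mxrank_eq0 mxrank_ker mxrank_tr (eqP freeV) -lt0n subn_gt0.
have Vw : V *m w^T = 0 by rewrite -[LHS]trmxK trmx_mul trmxK wV trmx0.
have [all0|[s [Ss sw]]] : (forall s, S s -> s^T *m w^T = 0) \/
    exists s, S s /\ s^T *m w^T <> 0.
- have [?|nall] := pselect (forall s, S s -> s^T *m w^T = 0); [by left|right].
  apply: contrapT => nex; apply: nall => s Ss; apply: contrapT => sw; apply: nex.
  by exists s.
- by right; exists w^T => //; apply: contra_neq w0 => /(congr1 trmx); rewrite trmxK trmx0.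
left; exists (col_mx s^T V : 'M[R]_(1 + r, n)); split.
  rewrite /row_free -(@addsmxE _ 1 r n) mxrank_disjoint_sum.
    have sT0 : s^T != 0 by apply/eqP => s0; case: sw; rewrite s0 mul0mx.
    by rewrite (eqP freeV) rank_rV sT0.
  apply/eqP/rowV0P => v; rewrite sub_capmx => /andP[/sub_rVP[c vE] /submxP[D vD]].
  have : v *m w^T = 0 by rewrite vD -mulmxA Vw mulmx0.
  rewrite vE -scalemxAl => /eqP; rewrite scaler_eq0 => /orP[/eqP->|/eqP//].
  by rewrite scale0r.
move=> i; case: (@split_ordP 1 r i) => k ->.
  by rewrite (@rowKu _ 1 r n) row_id ?trmxK // (ord1 k).
by rewrite (@rowKd _ 1 r n).
Qed.

Variables (pi : set 'M[R]_n.+1) (V : finZmodType).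
Hypotheses (flat_pi : compact_flat_manifold pi) (hol : holonomy_isom pi V).

Lemma flat_subgroup : subgroup pi. Proof. by case: flat_pi. Qed.
Lemma flat_isometry g : pi g -> isometry g. Proof. by case: flat_pi => _ + _ _ _; apply. Qed.

Lemma translationE g : translations pi g <-> pi g /\ g = euclidean 1%:M (trans_part g).
Proof.
split=> -[pg gE]; split=> //.
  by rewrite [LHS](isometryE (flat_isometry pg)) gE.
by rewrite gE lin_euclidean.
Qed.

Lemma holonomy_translation (f : 'M[R]_n.+1 -> V) :
    (forall g h, pi g -> pi h -> f (g * h) = f g + f h) ->
    (forall g, pi g -> (f g = 0 <-> translations pi g)) ->
  forall g h, pi g -> pi h -> f g = f h -> translations pi (g * h^-1).
Proof.
move=> fM fker g h pg ph fgh; have [up p1 pM pV] := flat_subgroup.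
apply/fker; first by apply: pM => //; apply: pV.
rewrite fM //; last exact: pV.
have f1 : f 1 = 0 by apply: (addrI (f 1)); rewrite -fM // mulr1 addr0.
have -> : f h^-1 = - f h by apply: (addrI (f h)); rewrite -fM ?mulrV ?up ?subrr //; apply: pV.
by rewrite fgh subrr.
Qed.

(** Translations have finite index in pi, so every point is the sum of a
translation vector and of a bounded vector.  A vector u orthogonal to all the
translations would therefore have a bounded product with all of R^n. *)
Lemma translations_span : exists W : 'M[R]_n, row_free W /\
  forall i, pi (euclidean 1%:M (row i W)^T).
Proof.
have [sp isop _ _ [K cK KP]] := flat_pi; have [up p1 pM pV] := sp.
have [[W [fW WP]]|[u u0 uP]] := independent_or_orthogonal [set v | pi (euclidean 1%:M v)].
  by exists W.
exfalso; have [f [fM f_surj fker]] := hol.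
have f_inv v : exists g, pi g /\ f g = v by have [g pg gv] := f_surj v; exists g.
have [h hP] := choice f_inv.
have [k0 [_ /(_ (k0 + 1))]] := compact_bounded cK.
rewrite ltrDl ltr01 => /(_ isT); set k := k0 + 1 => kK.
pose B : R := n%:R * 1 * `|k| + \sum_v `|trans_part (h v)|.
have near (x : 'cV[R]_n) : exists2 y : 'cV[R]_n, `|y| <= B & u^T *m x = u^T *m y.
  have [g pg Kgx] := KP x; exists (isom_act (h (f g^-1)) (isom_act g x)).
    apply: le_trans (ler_normD _ _) _; apply: lerD.
      apply: le_trans (mx_normM _ _) _; apply: ler_pM; rewrite ?mulr_ge0 //.
        by rewrite ler_wpM2l //; apply/orthogonal_norm/lin_orthogonal/isop; case: (hP (f g^-1)).
      by apply: le_trans (ler_norm k); apply: kK.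
    by rewrite (bigD1 (f g^-1)) //= lerDl sumr_ge0.
  set a := h _; have [pa fa] : pi a /\ f a = f g^-1 by apply: hP.
  have pgV := pV _ pg; have ig := isop _ pg; have ia := isop _ pa; have iV := isop _ pgV.
  have /translationE[pt tE] := holonomy_translation fM fker pgV pa (esym fa).
  have it := isop _ pt.
  have {1}-> : x = isom_act (g^-1 * a^-1) (isom_act a (isom_act g x)).
    rewrite -!isom_actM //; last first.
      by apply/isop/pM => //.
    rewrite ?mulrA mulrVK ?mulVr ?isom_act1 //; exact: isometry_unit.
  move: tE pt; set t := g^-1 * a^-1 => -> pt.
  rewrite {1}/isom_act lin_euclidean trans_euclidean mul1mx mulmxDr.
  by rewrite -[u^T *m trans_part t]trmxK trmx_mul trmxK uP ?trmx0 ?addr0.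
have uu : 0 < (u^T *m u) 0 0.
  rewrite lt_def; apply/andP; split.
    apply: contra_neq u0 => uu; apply: dot_eq0; rewrite [LHS]mx11_scalar uu.
    by apply/matrixP=> i j; rewrite !mxE mul0rn.
  by rewrite mxE sumr_ge0 // => i _; rewrite mxE -expr2 sqr_ge0.
pose c := (n%:R * `|u^T| * B + 1) / (u^T *m u) 0 0.
have [y yB] := near (c *: u); rewrite -scalemxAr => /matrixP/(_ 0 0).
rewrite mxE /c divfK ?lt0r_neq0 // => yE.
have := le_trans (mx_norm_entry (u^T *m y) 0 0) (mx_normM _ _).
rewrite -yE leNgt => /negP; apply.
apply: le_lt_trans (_ : n%:R * `|u^T| * B < _).
  by rewrite ler_wpM2l // mulr_ge0.
by apply: lt_le_trans (ler_norm _); rewrite ltrDl.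
Qed.

End Spanning.

Section TransportedHolonomy.
Variables (R : realType) (n : nat) (pi D : set 'M[R]_n.+1) (V : finZmodType).
Hypotheses (flat_pi : compact_flat_manifold pi) (hol : holonomy_isom pi V).
Hypotheses (sD : subgroup D) (isoD : forall g, D g -> isometry g) (dD : discrete_group D).
Variable phi : 'M[R]_n.+1 -> 'M[R]_n.+1.
Hypothesis phiD : forall g, pi g -> D (phi g).
Hypothesis phiM : forall g h, pi g -> pi h -> phi (g * h) = phi g * phi h.
Hypothesis phi_inj : forall g h, pi g -> pi h -> phi g = phi h -> g = h.

Definition hol_lin (g : 'M[R]_n.+1) : 'M[R]_n := lin_part (phi g).

Lemma phi1 : phi 1 = 1.
Proof.
have [_ p1 _ _] := flat_subgroup flat_pi.
by apply: (mulrI (isometry_unit (isoD (phiD p1)))); rewrite -phiM // !mulr1.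
Qed.

Lemma phiV g : pi g -> phi g^-1 = (phi g)^-1.
Proof.
move=> pg; have [up p1 pM pV] := flat_subgroup flat_pi.
have ug := isometry_unit (isoD (phiD pg)); apply: (mulrI ug).
by rewrite mulrV // -phiM ?mulrV ?phi1 //; [apply: up | apply: pV].
Qed.

Lemma hol_linM g h : pi g -> pi h -> hol_lin (g * h) = hol_lin g *m hol_lin h.
Proof. by move=> pg ph; rewrite /hol_lin phiM // lin_partM //; apply/isoD/phiD. Qed.

Lemma pi_translationB v w : pi (euclidean 1%:M v) -> pi (euclidean 1%:M w) ->
  pi (euclidean 1%:M (v - w)).
Proof.
move=> pv pw; have [up p1 pM pV] := flat_subgroup flat_pi.
have := pM _ _ pv (pV _ pw); rewrite isometryV; last exact: (flat_isometry flat_pi).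
by rewrite lin_euclidean trans_euclidean trmx1 mul1mx euclideanM mulmx1 mul1mx addrC.
Qed.

Lemma pi_translation_sum m (w : 'I_m -> 'cV[R]_n) (a : 'I_m -> int) :
  (forall i, pi (euclidean 1%:M (w i))) -> pi (euclidean 1%:M (\sum_i w i *~ a i)).
Proof.
move=> pw; have [up p1 pM pV] := flat_subgroup flat_pi.
have p0 : pi (euclidean 1%:M 0) by rewrite euclidean1.
have pD v v' : pi (euclidean 1%:M v) -> pi (euclidean 1%:M v') -> pi (euclidean 1%:M (v + v')).
  by move=> pv pv'; have := pi_translationB pv (pi_translationB p0 pv'); rewrite sub0r opprK.
elim/big_ind: _ => // i _; case: (a i) => k.
  rewrite -pmulrn; elim: k => [|k IHk]; first by rewrite mulr0n.
  by rewrite mulrS; apply: pD.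
rewrite NegzE mulrNz -pmulrn -sub0r; apply: pi_translationB => //.
by elim: (k.+1) => [|j IHj]; rewrite ?mulr0n // mulrS; apply: pD.
Qed.

(** The translations of pi contain a copy of Z^n, whose image under phi is a
discrete group of isometries as in theta_translations_free; the other
translations of pi commute with it. *)
Lemma transported_translations : (forall g, translations pi g -> hol_lin g = 1%:M) /\
  exists W : 'M[R]_n, row_free W /\
    forall i, exists2 t, pi t & phi t = euclidean 1%:M (row i W)^T.
Proof.
have [up p1 pM pV] := flat_subgroup flat_pi.
have [T [freeT piT]] := translations_span flat_pi hol.
pose tau (a : 'rV[int]_n) : 'cV[R]_n := \sum_i (row i T)^T *~ a 0 i.
pose theta a := phi (euclidean 1%:M (tau a)).
have piTau a : pi (euclidean 1%:M (tau a)) by apply: pi_translation_sum.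
have tauD a b : tau (a + b) = tau a + tau b.
  by rewrite /tau -big_split; apply: eq_bigr => i _; rewrite mxE mulrzDr.
have tau_inj : injective tau.
  move=> a b ab; have map_inj : map_mx intr a = map_mx intr b :> 'rV[R]_n.
    apply: (row_free_inj freeT); apply: trmx_inj; rewrite -[LHS]/((_ *m _)^T).
    have tauE c : (map_mx intr c *m T)^T = tau c.
      rewrite mulmx_sum_row linear_sum; apply: eq_bigr => i _.
      by rewrite mxE linearZ /= scaler_int.
    by rewrite !tauE.
  apply/matrixP=> i j; move/matrixP/(_ i j): map_inj; rewrite !mxE.
  exact: intr_inj.
have theta_trans a b : theta (a + b) = theta a * theta b.
  rewrite /theta tauD -phiM //; congr phi.
  by rewrite euclideanM mulmx1 mul1mx addrC.
have theta_inj : injective theta.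
  move=> a b /phi_inj => /(_ (piTau a) (piTau b)) /(congr1 (@trans_part R n)).
  by rewrite !trans_euclidean => /tau_inj.
have thetaD a : D (theta a) by apply: phiD.
have transl g : translations pi g -> hol_lin g = 1%:M.
  move=> /(translationE flat_pi)[pg gE].
  apply: (commuting_isometry_translation sD isoD dD thetaD theta_inj theta_trans).
    exact/isoD/phiD.
  move=> a; rewrite /theta -!phiM //; congr phi.
  by rewrite gE !euclideanM !mulmx1 !mul1mx addrC.
split=> //.
exists (\matrix_(i, j) trans_part (theta (delta_mx 0 i)) j 0); split.
  exact: (theta_translations_free sD isoD dD thetaD theta_inj theta_trans).
move=> i; exists (euclidean 1%:M (tau (delta_mx 0 i))) => //.
rewrite -/(theta _) [LHS]isometryE; last exact: isoD.
have -> : lin_part (theta (delta_mx 0 i)) = 1%:M.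
  by apply: transl; split; rewrite ?lin_euclidean.
congr euclidean; apply/matrixP=> j k; rewrite (ord1 k) [RHS]mxE [RHS]mxE [RHS]mxE.
by [].
Qed.

Lemma hol_lin_conj g t w : pi g -> pi t -> phi t = euclidean 1%:M w ->
  phi (g * t * g^-1) = euclidean 1%:M (hol_lin g *m w).
Proof.
move=> pg pt tw; have [up p1 pM pV] := flat_subgroup flat_pi.
have ig := isoD (phiD pg).
rewrite !phiM ?phiV ?tw //; try by [apply: pM | apply: pV].
rewrite [X in X * _ * _]isometryE // isometryV // !euclideanM mulmx1 lin_orthogonalV //.
by rewrite mulmxN mulmxA lin_orthogonalV // mul1mx addrCA addNr addr0.
Qed.

(** hol_lin factors through the holonomy group, which is commutative. *)
Lemma hol_lin_comm g h : pi g -> pi h -> hol_lin g *m hol_lin h = hol_lin h *m hol_lin g.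
Proof.
move=> pg ph; have [up p1 pM pV] := flat_subgroup flat_pi; have [f [fM _ fker]] := hol.
have pgh := pM _ _ pg ph; have phg := pM _ _ ph pg.
have tr := holonomy_translation flat_pi fM fker pgh phg.
have pt : pi (g * h * (h * g)^-1) by apply: pM => //; apply: pV.
rewrite -!hol_linM // -[in LHS](mulrVK (up _ phg) (g * h)) [LHS]hol_linM //.
by rewrite (transported_translations.1 _ (tr _)) ?mul1mx // !fM // addrC.
Qed.

Lemma hol_linX g k : pi g -> hol_lin (g ^+ k) = hol_lin g ^+ k.
Proof.
move=> pg; have sp := flat_subgroup flat_pi; have [up p1 pM pV] := sp.
elim: k => [|k IHk]; first by rewrite !expr0 /hol_lin phi1 lin_part1.
by rewrite !exprS hol_linM ?IHk //; apply: subgroupX.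
Qed.

Lemma hol_lin_exponent g d : pi g -> (forall v : V, v *+ d = 0) -> hol_lin g ^+ d = 1%:M.
Proof.
move=> pg Vd; have sp := flat_subgroup flat_pi; have [up p1 pM pV] := sp.
have [f [fM _ fker]] := hol.
rewrite -hol_linX //; apply: transported_translations.1; apply/fker; first exact: subgroupX.
rewrite -(Vd (f g)); elim: d {Vd} => [|d IHd].
  by rewrite expr0 mulr0n; apply: (addrI (f 1)); rewrite -fM // mulr1 addr0.
by rewrite exprS mulrS fM ?IHd //; apply: subgroupX.
Qed.

(** A common fixed vector u would give the homomorphism g |-> <u, translation of
phi g> to the reals, nonzero on translations, hence a class of infinite order in
the abelianization. *)
Lemma hol_lin_fixed (u : 'cV[R]_n) : first_betti pi 0 ->
  (forall g, pi g -> hol_lin g *m u = u) -> u = 0.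
Proof.
move=> [_ b1] fixu; have sp := flat_subgroup flat_pi; have [up p1 pM pV] := sp.
pose chi g : R := (u^T *m trans_part (phi g)) 0 0.
have chiM g h : pi g -> pi h -> chi (g * h) = chi g + chi h.
  move=> pg ph; rewrite /chi phiM // trans_partM; [|exact/isoD/phiD..].
  have uL : u^T *m lin_part (phi g) = u^T.
    rewrite -[lin_part _]trmxK -trmx_mul orthogonal_fixT ?fixu //.
    exact/lin_orthogonal/isoD/phiD.
  by rewrite mulmxDr mulmxA uL mxE addrC.
have chi1 : chi 1 = 0 by apply: (addrI (chi 1)); rewrite -chiM // mulr1 addr0.
have chiV g : pi g -> chi g^-1 = - chi g.
  by move=> pg; apply: (addrI (chi g)); rewrite -chiM ?mulrV ?subrr //; [apply: up | apply: pV].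
have chi_der g : derived_subgroup pi g -> chi g = 0.
  move=> /(_ [set g | pi g /\ chi g = 0])[] //; split; first split.
  - by move=> h [/up].
  - by [].
  - move=> h k [ph h0] [pk k0]; split; [exact: pM | by rewrite chiM // h0 k0 addr0].
  - by move=> h [ph h0]; split; [exact: pV | rewrite chiV // h0 oppr0].
  move=> _ [h [k [ph pk ->]]]; have [pVh pVk] := (pV _ ph, pV _ pk).
  have phk := pM _ _ pVh pVk; have phkh := pM _ _ phk ph.
  split; first exact: pM.
  by rewrite !chiM // !chiV //; ring.
have piX g k : pi g -> pi (g ^+ k) by apply: subgroupX.
have chiX g k : pi g -> chi (g ^+ k) = chi g *+ k.
  move=> pg; elim: k => [|k IHk]; first by rewrite expr0 mulr0n.
  by rewrite exprS mulrS chiM ?IHk //; apply: piX.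
have chi0 g : pi g -> chi g = 0.
  move=> pg; apply: contrapT => /eqP chig; apply: b1; exists (fun=> g); split=> // c.
  rewrite big_ord_recl big_ord0 mulr1 => /chi_der cg i; rewrite (ord1 i).
  have {cg} : chi g *~ c ord0 = 0.
    rewrite -cg; case: (c ord0) => k; first by rewrite -exprnP chiX.
    by rewrite -[g ^ _]/((g ^+ k.+1)^-1) NegzE mulrNz chiV ?chiX //; apply: piX.
  by move=> /eqP; rewrite mulrz_eq0 (negPf chig) orbF => /eqP.
have [_ [W [freeW WP]]] := transported_translations.
have uW : W^T \in unitmx by rewrite unitmx_tr -row_free_unit.
apply: trmx_inj; rewrite trmx0 -[LHS](mulmxK uW).
suff -> : u^T *m W^T = 0 by rewrite mul0mx.
apply/matrixP=> i j; rewrite (ord1 i) [RHS]mxE.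
have [t pt tE] := WP j; have := chi0 t pt; rewrite /chi tE trans_euclidean => <-.
by rewrite !mxE; apply: eq_bigr => k _; rewrite !mxE.
Qed.

End TransportedHolonomy.

(** * The rational structure at the cusp *)

Section RationalMatrices.
Variable R : realType.

Definition rational_mx a b (M : 'M[R]_(a, b)) : Prop :=
  exists M0 : 'M[rat]_(a, b), M = map_mx ratr M0.

Lemma rational_entries a b (M : 'M[R]_(a, b)) :
  (forall i j, exists q, M i j = ratr q) -> rational_mx M.
Proof.
move=> Mq; have [f fE] := choice (fun ij : 'I_a * 'I_b => Mq ij.1 ij.2).
by exists (\matrix_(i, j) f (i, j)); apply/matrixP=> i j; rewrite !mxE -fE.
Qed.

Lemma rational_entry a b (M : 'M[R]_(a, b)) i j :
  rational_mx M -> exists q, M i j = ratr q.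
Proof. by move=> [M0 ->]; exists (M0 i j); rewrite mxE. Qed.

Lemma rational_mulmx a b c (M : 'M[R]_(a, b)) (N : 'M[R]_(b, c)) :
  rational_mx M -> rational_mx N -> rational_mx (M *m N).
Proof. by move=> [M0 ->] [N0 ->]; exists (M0 *m N0); rewrite map_mxM. Qed.

Lemma rational_sub a b (M N : 'M[R]_(a, b)) :
  rational_mx M -> rational_mx N -> rational_mx (M - N).
Proof. by move=> [M0 ->] [N0 ->]; exists (M0 - N0); rewrite map_mxB. Qed.

Lemma rational_scale a b (M : 'M[R]_(a, b)) (q : rat) :
  rational_mx M -> rational_mx (ratr q *: M).
Proof. by move=> [M0 ->]; exists (q *: M0); rewrite map_mxZ. Qed.

Lemma rational1 a : rational_mx (1%:M : 'M[R]_a).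
Proof. by exists 1%:M; rewrite map_mx1. Qed.

Lemma rational_tr a b (M : 'M[R]_(a, b)) : rational_mx M -> rational_mx M^T.
Proof. by move=> [M0 ->]; exists M0^T; rewrite map_trmx. Qed.

(** Among the powers of g two lie in the same coset. *)
Lemma finite_index_power m (G K : set 'M[R]_m.+1) g :
    subgroup G -> subgroup K -> finite_index K G -> G g ->
  exists2 d, (0 < d)%N & K (g ^+ d).
Proof.
move=> sG [uK K1 KM KV] [KG [s [sGs sP]]] Gg; have [uG _ _ _] := sG.
have GX k : G (g ^+ k) by apply: subgroupX.
have coset k : exists i : 'I_(size s), K ((nth 1 s i)^-1 * g ^+ k).
  have [h hs Kh] := sP _ (GX k); rewrite -index_mem in hs.
  by exists (Ordinal hs); rewrite /= nth_index // -index_mem.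
have [c cP] := choice coset.
have /injectivePn[k [l kl ckl]] : ~~ injectiveb (fun k : 'I_(size s).+1 => c k).
  by apply/negP => /injectiveP/leq_card; rewrite !card_ord ltnn.
have main (i j : nat) : (i < j)%N -> c i = c j -> K (g ^+ (j - i)).
  move=> ij cij; have Ki := cP i; have Kj := cP j; rewrite -cij in Kj.
  have := KM _ _ (KV _ Ki) Kj.
  set h := nth 1 s (c i); have uh : h \is a GRing.unit.
    by apply/uG/sGs/mem_nth.
  have ui : g ^+ i \is a GRing.unit by apply/uG.
  rewrite invrM ?unitrV // invrK mulrA mulrK //.
  by rewrite -{1}(subnK (ltnW ij)) addnC exprD mulKr.
have [lt_kl|lt_lk|eq_kl] := ltngtP k l.
- by exists (l - k)%N; [rewrite subn_gt0 | apply: main].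
- by exists (k - l)%N; [rewrite subn_gt0 | apply: main].
- by case/eqP: kl; apply: val_inj.
Qed.

End RationalMatrices.

Section Logarithm.
Variables (R : realType) (n : nat) (A : 'M[rat]_n.+2) (xi : 'cV[R]_n.+2).
Variable P : 'M[R]_(1 + (1 + n)).
Hypothesis frameP : is_null_frame (realmx R A) xi P.

Let uP : P \in unitmx. Proof. by case: frameP. Qed.

Definition null_log (w : 'cV[R]_n) : 'M[R]_(1 + (1 + n)) :=
  block_mx 0 (row_mx 0 w^T) 0 (block_mx 0 0 w 0).

Definition frame_log w : 'M[R]_n.+2 := P *m null_log w *m invmx P.

Lemma null_logZ c w : null_log (c *: w) = c *: null_log w.
Proof.
by rewrite /null_log !scale_block_mx scale_row_mx !scaler0 linearZ.
Qed.

(** A parabolic translation is unipotent of degree 3, so its logarithm is a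
polynomial in it. *)
Lemma horo_mx_log w : let M := horo_mx (euclidean 1%:M w) - 1%:M in
  M - 2^-1 *: (M *m M) = null_log w.
Proof.
move=> M; have ME : M = block_mx 0 (row_mx (2^-1 *: (w^T *m w)) w^T) 0 (block_mx 0 0 w 0).
  rewrite /M /horo_mx lin_euclidean trans_euclidean mulmx1.
  rewrite [X in _ - X](@scalar_mx_block _ 1 (1 + n)) opp_block_mx add_block_mx.
  rewrite subrr !subr0; congr block_mx.
  rewrite [X in _ - X](@scalar_mx_block _ 1 n) /euclidean opp_block_mx add_block_mx.
  by rewrite !subrr oppr0 !addr0.
have MM : M *m M = block_mx 0 (row_mx (w^T *m w) 0) 0 0.
  rewrite ME mulmx_block !(mulmx0, mul0mx, addr0, add0r) mul_row_block mulmx_block.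
  by rewrite !(mulmx0, mul0mx, addr0, add0r) block_mx0.
rewrite MM ME /null_log scale_block_mx scale_row_mx !scaler0 opp_block_mx opp_row_mx.
by rewrite add_block_mx add_row_mx !oppr0 !addr0 subrr.
Qed.

(** Some power of g is a rational matrix, and its logarithm is a multiple of that
of g. *)
Lemma rational_log (Gamma : set 'M[R]_n.+2) (e : 'cV[R]_n.+2) g w :
    subgroup Gamma -> Gamma `<=` Oplus A e ->
    (exists G, [/\ subgroup G, G `<=` OplusQ A e & commensurable Gamma G]) ->
    Gamma g -> g *m xi = xi -> rho P g = euclidean 1%:M w ->
  rational_mx (frame_log w).
Proof.
move=> sG OG [G [sG' GQ [fin _]]] Gg gxi gw.
have sK : subgroup (Gamma `&` G).
  have [u1 o1 M1 V1] := sG; have [u2 o2 M2 V2] := sG'; split=> //.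
  - by move=> h [/u1].
  - by move=> h k [? ?] [? ?]; split; [apply: M1 | apply: M2].
  - by move=> h [? ?]; split; [apply: V1 | apply: V2].
have [d d0 [_ /GQ[_ [g0 g0E]]]] := finite_index_power sG sK fin Gg.
have [dE dxi] := rhoX frameP sG OG d Gg gxi.
have eucX k : euclidean 1%:M w ^+ k = euclidean 1%:M (w *+ k).
  elim: k => [|k IHk]; first by rewrite expr0 mulr0n euclidean1.
  by rewrite exprS IHk euclideanM mul1mx mul1mx mulrS addrC.
rewrite gw eucX in dE.
have [_ gdE] := rhoP frameP (cusp_stab OG (subgroupX d sG Gg) dxi).
rewrite dE in gdE.
pose M := horo_mx (euclidean 1%:M (w *+ d)) - 1%:M.
have PMP : P *m M *m invmx P = g ^+ d - 1%:M.
  by rewrite gdE mulmxBr mulmxBl mulmx1 mulmxV.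
have logE : M - 2^-1 *: (M *m M) = null_log (w *+ d) by apply: horo_mx_log.
clearbody M.
have ratM : rational_mx (P *m M *m invmx P).
  by rewrite PMP; apply: rational_sub; [exists g0 | apply: rational1].
have -> : frame_log w = ratr d%:R^-1 *: (P *m M *m invmx P -
    ratr 2^-1 *: ((P *m M *m invmx P) *m (P *m M *m invmx P))).
  have -> : P *m M *m invmx P *m (P *m M *m invmx P) = P *m (M *m M) *m invmx P.
    by rewrite -!mulmxA (mulmxA (invmx P) P) mulVmx // mul1mx !mulmxA.
  have -> : P *m M *m invmx P - ratr 2^-1 *: (P *m (M *m M) *m invmx P) =
      frame_log (w *+ d).
    rewrite /frame_log -logE.
    rewrite mulmxBr mulmxBl -scalemxAr -scalemxAl.
    by rewrite fmorphV /= ratr_nat.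
  rewrite -scaler_nat /frame_log null_logZ -scalemxAr -scalemxAl.
  rewrite scalerA fmorphV /= ratr_nat mulVf ?scale1r // pnatr_eq0 -lt0n //.
by apply/rational_scale/rational_sub => //; apply/rational_scale/rational_mulmx.
Qed.

Lemma rational_base_point : exists x0 : 'cV[R]_n.+2,
  rational_mx x0 /\ coord_eta P x0 != 0.
Proof.
pose i : 'I_(1 + (1 + n)) := rshift 1 (lshift n 0).
have etaE x : coord_eta P x = (invmx P *m x) i 0 by rewrite /coord_eta mxE mxE.
have [[j Pij]|all0] := pselect (exists j, invmx P i j != 0).
  exists (delta_mx j 0); split; last by rewrite etaE -colE mxE.
  apply: rational_entries => k l; rewrite mxE.
  by exists ((k == j) && (l == 0))%:R; rewrite ratr_nat.
have rowi : row i (invmx P) = 0.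
  apply/matrixP=> k j; rewrite !mxE; apply: contrapT => /eqP Pij.
  by apply: all0; exists j.
have : row i (invmx P *m P) = 0 by rewrite row_mul rowi mul0mx.
rewrite mulVmx // => /matrixP/(_ 0 i); rewrite !mxE eqxx => /eqP.
by rewrite oner_eq0.
Qed.

Lemma rational_bform (x y : 'cV[R]_n.+2) : rational_mx x -> rational_mx y ->
  exists q, bform A x y = ratr q.
Proof.
move=> rx ry; apply: (@rational_entry R 1 1); apply: rational_mulmx => //.
by apply: rational_mulmx; [exact: rational_tr | exists A].
Qed.

Section Basis.
Variable x0 : 'cV[R]_n.+2.
Let s := coord_eta P x0.

Definition log_vec w : 'cV[R]_n.+2 := frame_log w *m x0.

Lemma log_vecE w :
  log_vec w = P *m col_mx (w^T *m coord_w P x0) (col_mx 0 (s *: w)).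
Proof.
have [a x0E] := coord_expand frameP x0.
rewrite /log_vec /frame_log {1}x0E -!mulmxA mulKmx //; congr (_ *m _).
rewrite /null_log mul_block_col mul_row_col mul_block_col.
by rewrite !mul0mx !add0r addr0 mul_mx_scalar.
Qed.

Lemma log_vec_gram w w' : bform A (log_vec w) (log_vec w') = s ^+ 2 * (w^T *m w') 0 0.
Proof.
rewrite !log_vecE [w^T *m coord_w _ _]mx11_scalar [w'^T *m _]mx11_scalar.
have -> : (0 : 'M[R]_1) = (0 : R)%:M by rewrite raddf0.
rewrite (bform_coord frameP) null_product [(s *: w)^T]linearZ /= -scalemxAl -scalemxAr.
by rewrite scalerA mxE expr2; ring.
Qed.

Lemma log_vec_xi w : frame_log w *m log_vec w = (s * (w^T *m w) 0 0) *: xi.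
Proof.
rewrite log_vecE /frame_log -!mulmxA mulKmx // /null_log mul_block_col mul_row_col.
rewrite mul_block_col !(mul0mx, mulmx0, add0r, addr0) col_mx0 -scalemxAr.
have [_ _ <-] := frameP; rewrite [in LHS](mx11_scalar (w^T *m w)) scalemxAr scale_col_mx scaler0.
by rewrite !scale_scalar_mx mulr1.
Qed.

End Basis.

(** Elimination of the (0, 1) blocks leaves the identity and J' - r^T r. *)
Lemma det_null_form : \det (null_form R n) = -1.
Proof.
pose r : 'rV[R]_(1 + n) := row_mx (- 1%:M) 0.
pose J' : 'M[R]_(1 + n) := block_mx 0 0 0 1%:M.
have rr : r^T *m r = block_mx 1%:M 0 0 0.
  rewrite /r tr_row_mx linearN /= trmx1 trmx0 mul_col_row mulNmx mulmxN opprK.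
  by rewrite mul1mx !mul0mx mulmx0.
have JE : null_form R n *m block_mx 1%:M 0 r^T 1%:M =
    block_mx 1%:M 0 r^T 1%:M *m block_mx 1%:M r 0 (J' - r^T *m r).
  rewrite /null_form -/r -/J' !mulmx_block.
  rewrite !(mulmx1, mul1mx, mulmx0, mul0mx, addr0, add0r).
  have -> : r *m r^T = 1%:M.
    rewrite /r tr_row_mx linearN /= trmx1 trmx0 mul_row_col mulNmx mulmxN opprK.
    by rewrite mul1mx mul0mx addr0.
  congr block_mx.
    have -> : J' *m r^T = 0.
      rewrite /J' /r tr_row_mx trmx0 mul_block_col.
      by rewrite !mul0mx !mulmx0 !addr0 col_mx0.
    by rewrite addr0 /r tr_row_mx linearN /= trmx1 trmx0.
  by rewrite addrCA subrr addr0.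
move/(congr1 (fun M : 'M[R]_(1 + (1 + n)) => \det M)): JE.
rewrite !det_mulmx !det_lblock det_ublock !det1 !mul1r !mulr1 => ->.
rewrite rr /J' opp_block_mx add_block_mx !oppr0 !addr0 add0r det_ublock det1 mulr1.
by rewrite det_mx11 !mxE.
Qed.

(** The vectors xi0 = (log t)^2 x0, on the line of xi, then x0 and the
(log t_i) x0 form a rational basis.  Since the (log t_i) x0 are orthogonal to xi,
A is the sum of a hyperbolic plane and of their Gram matrix G0.  The determinants
are compared through the null frame, in which the basis has the matrix U. *)
Lemma disc_cusp_form (W : 'M[R]_n) x0 : (0 < n)%N -> row_free W ->
    rational_mx x0 -> coord_eta P x0 != 0 ->
    (forall i, rational_mx (frame_log (row i W)^T)) ->
  exists (G0 : 'M[rat]_n) (q r : rat), [/\ q != 0, r != 0, \det G0 != 0,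
    \det A * q ^+ 2 = - (r ^+ 2 * \det G0) &
    map_mx ratr G0 = coord_eta P x0 ^+ 2 *: (W *m W^T)].
Proof.
move=> n0 freeW rx0 s0 ratW; set s := coord_eta P x0 in s0 *.
pose i0 := Ordinal n0; pose w0 : 'cV[R]_n := (row i0 W)^T.
have uW : W \in unitmx by rewrite -row_free_unit.
have rlog i : rational_mx (log_vec x0 (row i W)^T) by apply: rational_mulmx.
have gramE i j : ((row i W)^T^T *m (row j W)^T) 0 0 = (W *m W^T) i j.
  by rewrite trmxK !mxE; apply: eq_bigr => k _; rewrite !mxE.
have [G0 G0E] : rational_mx (s ^+ 2 *: (W *m W^T)).
  apply: rational_entries => i j; rewrite mxE -gramE -log_vec_gram.
  exact: rational_bform.
pose kappa := s * (w0^T *m w0) 0 0.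
have kappa0 : kappa != 0.
  rewrite mulf_neq0 //; apply: contraTneq uW => ww; rewrite unitmxE.
  have w00 : w0 = 0.
    apply: dot_eq0; rewrite [LHS]mx11_scalar ww.
    by apply/matrixP=> i j; rewrite !mxE mul0rn.
  rewrite (expand_det_row W i0) big1 ?unitr0 // => j _.
  by move/matrixP/(_ j 0): w00; rewrite !mxE => ->; rewrite mul0r.
pose xi0 := frame_log w0 *m log_vec x0 w0.
have rxi0 : rational_mx xi0 by apply: rational_mulmx; [exact: ratW | exact: rlog].
have xi0E : xi0 = P *m col_mx kappa%:M 0.
  rewrite /xi0 log_vec_xi -/kappa; have [_ _ <-] := frameP.
  by rewrite scalemxAr scale_col_mx scaler0 scale_scalar_mx mulr1.
have [a x0E] := coord_expand frameP x0.
pose b : 'rV[R]_n := (W *m coord_w P x0)^T.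
pose U : 'M[R]_(1 + (1 + n)) := block_mx kappa%:M (row_mx a%:M b) 0
  (block_mx s%:M 0 (coord_w P x0) (s *: W^T)).
have detU : \det U = kappa * s * \det (s *: W^T).
  by rewrite det_ublock det_lblock !det_scalar1 mulrA.
have [Q QE] : rational_mx (P *m U).
  have -> : U = row_mx (col_mx kappa%:M 0) (row_mx (col_mx a%:M (col_mx s%:M (coord_w P x0)))
      (col_mx b (col_mx 0 (s *: W^T)))).
    by rewrite /U block_mxEh block_mxEh -block_mxEv block_mxEh.
  rewrite !mul_mx_row -x0E -xi0E.
  have [X XE] : rational_mx (P *m col_mx b (col_mx 0 (s *: W^T))).
    apply: rational_entries => i j.
    have -> : (P *m col_mx b (col_mx 0 (s *: W^T))) i j = log_vec x0 (row j W)^T i 0.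
      rewrite log_vecE !mxE; apply: eq_bigr => k _; congr (_ * _).
      case: (split_ordP k) => k1 ->; rewrite ?col_mxEu ?col_mxEd.
        by rewrite (ord1 k1) /b trmxK !mxE; apply: eq_bigr => l _; rewrite !mxE.
      case: (split_ordP k1) => k2 ->; rewrite ?col_mxEu ?col_mxEd; first by rewrite !mxE.
      by rewrite !mxE.
    exact: rational_entry.
  have [x1 x1E] := rx0; have [x2 x2E] := rxi0.
  by exists (row_mx x2 (row_mx x1 X)); rewrite XE x1E x2E !map_row_mx.
have [r rE] := rational_bform rxi0 rx0.
have {}rE : kappa * s = ratr (- r).
  rewrite rmorphN /= -rE xi0E x0E.
  have -> : (0 : 'cV[R]_(1 + n)) = col_mx (0 : R)%:M 0 by rewrite raddf0 col_mx0.
  by rewrite (bform_coord frameP) null_product -/s trmx0 mul0mx mxE; ring.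
have detG0 : ratr (\det G0) = \det (s *: W^T) ^+ 2 :> R.
  rewrite -det_map_mx -G0E.
  have -> : s ^+ 2 *: (W *m W^T) = (s *: W^T)^T *m (s *: W^T).
    by rewrite [(s *: W^T)^T]linearZ /= trmxK -scalemxAl -scalemxAr scalerA expr2.
  by rewrite det_mulmx det_tr.
have dW0 : \det (s *: W^T) != 0.
  by rewrite detZ det_tr mulf_neq0 ?expf_neq0 // -unitfE -unitmxE.
have detQ : ratr (\det Q) = \det P * \det U :> R.
  by rewrite -det_map_mx -QE det_mulmx.
have detP : \det (realmx R A) * \det P ^+ 2 = -1.
  rewrite -det_null_form; have [_ <- _] := frameP.
  by rewrite !det_mulmx det_tr; ring.
exists G0, (\det Q), r; split=> //.
- rewrite -(fmorph_eq0 (@ratr R)) /= detQ mulf_neq0 //.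
    by rewrite -unitfE -unitmxE.
  by rewrite detU mulf_neq0 // mulf_neq0.
- by rewrite -oppr_eq0 -(fmorph_eq0 (@ratr R)) /= -rE mulf_neq0.
- by rewrite -(fmorph_eq0 (@ratr R)) /= detG0 expf_neq0.
apply: (fmorph_inj (@ratr R)).
rewrite rmorphN (rmorphM _ (\det A)) (rmorphM _ (r ^+ 2)) !rmorphXn /= detQ detG0.
have -> : ratr r ^+ 2 = (kappa * s) ^+ 2 :> R by rewrite rE rmorphN sqrrN.
rewrite -det_map_mx -/(realmx R A) exprMn mulrA detP detU; ring.
Qed.

End Logarithm.

(** * The discriminant *)

Lemma sqclass_mul_square (a b : rat) : b != 0 -> sqclass (a * b ^+ 2) = sqclass a.
Proof.
move=> b0; apply/seteqP; split=> _ [c /= c0 <-].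
  by exists (b * c); rewrite /= ?mulf_neq0 // exprMn mulrA.
exists (c / b); first by rewrite /= mulf_neq0 // invr_eq0.
by rewrite expr_div_n; field.
Qed.

(** The trivial group, the only one acting by isometries on a point, has trivial
holonomy. *)
Lemma flat_dim_gt0 (R : realType) (n p k : nat) (pi : set 'M[R]_n.+1) :
  prime p -> (0 < k)%N -> compact_flat_manifold pi -> holonomy_isom pi 'rV['F_p]_k ->
  (0 < n)%N.
Proof.
move=> p_pr k0 flat_pi [f [_ f_surj _]]; rewrite lt0n; apply/eqP => n0; subst n.
have trivial g : pi g -> g = 1.
  move=> /(flat_isometry flat_pi)/isometryE->; rewrite -euclidean1.
  by congr euclidean; apply/matrixP=> -[].
have [[g pg fg] [h ph fh]] := (f_surj 0, f_surj (const_mx 1)).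
have : const_mx 1 = 0 :> 'rV['F_p]_k by rewrite -fg -fh (trivial g) // (trivial h).
by move/matrixP/(_ 0 (Ordinal k0))/eqP; rewrite !mxE oner_eq0.
Qed.

(** The coordinates in the basis W of the images of its vectors under L are read
off from their Gram products with the basis. *)
Lemma rational_holonomy (R : realType) n (W L : 'M[R]_n) (G0 : 'M[rat]_n) (c : R) :
    row_free W -> map_mx ratr G0 = c *: (W *m W^T) -> \det G0 != 0 ->
    rational_mx (c *: (W *m L^T *m W^T)) ->
  exists C : 'M[rat]_n, map_mx ratr C = W *m L^T *m invmx W.
Proof.
move=> freeW GE nzG0 [K KE]; have uW : W \in unitmx by rewrite -row_free_unit.
exists (K *m invmx G0).
have uG : G0 \in unitmx by rewrite unitmxE unitfE.
rewrite map_mxM map_invmx -KE.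
have -> : c *: (W *m L^T *m W^T) = W *m L^T *m invmx W *m map_mx ratr G0.
  by rewrite GE -scalemxAr !mulmxA mulmxKV.
by rewrite mulmxK // map_unitmx.
Qed.

Theorem theorem1p6 (R : realType) (p k n : nat)
    (pi : set 'M[R]_n.+1)
    (A : 'M[rat]_n.+2) (e : 'cV[R]_n.+2) (Gamma : set 'M[R]_n.+2) :
  prime p -> odd p -> (2 <= k)%N ->
  compact_flat_manifold pi ->
  first_betti pi 0 ->
  holonomy_isom pi 'rV['F_p]_k ->
  rational_form A -> signature_n1 R A ->
  qform A e = -1 ->
  quasi_arithmetic_manifold A e Gamma ->
  cusp_cross_section A e pi Gamma ->
  (n = 0 %[mod 2 * (p - 1)] /\ disc A = sqclass (-1)) \/
  (n = p - 1 %[mod 2 * (p - 1)] /\ disc A = sqclass (- p%:R)).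
Proof.
move=> p_pr p_odd k2 flat_pi b1 hol [symA detA] sigA qe.
move=> [[sG OG] dG tfG _ commG] [xi cusp_xi diffeo].
have n0 : (0 < n)%N by apply: flat_dim_gt0 hol => //; apply: leq_trans k2.
have [[qxi xi_neg] _ _] := cusp_xi.
have xi0 : xi != 0.
  apply/eqP => xi0; have : bform A e xi < 0.
    by apply: xi_neg; split; rewrite // -/(qform A e) qe ltrN10.
  by rewrite xi0 /bform mulmx0 mxE ltxx.
have [P frameP] : exists P, is_null_frame (realmx R A) xi P.
  apply: null_frame_exists => //; rewrite [LHS]mx11_scalar -[X in X%:M]/(qform A xi) qxi.
  exact: raddf0.
have sD := cusp_group_subgroup frameP sG OG.
have isoD := @cusp_group_isometry _ _ _ _ _ _ frameP _ OG.
have dD := cusp_group_discrete frameP OG dG.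
have [phi [phiD phiM phi_inj]] :=
  cross_section_injection frameP qe sG OG dG tfG cusp_xi flat_pi diffeo.
have [_ [W [freeW WP]]] :=
  transported_translations flat_pi hol sD isoD dD phiD phiM phi_inj.
pose L g := hol_lin phi g.
have uW : W \in unitmx by rewrite -row_free_unit.
have [_ _ pM pV] := flat_subgroup flat_pi.
have ratl t w : pi t -> phi t = euclidean 1%:M w -> rational_mx (frame_log P w).
  move=> pt tw; have [g [Gg gxi] gE] := phiD t pt.
  by apply: (rational_log frameP sG OG commG Gg gxi); rewrite gE.
have ratW i : rational_mx (frame_log P (row i W)^T).
  by have [t pt tE] := WP i; apply: ratl tE.
have [x0 [rx0 s0]] := rational_base_point frameP.
have [G0 [q [r [q0 r0 detG0 detE G0E]]]] := disc_cusp_form frameP n0 freeW rx0 s0 ratW.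
set s := coord_eta P x0 in s0 G0E.
have ratL g : pi g -> exists C : 'M[rat]_n, map_mx ratr C = W *m (L g)^T *m invmx W.
  move=> pg; apply: (rational_holonomy freeW G0E detG0).
  apply: rational_entries => i j; have [t pt tE] := WP i.
  have rgt : rational_mx (frame_log P (L g *m (row i W)^T)).
    apply: (ratl (g * t * g^-1)); first exact: (pM _ _ (pM _ _ pg pt) (pV _ pg)).
    exact: (hol_lin_conj flat_pi isoD phiD phiM).
  have [q' q'E] : exists q', bform A (log_vec P x0 (L g *m (row i W)^T))
      (log_vec P x0 (row j W)^T) = ratr q'.
    by apply: rational_bform; apply: rational_mulmx.
  exists q'; rewrite -q'E (log_vec_gram frameP) mxE; congr (_ * _).
  rewrite trmx_mul trmxK -row_mul [LHS]mxE [RHS]mxE; apply: eq_bigr => l _.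
  by rewrite [row _ _ _ _]mxE [(row j W)^T _ _]mxE [row _ _ _ _]mxE [W^T _ _]mxE.
(* The holonomy, in the basis W, as rational matrices acting on rows. *)
pose S (C : 'M[rat]_n) := exists2 g, pi g & map_mx ratr C = W *m (L g)^T *m invmx W.
have conjM (X Y : 'M[R]_n) :
    W *m X *m invmx W *m (W *m Y *m invmx W) = W *m (X *m Y) *m invmx W.
  by rewrite !mulmxA mulmxKV.
have ratr_mx_inj : injective (map_mx (ratr : rat -> R) : 'M[rat]_n -> 'M[R]_n).
  by move=> X Y /matrixP XY; apply/matrixP=> i j; have := XY i j; rewrite !mxE => /fmorph_inj.
have [||||||m [c [nE detG]]] := @det_form_exponent_p p n G0 S p_pr p_odd.
- by apply: ratr_mx_inj; rewrite -map_trmx G0E [(_ *: _)^T]linearZ /= trmx_mul trmxK.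
- exact: detG0.
- move=> C [g pg CE]; apply: ratr_mx_inj; rewrite !map_mxM -map_trmx CE G0E.
  rewrite !trmx_mul trmxK -scalemxAr -scalemxAl; congr (_ *: _).
  rewrite !mulmxA mulmxKV // -!mulmxA (mulmxA W^T) -trmx_mul mulVmx // trmx1 mul1mx.
  rewrite (mulmxA (L g)^T) lin_orthogonal ?mul1mx //; exact/isoD/phiD.
- move=> C [g pg CE]; apply: ratr_mx_inj; rewrite map_mx1.
  have CX i : map_mx ratr (C ^+ i) = W *m (L g ^+ i)^T *m invmx W.
    elim: i => [|i IHi]; first by rewrite !expr0 map_mx1 trmx1 mulmx1 mulmxV.
    by rewrite exprS exprSr -!mulmxE map_mxM CE IHi conjM trmx_mul.
  rewrite CX (hol_lin_exponent flat_pi hol sD isoD dD phiD phiM phi_inj pg) //.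
    by rewrite trmx1 mulmx1 mulmxV.
  by move=> v; rewrite -scaler_nat pchar_Fp_0 ?scale0r.
- move=> C C' [g pg CE] [g' pg' CE']; apply: ratr_mx_inj; rewrite !map_mxM CE CE'.
  by rewrite !conjM -!trmx_mul (hol_lin_comm flat_pi hol sD isoD dD phiD phiM phi_inj pg pg').
- move=> x fx; pose y : 'rV[R]_n := map_mx ratr x *m W.
  have y0 : y^T = 0.
    apply: (hol_lin_fixed flat_pi hol sD isoD dD phiD phiM phi_inj b1) => g pg.
    have [C CE] := ratL g pg; have xC : x *m C = x by apply: fx; exists g.
    rewrite -[hol_lin _ _]trmxK -trmx_mul; congr (_^T).
    by rewrite /y -{2}xC map_mxM CE -!mulmxA mulVmx // mulmx1.
  have : map_mx ratr x = 0 :> 'rV[R]_n.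
    by rewrite -[LHS](mulmxK uW) -/y -[y]trmxK y0 trmx0 mul0mx.
  move=> /matrixP x0'; apply/matrixP=> i j; have := x0' i j; rewrite !mxE => /eqP.
  by rewrite fmorph_eq0 => /eqP.
have c0 : c != 0.
  by apply: contraNneq detG0 => c0; rewrite detG c0 expr0n mulr0.
have pn0 : (p%:R : rat) != 0 by rewrite pnatr_eq0 -lt0n prime_gt0.
have discE (b : rat) h : h != 0 -> - (r ^+ 2 * (p%:R ^+ m * c ^+ 2)) = b * h ^+ 2 ->
    disc A = sqclass b.
  move=> h0 bh; rewrite /disc -(sqclass_mul_square _ q0) detE detG bh.
  exact: sqclass_mul_square.
rewrite subn1; have mE := odd_double_half m; set h := m./2 in mE.
have pm : p%:R ^+ m = p%:R ^+ odd m * (p%:R ^+ h) ^+ 2 :> rat.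
  by rewrite -[in LHS]mE exprD -muln2 exprM.
have h0 : r * c * p%:R ^+ h != 0 by rewrite mulf_neq0 ?mulf_neq0 ?expf_neq0.
case m_odd : (odd m) in mE pm.
  right; split; last by apply: (discE _ _ h0); rewrite pm expr1; ring.
  by rewrite nE -mE mulnDl mul1n -mul2n addnC mulnAC [(_ * h)%N]mulnC modnMDl.
left; split; last by apply: (discE _ _ h0); rewrite pm expr0; ring.
by rewrite nE -mE add0n -mul2n mulnAC modnMr mod0n.
Qed.
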